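(* Let $M$ be a normal metric contact pair manifold of type $(p,q)$ and dimension $m=2p+2q+2$. Then $M$ is a generalized quasi-Einstein manifold if and only if there exists a function $\lambda$ on $M$ such that at every point $Q\in M$ (with $\lambda$ and $Z_1,Z_2$ evaluated at $Q$): (i) $scal(P)+p+q-\lambda=scal(P^{\bot})$ for every $(p+q+1)$-plane section $P\subset T_QM$ with $Z_1,Z_2\in P^{\bot}$; (ii) $scal(N)+p+q=scal(N^{\bot})$ for every $(p+q)$-plane section $N\subset T_QM$ with $Z_1,Z_2\in N^{\bot}$; (iii) $scal(R)+q-p=scal(R^{\bot})$ for every $(p+q+1)$-plane section $R\subset T_QM$ with $Z_1\in R$ and $Z_2\in R^{\bot}$; where $P^{\bot},N^{\bot},R^{\bot}$ denote the orthogonal complements of $P,N,R$ in $T_QM$.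
   Context: A contact pair of type $(p,q)$ ($p,q$ positive integers) on a differentiable manifold $M$ of dimension $m=2p+2q+2$ is a pair of $1$-forms $(\alpha_1,\alpha_2)$ with $\alpha_1\wedge(d\alpha_1)^p\wedge\alpha_2\wedge(d\alpha_2)^q\neq 0$ everywhere, $(d\alpha_1)^{p+1}=0$ and $(d\alpha_2)^{q+1}=0$. Its Reeb vector fields $Z_1,Z_2$ are the unique vector fields with $\alpha_i(Z_j)=\delta_{ij}$ and $i_{Z_i}d\alpha_j=0$ for $i,j\in\{1,2\}$. An almost contact pair structure is $(\alpha_1,\alpha_2,\phi)$ with $\phi$ a $(1,1)$-tensor field satisfying $\phi^2=-I+\alpha_1\otimes Z_1+\alpha_2\otimes Z_2$ and $\phi Z_1=\phi Z_2=0$ (then $\phi$ has rank $2p+2q$ and $\alpha_i\circ\phi=0$). Throughout, $\phi$ is assumed decomposable, i.e. $T\mathcal F_i=\ker\alpha_i\cap\ker d\alpha_i$ is $\phi$-invariant for $i=1,2$. A Riemannian metric $g$ is associated if $g(X,\phi Y)=(d\alpha_1+d\alpha_2)(X,Y)$ and $g(X,Z_i)=\alpha_i(X)$ for $i=1,2$; with such $g$, $(M,\phi,Z_1,Z_2,\alpha_1,\alpha_2,g)$ is a metric (almost) contact pair manifold. Here $d\alpha(X,Y)=\frac12\big(X\alpha(Y)-Y\alpha(X)-\alpha([X,Y])\big)$. It is normal if the almost complex structures $J=\phi-\alpha_2\otimes Z_1+\alpha_1\otimes Z_2$ and $T=\phi+\alpha_2\otimes Z_1-\alpha_1\otimes Z_2$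 are both integrable. A normal metric contact pair manifold is generalized quasi-Einstein if there are functions $\lambda,\beta,\mu$ on $M$ with $Ric(X_1,X_2)=\lambda g(X_1,X_2)+\beta\alpha_1(X_1)\alpha_1(X_2)+\mu\alpha_2(X_1)\alpha_2(X_2)$ for all $X_1,X_2\in\Gamma(TM)$, where $Ric$ is the Ricci tensor of $g$. A $k$-plane section at $Q$ is a $k$-dimensional linear subspace of $T_QM$. For a subspace $\mathcal L\subset T_QM$ of dimension $k\ge 2$ with orthonormal basis $E_1,\dots,E_k$, $scal(\mathcal L)=\sum_{1\le i<j\le k}Sec(E_i\wedge E_j)$, where $Sec(E_i\wedge E_j)$ is the sectional curvature of the plane spanned by $E_i,E_j$. *)

(* Defs.v *)
From HB Require Import structures.
From mathcomp Require Import all_boot all_order all_algebra all_fingroup.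
From mathcomp Require Import all_classical all_reals all_analysis.

Set Implicit Arguments.
Unset Strict Implicit.
Unset Printing Implicit Defensive.

Import Order.TTheory GRing.Theory Num.Theory.
Import numFieldNormedType.Exports.

Local Open Scope classical_set_scope.
Local Open Scope ring_scope.

Fixpoint Ck_on (R : realType) (V W : normedModType R) (k : nat) (U : set V)
    (f : V -> W) : Prop :=
  match k with
  | 0%N => forall x, U x -> {for x, continuous f}
  | k'.+1 => (forall x, U x -> differentiable f x)
             /\ (forall v, Ck_on k' U ('D_v f))
  end.

Definition smooth_on (R : realType) (V W : normedModType R) (U : set V)
    (f : V -> W) : Prop :=
  forall k, Ck_on k U f.

(** Both maps are total functions; only the values of [chart_map] on
    [chart_dom] and of [chart_inv] on [chart_cod] are meaningful. *)
Record chart (R : realType) (m : nat) (M : topologicalType) := Chart {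
  chart_dom : set M;
  chart_map :> M -> 'rV[R]_m;
  chart_inv : 'rV[R]_m -> M }.

Definition chart_cod (R : realType) (m : nat) (M : topologicalType)
    (c : chart R m M) : set 'rV[R]_m :=
  c @` chart_dom c.

Definition is_chart (R : realType) (m : nat) (M : topologicalType)
    (c : chart R m M) : Prop :=
  [/\ open (chart_dom c), open (chart_cod c),
      {in chart_dom c, cancel c (chart_inv c)},
      forall Q, chart_dom c Q -> {for Q, continuous c} &
      forall x, chart_cod c x -> {for x, continuous (chart_inv c)}].

Definition transition (R : realType) (m : nat) (M : topologicalType)
    (c d : chart R m M) : 'rV[R]_m -> 'rV[R]_m :=
  d \o chart_inv c.

Record manifold (R : realType) (m : nat) := Manifold {
  mpoint :> topologicalType;
  mhausdorff : hausdorff_space mpoint;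
  msecond_countable : @second_countable mpoint;
  atlas : set (chart R m mpoint);
  atlas_chart : forall c, atlas c -> is_chart c;
  atlas_cover : forall Q : mpoint, exists2 c, atlas c & chart_dom c Q;
  atlas_smooth : forall c d, atlas c -> atlas d ->
    smooth_on (c @` (chart_dom c `&` chart_dom d)) (transition c d) }.

(** A chart [c] around [Q] identifies the tangent space at [Q] with ['rV_m].
    A tensor field is given by its components in every chart, as functions of
    the coordinates [x], subject to the usual transformation law under the
    differential of the transition map. *)

Definition change (R : realType) (m : nat) (M : manifold R m)
    (c d : chart R m M) (Q : M) (u : 'rV[R]_m) : 'rV[R]_m :=
  'd (transition c d) (c Q) u.

Definition overlap (R : realType) (m : nat) (M : manifold R m)
    (c d : chart R m M) (Q : M) : Prop :=
  [/\ atlas c, atlas d, chart_dom c Q & chart_dom d Q].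

Record vector_field (R : realType) (m : nat) (M : manifold R m) :=
  VectorField {
  vcomp :> chart R m M -> 'rV[R]_m -> 'rV[R]_m;
  vcomp_smooth : forall c, atlas c -> smooth_on (chart_cod c) (vcomp c);
  vcomp_change : forall c d Q, overlap c d Q ->
    vcomp d (d Q) = change c d Q (vcomp c (c Q)) }.

(** The row vector [a] represents the linear form [u |-> \sum_i u_i a_i]. *)
Definition pairing (R : realType) (m : nat) (a u : 'rV[R]_m) : R :=
  \sum_i a 0 i * u 0 i.

Record one_form (R : realType) (m : nat) (M : manifold R m) := OneForm {
  fcomp :> chart R m M -> 'rV[R]_m -> 'rV[R]_m;
  fcomp_smooth : forall c, atlas c -> smooth_on (chart_cod c) (fcomp c);
  fcomp_change : forall c d Q, overlap c d Q -> forall u,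
    pairing (fcomp d (d Q)) (change c d Q u) = pairing (fcomp c (c Q)) u }.

(** Tangent vectors are rows, so the endomorphism with matrix [F] is
    [u |-> u *m F]. *)
Record endo_field (R : realType) (m : nat) (M : manifold R m) := EndoField {
  ecomp :> chart R m M -> 'rV[R]_m -> 'M[R]_m;
  ecomp_smooth : forall c, atlas c -> smooth_on (chart_cod c) (ecomp c);
  ecomp_change : forall c d Q, overlap c d Q -> forall u,
    change c d Q u *m ecomp d (d Q) = change c d Q (u *m ecomp c (c Q)) }.

Definition bilin (R : realType) (m : nat) (G : 'M[R]_m) (u v : 'rV[R]_m) : R :=
  (u *m G *m v^T) 0 0.

Record riemannian_metric (R : realType) (m : nat) (M : manifold R m) :=
  RiemannianMetric {
  gcomp :> chart R m M -> 'rV[R]_m -> 'M[R]_m;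
  gcomp_smooth : forall c, atlas c -> smooth_on (chart_cod c) (gcomp c);
  gcomp_change : forall c d Q, overlap c d Q -> forall u v,
    bilin (gcomp d (d Q)) (change c d Q u) (change c d Q v) =
    bilin (gcomp c (c Q)) u v;
  gcomp_sym : forall c x, atlas c -> chart_cod c x -> forall u v,
    bilin (gcomp c x) u v = bilin (gcomp c x) v u;
  gcomp_pos : forall c x, atlas c -> chart_cod c x -> forall u,
    u != 0 -> 0 < bilin (gcomp c x) u u }.

Definition lie_bracket (R : realType) (m : nat)
    (X Y : 'rV[R]_m -> 'rV[R]_m) : 'rV[R]_m -> 'rV[R]_m :=
  fun x => 'D_(X x) Y x - 'D_(Y x) X x.

Definition ext_d (R : realType) (m : nat) (a X Y : 'rV[R]_m -> 'rV[R]_m)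
    (x : 'rV[R]_m) : R :=
  2^-1 * ('D_(X x) (fun y => pairing (a y) (Y y)) x
          - 'D_(Y x) (fun y => pairing (a y) (X y)) x
          - pairing (a x) (lie_bracket X Y x)).

(** Since [ext_d a X Y x] depends only on [X x] and [Y x], its value on two
    tangent vectors is computed on their constant extensions; likewise for
    [riemann] below. *)
Definition d_at (R : realType) (m : nat) (a : 'rV[R]_m -> 'rV[R]_m)
    (x u v : 'rV[R]_m) : R :=
  ext_d a (fun=> u) (fun=> v) x.

Definition mform (R : realType) (m k : nat) : Type := ('I_k -> 'rV[R]_m) -> R.

Definition mform1 (R : realType) (m : nat) (a : 'rV[R]_m) : mform R m 1 :=
  fun v => pairing a (v ord0).

Definition mform2 (R : realType) (m : nat) (w : 'rV[R]_m -> 'rV[R]_m -> R) :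
    mform R m 2 :=
  fun v => w (v ord0) (v ord_max).

(** Normalised as the alternation of the tensor product, consistently with
    the factor 1/2 in [ext_d]. *)
Definition wedge (R : realType) (m k l : nat) (w : mform R m k)
    (z : mform R m l) : mform R m (k + l) :=
  fun v => ((k + l)`!)%:R^-1 *
    \sum_(s : 'S_(k + l)) (-1) ^+ s *
      (w (fun i => v (s (lshift l i))) * z (fun j => v (s (rshift k j)))).

Fixpoint wedge_exp (R : realType) (m : nat) (w : mform R m 2) (n : nat) :
    mform R m (n * 2) :=
  match n return mform R m (n * 2) with
  | 0%N => fun=> 1
  | n'.+1 => wedge w (@wedge_exp R m w n')
  end.
Arguments wedge_exp {R m} w n v.

(** The i-th entry is [g (nabla_u v, e_i)], by Koszul's formula for the constant
    fields [u], [v], [e_i]. *)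
Definition koszul (R : realType) (m : nat) (g : 'rV[R]_m -> 'M[R]_m)
    (x u v : 'rV[R]_m) : 'rV[R]_m :=
  \row_i (2^-1 * ('D_u (fun y => bilin (g y) v (delta_mx 0 i)) x
                  + 'D_v (fun y => bilin (g y) u (delta_mx 0 i)) x
                  - 'D_(delta_mx 0 i) (fun y => bilin (g y) u v) x)).

Definition christoffel (R : realType) (m : nat) (g : 'rV[R]_m -> 'M[R]_m)
    (x u v : 'rV[R]_m) : 'rV[R]_m :=
  koszul g x u v *m invmx (g x).

Definition nabla (R : realType) (m : nat) (g : 'rV[R]_m -> 'M[R]_m)
    (X Y : 'rV[R]_m -> 'rV[R]_m) : 'rV[R]_m -> 'rV[R]_m :=
  fun x => 'D_(X x) Y x + christoffel g x (X x) (Y x).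

Definition riemann (R : realType) (m : nat) (g : 'rV[R]_m -> 'M[R]_m)
    (X Y Z : 'rV[R]_m -> 'rV[R]_m) : 'rV[R]_m -> 'rV[R]_m :=
  fun x => nabla g X (nabla g Y Z) x - nabla g Y (nabla g X Z) x
           - nabla g (lie_bracket X Y) Z x.

Definition curv (R : realType) (m : nat) (g : 'rV[R]_m -> 'M[R]_m)
    (x u v w : 'rV[R]_m) : 'rV[R]_m :=
  riemann g (fun=> u) (fun=> v) (fun=> w) x.

(** Trace of [w |-> R(w, u) v]. *)
Definition Ric (R : realType) (m : nat) (g : 'rV[R]_m -> 'M[R]_m)
    (x u v : 'rV[R]_m) : R :=
  \sum_i (curv g x (delta_mx 0 i) u v) 0 i.

Definition Sec (R : realType) (m : nat) (g : 'rV[R]_m -> 'M[R]_m)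
    (x u v : 'rV[R]_m) : R :=
  bilin (g x) (curv g x u v v) u /
  (bilin (g x) u u * bilin (g x) v v - bilin (g x) u v ^+ 2).

(** A subspace of the tangent space is given as the row space of a square
    matrix [L]; its dimension is [\rank L]. *)

Definition orthonormal_basis (R : realType) (m : nat) (G L : 'M[R]_m) (k : nat)
    (E : 'M[R]_(k, m)) : Prop :=
  (E == L)%MS /\
  forall i j, bilin G (row i E) (row j E) = (i == j)%:R.

(** Computed on a chosen orthonormal basis; the value does not depend on the
    choice. *)
Definition scal (R : realType) (m : nat) (g : 'rV[R]_m -> 'M[R]_m)
    (x : 'rV[R]_m) (L : 'M[R]_m) : R :=
  let E : 'M[R]_(\rank L, m) := xget 0 [set E | orthonormal_basis (g x) L E] in
  \sum_(i < \rank L) \sum_(j < \rank L | (i < j)%N)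
    Sec g x (row i E) (row j E).

(** Its rows span [{u | g(u, v) = 0 for all v in L}]. *)
Definition orthocomp (R : realType) (m : nat) (G L : 'M[R]_m) : 'M[R]_m :=
  kermx (G *m L^T).

Definition is_contact_pair (R : realType) (m : nat) (M : manifold R m)
    (p q : nat) (a1 a2 : one_form M) : Prop :=
  [/\ (0 < p)%N, (0 < q)%N, m = (2 * p + 2 * q + 2)%N &
   forall c x, atlas c -> chart_cod c x ->
   let da1 := mform2 (d_at (a1 c) x) in
   let da2 := mform2 (d_at (a2 c) x) in
   [/\ exists v,
         wedge (wedge (mform1 (a1 c x)) (wedge_exp da1 p))
               (wedge (mform1 (a2 c x)) (wedge_exp da2 q)) v <> 0,
       forall v, wedge_exp da1 p.+1 v = 0 &
       forall v, wedge_exp da2 q.+1 v = 0]].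

Definition are_reeb_fields (R : realType) (m : nat) (M : manifold R m)
    (a1 a2 : one_form M) (Z1 Z2 : vector_field M) : Prop :=
  forall c x, atlas c -> chart_cod c x ->
  [/\ pairing (a1 c x) (Z1 c x) = 1 /\ pairing (a1 c x) (Z2 c x) = 0,
      pairing (a2 c x) (Z1 c x) = 0 /\ pairing (a2 c x) (Z2 c x) = 1,
      forall u, d_at (a1 c) x (Z1 c x) u = 0 /\ d_at (a1 c) x (Z2 c x) u = 0 &
      forall u, d_at (a2 c) x (Z1 c x) u = 0 /\ d_at (a2 c) x (Z2 c x) u = 0].

Definition is_almost_contact_pair (R : realType) (m : nat) (M : manifold R m)
    (a1 a2 : one_form M) (Z1 Z2 : vector_field M) (phi : endo_field M) : Prop :=
  forall c x, atlas c -> chart_cod c x ->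
  [/\ forall u, u *m phi c x *m phi c x =
        - u + pairing (a1 c x) u *: Z1 c x + pairing (a2 c x) u *: Z2 c x,
      Z1 c x *m phi c x = 0 &
      Z2 c x *m phi c x = 0].

(** Membership in [ker a] and [ker da] at [x]. *)
Definition in_char (R : realType) (m : nat) (a : 'rV[R]_m -> 'rV[R]_m)
    (x u : 'rV[R]_m) : Prop :=
  pairing (a x) u = 0 /\ forall v, d_at a x u v = 0.

Definition is_decomposable (R : realType) (m : nat) (M : manifold R m)
    (a1 a2 : one_form M) (phi : endo_field M) : Prop :=
  forall c x, atlas c -> chart_cod c x -> forall u,
  (in_char (a1 c) x u -> in_char (a1 c) x (u *m phi c x)) /\
  (in_char (a2 c) x u -> in_char (a2 c) x (u *m phi c x)).

Definition is_associated (R : realType) (m : nat) (M : manifold R m)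
    (a1 a2 : one_form M) (Z1 Z2 : vector_field M) (phi : endo_field M)
    (g : riemannian_metric M) : Prop :=
  forall c x, atlas c -> chart_cod c x ->
  [/\ forall u v, bilin (g c x) u (v *m phi c x) =
        d_at (a1 c) x u v + d_at (a2 c) x u v,
      forall u, bilin (g c x) u (Z1 c x) = pairing (a1 c x) u &
      forall u, bilin (g c x) u (Z2 c x) = pairing (a2 c x) u].

(** An almost complex structure, given by its action on the tangent vector [u]
    at the point of coordinates [x] in the chart [c], is integrable when around
    every point there are local complex coordinates [z = f + i h] with
    [dz (J u) = i dz u]; [psi = (f, h)]. *)
Definition mul_i (R : realType) (n : nat) (w : 'rV[R]_(n + n)) :
    'rV[R]_(n + n) :=
  row_mx (- rsubmx w) (lsubmx w).

Definition integrable_acs (R : realType) (m : nat) (M : manifold R m)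
    (J : chart R m M -> 'rV[R]_m -> 'rV[R]_m -> 'rV[R]_m) : Prop :=
  forall c x, atlas c -> chart_cod c x ->
  exists (n : nat) (U : set 'rV[R]_m) (psi : 'rV[R]_m -> 'rV[R]_(n + n))
         (psi' : 'rV[R]_(n + n) -> 'rV[R]_m),
  [/\ [/\ open U, U x & U `<=` chart_cod c],
      [/\ {in U, cancel psi psi'}, open (psi @` U), smooth_on U psi &
          smooth_on (psi @` U) psi'] &
      forall y u, U y -> 'd psi y (J c y u) = mul_i ('d psi y u)].

Definition acs_J (R : realType) (m : nat) (M : manifold R m)
    (a1 a2 : one_form M) (Z1 Z2 : vector_field M) (phi : endo_field M)
    (c : chart R m M) (x u : 'rV[R]_m) : 'rV[R]_m :=
  u *m phi c x - pairing (a2 c x) u *: Z1 c x + pairing (a1 c x) u *: Z2 c x.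

Definition acs_T (R : realType) (m : nat) (M : manifold R m)
    (a1 a2 : one_form M) (Z1 Z2 : vector_field M) (phi : endo_field M)
    (c : chart R m M) (x u : 'rV[R]_m) : 'rV[R]_m :=
  u *m phi c x + pairing (a2 c x) u *: Z1 c x - pairing (a1 c x) u *: Z2 c x.

Record metric_contact_pair (R : realType) (m : nat) (M : manifold R m)
    (p q : nat) := MetricContactPair {
  alpha1 : one_form M;
  alpha2 : one_form M;
  reeb1 : vector_field M;
  reeb2 : vector_field M;
  phi : endo_field M;
  metric : riemannian_metric M;
  mcp_contact : is_contact_pair p q alpha1 alpha2;
  mcp_reeb : are_reeb_fields alpha1 alpha2 reeb1 reeb2;
  mcp_almost : is_almost_contact_pair alpha1 alpha2 reeb1 reeb2 phi;
  mcp_decomposable : is_decomposable alpha1 alpha2 phi;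
  mcp_associated : is_associated alpha1 alpha2 reeb1 reeb2 phi metric }.

Definition is_normal (R : realType) (m : nat) (M : manifold R m) (p q : nat)
    (S : metric_contact_pair M p q) : Prop :=
  integrable_acs (acs_J (alpha1 S) (alpha2 S) (reeb1 S) (reeb2 S) (phi S)) /\
  integrable_acs (acs_T (alpha1 S) (alpha2 S) (reeb1 S) (reeb2 S) (phi S)).

Definition generalized_quasi_einstein (R : realType) (m : nat)
    (M : manifold R m) (p q : nat) (S : metric_contact_pair M p q) : Prop :=
  exists lambda beta mu : M -> R,
  forall c Q, atlas c -> chart_dom c Q -> forall u v : 'rV[R]_m,
  Ric (metric S c) (c Q) u v =
    lambda Q * bilin (metric S c (c Q)) u v
    + beta Q * (pairing (alpha1 S c (c Q)) u * pairing (alpha1 S c (c Q)) v)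
    + mu Q * (pairing (alpha2 S c (c Q)) u * pairing (alpha2 S c (c Q)) v).

(* Main.v *)
Require Import Defs.
From HB Require Import structures.
From mathcomp Require Import all_boot all_order all_algebra all_fingroup.
From mathcomp Require Import all_classical all_reals all_analysis.
From mathcomp Require Import ring lra zify.
Import Order.TTheory GRing.Theory Num.Theory.
Import numFieldNormedType.Exports.
Local Open Scope classical_set_scope.
Local Open Scope ring_scope.

Set Implicit Arguments.
Unset Strict Implicit.
Unset Printing Implicit Defensive.

(** The conditions of the theorem only see the Ricci tensor. In an orthonormal
    basis of [L] completed by one of its complement, Ric(E_i, E_i) is a sum of
    sectional curvatures; when these sums over [L] and over the complement are
    subtracted, the mixed curvatures cancel, so that twice the difference of the
    scalar curvatures is the trace of Ric over [L] minus its trace over the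
    complement ([scal_orthocomp]). The second ingredient is the value of Ric on
    the Reeb fields of a normal metric contact pair ([Ric_reeb]):
      Ric(X, Z_1) = 2p alpha_1(X)   and   Ric(X, Z_2) = 2q alpha_2(X).

    Granting both, the equivalence is linear algebra at each point. If Ric has
    the quasi-Einstein form, then lambda + beta = 2p and lambda + mu = 2q, and
    the three identities follow by counting dimensions ([quasi_einstein_scal]).
    Conversely, let e be a unit vector orthogonal to Z_1 and Z_2, choose N of
    dimension p + q orthogonal to e, Z_1 and Z_2, and subtract (ii) for N from
    (i) for N + e: this leaves Ric(e, e) = lambda. By polarisation Ric is
    lambda g on horizontal vectors, and the values on the Reeb fields are known
    ([scal_quasi_einstein]).

    The Ricci curvature of the Reeb fields is computed in a chart. By Cartan's
    formula the flow of Z_i preserves alpha_j, d alpha_j and Z_j. In complex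
    coordinates J and T are constant, so their Nijenhuis tensors vanish
    ([complex_coord_nijenhuis]); as J Z_1 = Z_2 and T Z_2 = Z_1, this relates the
    Lie derivatives of phi along Z_1 and Z_2 in two ways, which together force
    both to vanish ([lie_phi]). Hence the Z_i are Killing fields and the
    covariant derivative of Z_i is B_i, the two-form d alpha_i with an index
    raised ([nabla_reeb]). The vanishing of the exterior powers bounds the ranks
    of the d alpha_i by 2p and 2q ([wedge_exp_rank]); with phi decomposable this
    gives B_1 B_2 = B_2 B_1 = 0, B_1^2 + B_2^2 = phi^2, and that - B_i^2 is a
    projector, of rank 2p or 2q ([ReebSplitting]). The Ricci identity expresses
    Ric(., Z_i) by the divergence of B_i. Contracting the covariant derivative of
    (B_1 + e B_2)^2 = phi^2, for both signs e, against a frame and using that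
    d alpha_i is closed shows that this divergence has no horizontal component
    ([contraction]); its Reeb components are the traces of the B_k B_i. *)

(** * Bilinear forms given by matrices *)

Section Bilinear.
Variables (R : realType) (m : nat).
Implicit Types (G : 'M[R]_m) (u v w : 'rV[R]_m).

Lemma bilinE G u v : bilin G u v = (u *m G *m v^T) 0 0.
Proof. by []. Qed.

Lemma bilinDl G u v w : bilin G (u + v) w = bilin G u w + bilin G v w.
Proof. by rewrite /bilin !mulmxDl mxE. Qed.

Lemma bilinDr G u v w : bilin G u (v + w) = bilin G u v + bilin G u w.
Proof. by rewrite /bilin linearD mulmxDr mxE. Qed.

Lemma bilinZl G a u v : bilin G (a *: u) v = a * bilin G u v.
Proof. by rewrite /bilin -!scalemxAl mxE. Qed.

Lemma bilinZr G a u v : bilin G u (a *: v) = a * bilin G u v.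
Proof. by rewrite /bilin linearZ -scalemxAr mxE. Qed.

Lemma bilinNl G u v : bilin G (- u) v = - bilin G u v.
Proof. by rewrite -scaleN1r bilinZl mulN1r. Qed.

Lemma bilinNr G u v : bilin G u (- v) = - bilin G u v.
Proof. by rewrite -scaleN1r bilinZr mulN1r. Qed.

Lemma bilin0l G u : bilin G 0 u = 0.
Proof. by rewrite /bilin !mul0mx mxE. Qed.

Lemma bilin_mxP a G G' u v : bilin (a *: G + G') u v = a * bilin G u v + bilin G' u v.
Proof. by rewrite /bilin mulmxDr mulmxDl -scalemxAr -scalemxAl [LHS]mxE [X in X + _]mxE. Qed.

Lemma bilin_tr G u v : bilin G^T u v = bilin G v u.
Proof.
have -> : bilin G v u = ((v *m G *m u^T)^T) 0 0 by rewrite mxE.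
by rewrite !trmx_mul trmxK mulmxA.
Qed.

Lemma bilin_skew G u v : G^T = - G -> bilin G u v = - bilin G v u.
Proof. by move=> skewG; rewrite -[in RHS](bilin_tr G u v) skewG /bilin mulmxN mulNmx [in RHS]mxE opprK. Qed.

Lemma bilin_delta G i j : bilin G (delta_mx 0 i) (delta_mx 0 j) = G i j.
Proof. by rewrite /bilin trmx_delta -rowE -colE !mxE. Qed.

Lemma bilin_mull G A u v : bilin G (u *m A) v = bilin (A *m G) u v.
Proof. by rewrite /bilin !mulmxA. Qed.

Lemma bilin_mulr G A u v : bilin G u (v *m A) = bilin (G *m A^T) u v.
Proof. by rewrite /bilin trmx_mul !mulmxA. Qed.

Lemma bilinP G G' : (forall u v, bilin G u v = bilin G' u v) -> G = G'.
Proof.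
by move=> eqG; apply/matrixP=> i j; rewrite -!bilin_delta eqG.
Qed.

Lemma rowbilinP u v : (forall w, (u *m w^T) 0 0 = (v *m w^T) 0 0) -> u = v.
Proof.
move=> eqw; apply/rowP=> i; have := eqw (delta_mx 0 i).
by rewrite trmx_delta -!colE !mxE.
Qed.

End Bilinear.

(** * Rank of a two-form with vanishing exterior power *)

Section Symplectic.
Variables (R : realType) (m : nat).
Implicit Types (e f : nat -> 'rV[R]_m).

Lemma wedge_perm k l (w : mform R m k) (z : mform R m l)
    (v : 'I_(k + l) -> 'rV[R]_m) (t : 'S_(k + l)) :
  wedge w z (fun i => v (t i)) = (-1) ^+ t * wedge w z v.
Proof.
rewrite /wedge mulrCA; congr (_ * _).
rewrite mulr_sumr [RHS](reindex_inj (mulIg t)) /=; apply: eq_bigr => s _.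
rewrite odd_permM signr_addb [RHS]mulrA; congr (_ * _).
  by rewrite mulrCA -expr2 sqrr_sign mulr1.
by congr (w _ * z _); apply: funext => i; rewrite permM.
Qed.

Lemma wedge_exp_perm (w : mform R m 2) n (v : 'I_(n * 2) -> 'rV[R]_m)
    (t : 'S_(n * 2)) :
  wedge_exp w n (fun i => v (t i)) = (-1) ^+ t * wedge_exp w n v.
Proof.
case: n v t => [|n] v t; last exact: wedge_perm.
have -> : t = 1%g by apply/permP => -[].
by rewrite odd_perm1 mul1r.
Qed.

(** Interleaved as e_0, f_0, e_1, f_1, ...: the order in which the successive
    factors of an exterior power take their arguments. *)
Definition pair_seq e f (i : nat) : 'rV[R]_m :=
  if odd i then f i./2 else e i./2.

Definition symplectic (w : 'rV[R]_m -> 'rV[R]_m -> R) n e f :=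
  forall i j, (i < n)%N -> (j < n)%N ->
  [/\ w (e i) (e j) = 0, w (f i) (f j) = 0 & w (e i) (f j) = (i == j)%:R].

Lemma perm_fix0 n (s : 'S_n.+1) :
  s ord0 = ord0 -> exists t : 'S_n, s = lift_perm ord0 ord0 t.
Proof.
move=> s0; pose h j := odflt j (unlift ord0 (s (lift ord0 j))).
have hE j : lift ord0 (h j) = s (lift ord0 j).
  rewrite /h; case: unliftP => [k ->|] //=.
  by rewrite -{2}s0 => /perm_inj/eqP; rewrite eq_sym (negbTE (neq_lift _ _)).
have h_inj : injective h.
  by move=> i j /(congr1 (lift ord0)); rewrite !hE => /perm_inj/lift_inj.
exists (perm h_inj); apply/permP => i.
case: (unliftP ord0 i) => [j|] ->; last by rewrite lift_perm_id.
by rewrite lift_perm_lift permE hE.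
Qed.

(** Such a summand of the expansion of the wedge of w with its power w^n
    evaluates w^n on permuted arguments, where [wedge_exp_perm] applies. *)
Lemma perm_fix01 n (s : 'S_(2 + n)) :
  s (lshift n ord0) = lshift n ord0 -> s (lshift n ord_max) = lshift n ord_max ->
  exists2 t : 'S_n, (forall j, s (rshift 2 j) = rshift 2 (t j)) &
    odd_perm s = odd_perm t.
Proof.
move=> s0 s1.
have e0 : lshift n (ord0 : 'I_2) = ord0 by apply: val_inj.
have e1 : lshift n (ord_max : 'I_2) = lift ord0 ord0 by apply: val_inj.
have eS j : rshift 2 j = lift ord0 (lift ord0 j) :> 'I_(2 + n).
  by apply: val_inj.
have [t def_s] : exists t : 'S_n.+1, s = lift_perm ord0 ord0 t.
  by apply: perm_fix0; rewrite -e0.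
have [r def_t] : exists r : 'S_n, t = lift_perm ord0 ord0 r.
  apply: perm_fix0; move: s1; rewrite e1 def_s lift_perm_lift.
  exact: lift_inj.
exists r; first by move=> j; rewrite !eS def_s lift_perm_lift def_t lift_perm_lift.
by rewrite def_s odd_lift_perm def_t odd_lift_perm.
Qed.

Section PairTerm.
Variables (w : 'rV[R]_m -> 'rV[R]_m -> R) (n : nat).
Hypothesis w_skew : forall u v, w u v = - w v u.
Hypothesis IHn : forall e f, symplectic w n e f ->
  0 < wedge_exp (mform2 w) n (fun i => pair_seq e f i).

(** The summand of s in the expansion of the wedge product of w with w^n. *)
Let term (v : nat -> 'rV[R]_m) (s : 'S_(2 + n * 2)) :=
  (-1) ^+ s * (w (v (s (lshift _ ord0))) (v (s (lshift _ ord_max))) *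
    wedge_exp (mform2 w) n (fun j => v (s (rshift 2 j)))).

(** The permutation sg exchanges the pair (e_k, f_k) with (e_0, f_0). As a
    product of two transpositions it is even (for k = 0 both are trivial), and
    the other pairs still form a symplectic family, to which the induction
    hypothesis applies. *)
Lemma term_gt0 e f (s : 'S_(2 + n * 2)) k : symplectic w n.+1 e f ->
    s (lshift _ ord0) = k.*2 :> nat -> s (lshift _ ord_max) = k.*2.+1 :> nat ->
  0 < term (pair_seq e f) s.
Proof.
move=> sympl s0 s1.
have k_lt : (k < n.+1)%N.
  by have := ltn_ord (s (lshift (n * 2) ord0)); rewrite s0 add2n muln2 -doubleS ltn_double.
pose sw (i : nat) := if i == 0%N then k else if i == k then 0%N else i.
have sw_lt i : (i < n.+1)%N -> (sw i < n.+1)%N.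
  by rewrite /sw; case: eqP => // _; case: eqP.
have swK : involutive sw.
  move=> i; rewrite /sw; have [->|i0] := eqVneq i 0%N.
    by have [->|_] := eqVneq k 0%N; rewrite ?eqxx.
  have [->|ik] := eqVneq i k; first by rewrite eqxx.
  by rewrite (negbTE i0) (negbTE ik).
have sw_inj i j : (sw i == sw j) = (i == j) by rewrite (inv_eq swK) swK.
set a := s (lshift _ ord0) in s0; set b := s (lshift _ ord_max) in s1.
pose i0 : 'I_(2 + n * 2) := lshift _ ord0; pose i1 : 'I_(2 + n * 2) := lshift _ ord_max.
pose sg := (tperm i0 a * tperm i1 b)%g.
pose e' (i : nat) := e (sw i); pose f' (i : nat) := f (sw i).
have sgE (i : 'I_(2 + n * 2)) : pair_seq e f i = pair_seq e' f' (sg i).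
  have i0E : (i0 : nat) = 0%N by [].
  have i1E : (i1 : nat) = 1%N by [].
  have swE j : j != 0%N -> j != k -> sw j = j by rewrite /sw => /negbTE-> /negbTE->.
  have sw0 : sw 0%N = k by [].
  have swk : sw k = 0%N by rewrite /sw; case: eqP => [->|]; rewrite ?eqxx.
  rewrite /sg permM; case: (tpermP i0 a i) => [->|->|/eqP ni0 /eqP nia].
  - have na1 : i1 != a by rewrite -val_eqE /= s0; case: (k).
    have nab : b != a by rewrite -val_eqE /= s0 s1 eqn_leq ltnn.
    rewrite tpermD //.
    by rewrite i0E s0 /pair_seq /= odd_double doubleK /e' swk.
  - rewrite tpermD; last 2 first.
    + by apply/eqP => /(congr1 val).
    + by apply/eqP => /(congr1 val)/=; rewrite s1.
    by rewrite i0E s0 /pair_seq /= odd_double doubleK /e' sw0.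
  - case: tpermP => [->|->|/eqP ni1 /eqP nib].
    + by rewrite i1E s1 /pair_seq /= odd_double /= uphalf_double /f' swk.
    + by rewrite i1E s1 /pair_seq /= odd_double /= uphalf_double /f' sw0.
    + have [n0 n1 n2 n3] : [/\ val i != 0, val i != 1, val i != k.*2 & val i != k.*2.+1]%N.
        by split; [move: ni0|move: ni1|move: nia|move: nib]; rewrite -val_eqE /= ?s0 ?s1.
      have := odd_double_half i; rewrite /pair_seq /e' /f'; case: (odd i) => /= Ei;
        rewrite swE //; apply/eqP => h; move: n0 n1 n2 n3;
        by rewrite /= -Ei h ?double0 ?add1n ?add0n ?eqxx.
have sympl' : symplectic w n (fun i => e' i.+1) (fun i => f' i.+1).
  move=> i j li lj; have [h1 h2 h3] := sympl (sw i.+1) (sw j.+1) (sw_lt i.+1 li) (sw_lt j.+1 lj).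
  by split=> //; rewrite h3 sw_inj.
have ev : ~~ odd_perm sg.
  rewrite odd_permM !odd_tperm.
  have -> : (i0 != a) = (0%N != k) by rewrite -val_eqE /= s0 -double0 (inj_eq double_inj).
  by have -> : (i1 != b) = (0%N != k); rewrite ?addbb // -val_eqE /= s1 eqSS -double0 (inj_eq double_inj).
pose s' := (s * sg)%g.
have s'0 : s' (lshift _ ord0) = lshift _ ord0.
  rewrite permM -/a permM tpermR tpermD //; apply/eqP => /(congr1 val) //=.
  by rewrite s1.
have s'1 : s' (lshift _ ord_max) = lshift _ ord_max.
  rewrite permM -/b permM (tpermD (z := b)) ?tpermR //; apply/eqP => /(congr1 val) //=; rewrite s1 //.
  by rewrite s0 => /eqP; lia.
have [t s't odds'] := perm_fix01 s'0 s'1.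
have odds : odd_perm s = odd_perm t by rewrite -odds' odd_permM (negbTE ev) addbF.
rewrite /term odds -/a -/b s0 s1 /pair_seq /= odd_double /= doubleK uphalf_double.
have [_ _ ->] := sympl k k k_lt k_lt; rewrite eqxx mul1r.
rewrite -/(pair_seq _ _).
have -> : (fun j => pair_seq e f (s (rshift 2 j))) =
          (fun j => (fun i : 'I_(n * 2) => pair_seq (fun i => e' i.+1) (fun i => f' i.+1) i) (t j)).
  by apply: funext => j; rewrite sgE -permM -/s' s't /pair_seq /= negbK.
rewrite (wedge_exp_perm (mform2 w) (fun i : 'I_(n * 2) => pair_seq (fun i => e' i.+1) (fun i => f' i.+1) i) t).
by rewrite mulrA -expr2 sqrr_sign mul1r IHn.
Qed.

(** The factor w vanishes unless s sends the first two positions to e_k and f_k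
    for some k, in one of the two orders. If f_k comes first, a transposition
    of the two positions restores the order; its sign cancels against the
    skewness of w. *)
Lemma term_ge0 e f (s : 'S_(2 + n * 2)) : symplectic w n.+1 e f -> 0 <= term (pair_seq e f) s.
Proof.
move=> sympl; set a := s (lshift _ ord0); set b := s (lshift _ ord_max).
have lt_half (i : 'I_(2 + n * 2)) : (i./2 < n.+1)%N.
  by rewrite ltn_half_double -muln2; apply: ltn_ord.
have [hee hff hef] := sympl a./2 b./2 (lt_half a) (lt_half b).
have [_ _ hfe] := sympl b./2 a./2 (lt_half b) (lt_half a).
have Ea := odd_double_half a; have Eb := odd_double_half b.
have wab : w (pair_seq e f a) (pair_seq e f b) =
  if odd a == odd b then 0 else (a./2 == b./2)%:R * (-1) ^+ odd a.
  rewrite /pair_seq; case: (odd a) (odd b) => -[] //=; rewrite ?mulr1 //.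
  by rewrite w_skew hfe eq_sym mulrN1.
case: eqP wab => [_ wab|/eqP nab wab].
  by rewrite /term wab mul0r mulr0.
case: eqP wab => [hab wab|_ wab]; last by rewrite /term wab !mul0r mulr0.
case: (boolP (odd a)) => oa; last first.
  apply/ltW/(@term_gt0 _ _ _ a./2) => //; rewrite -/a -/b.
    by move: Ea; rewrite (negbTE oa).
  by move: Eb nab; rewrite (negbTE oa) -hab; case: (odd b).
pose tp : 'S_(2 + n * 2) := tperm (lshift _ ord0) (lshift _ ord_max).
have tp0 : tp (lshift _ ord0) = lshift _ ord_max by rewrite /tp tpermL.
have tp1 : tp (lshift _ ord_max) = lshift _ ord0 by rewrite /tp tpermR.
have tpS j : tp (rshift 2 j) = rshift 2 j.
  by rewrite /tp tpermD //; apply/eqP => /(congr1 val).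
suff -> : term (pair_seq e f) s = term (pair_seq e f) (tp * s)%g.
  apply/ltW/(@term_gt0 _ _ _ a./2) => //; rewrite permM ?tp0 ?tp1 -/a -/b.
    by move: Eb nab; rewrite oa -hab; case: (odd b).
  by move: Ea; rewrite oa.
have odd_tp : odd_perm tp = true by rewrite odd_tperm.
rewrite /term !permM tp0 tp1 odd_permM odd_tp addTb signrN w_skew !mulNr mulrN.
congr (- (_ * (_ * wedge_exp _ _ _))); apply: funext => j.
by rewrite permM tpS.
Qed.

Lemma term1_gt0 e f : symplectic w n.+1 e f -> 0 < term (pair_seq e f) 1%g.
Proof. by move=> sympl; apply: (@term_gt0 _ _ _ 0) => //; rewrite perm1. Qed.

End PairTerm.

(** No summand of the expansion is negative and that of the identity is
    positive, so no cancellation can occur. *)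
Lemma wedge_exp_symplectic_gt0 (w : 'rV[R]_m -> 'rV[R]_m -> R) n e f :
    (forall u v, w u v = - w v u) -> symplectic w n e f ->
  0 < wedge_exp (mform2 w) n (fun i => pair_seq e f i).
Proof.
move=> w_skew; elim: n e f => [|n IHn] e f sympl /=; first exact: ltr01.
rewrite /wedge pmulr_rgt0 ?invr_gt0 ?ltr0n ?fact_gt0 //.
rewrite (bigD1 1%g) //=; apply: ltr_wpDr; last by have := term1_gt0 IHn sympl; apply.
by apply: sumr_ge0 => s _; have := term_ge0 w_skew IHn s sympl.
Qed.

(** Symplectic Gram-Schmidt: passing to the W-orthogonal of a plane on which W
    does not vanish lowers the rank by at most two. The slack of one in the
    bound is possible because the rank of a skew form is even. *)
Lemma exists_symplectic n (W : 'M[R]_m) :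
    W^T = - W -> (n.*2 <= (\rank W).+1)%N ->
  exists e f, symplectic (bilin W) n e f.
Proof.
elim: n W => [|n IHn] W skewW rW; first by exists (fun=> 0), (fun=> 0).
have [W0|Wn0] := eqVneq W 0; first by move: rW; rewrite W0 mxrank0 doubleS.
have [u [v wuv]] : exists u v, bilin W u v = 1.
  have [i [j Wij]] : exists i j, W i j != 0.
    apply: contrapT => noW; case/eqP: Wn0; apply/matrixP => i j; rewrite mxE.
    by apply/eqP/negP => /negP nz; apply: noW; exists i, j.
  exists ((W i j)^-1 *: delta_mx 0 i), (delta_mx 0 j).
  by rewrite bilinZl bilin_delta mulVf.
have wvu : bilin W v u = -1 by rewrite bilin_skew // wuv.
have wdiag x : bilin W x x = 0.
  by have := bilin_skew x x skewW; lra.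
(* The projection onto the W-orthogonal of the plane spanned by u and v, and
   its matrix. *)
pose q x := x - bilin W x v *: u + bilin W x u *: v.
pose Q := 1%:M - W *m v^T *m u + W *m u^T *m v.
have outer x (y z : 'rV[R]_m) : x *m (W *m y^T *m z) = bilin W x y *: z.
  by rewrite /bilin !mulmxA [X in X *m z = _]mx11_scalar mul_scalar_mx.
have qE x : x *m Q = q x by rewrite /Q mulmxDr mulmxBr mulmx1 !outer.
have qv x : bilin W (q x) v = 0.
  by rewrite /q !(bilinDl, bilinNl, bilinZl) wuv wdiag; ring.
have qu x : bilin W (q x) u = 0.
  by rewrite /q !(bilinDl, bilinNl, bilinZl) wvu wdiag; ring.
have uq x : bilin W u (q x) = 0 by rewrite bilin_skew // qu oppr0.
have vq x : bilin W v (q x) = 0 by rewrite bilin_skew // qv oppr0.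
pose W' := Q *m W *m Q^T.
have W'E x y : bilin W' x y = bilin W (q x) (q y).
  by rewrite -!qE bilin_mulr bilin_mull mulmxA.
have skewW' : W'^T = - W'.
  by rewrite /W' !trmx_mul trmxK skewW mulNmx mulmxN mulmxA.
have W'W : W = W' + (W *m v^T) *m (u *m W) - (W *m u^T) *m (v *m W).
  have -> : W' = Q *m W.
    apply: bilinP => x y; rewrite W'E -bilin_mull qE [in LHS]/q.
    by rewrite !(bilinDr, bilinNr, bilinZr) qu qv; ring.
  by rewrite /Q mulmxDl mulmxBl mul1mx !mulmxA [RHS]addrAC addrK subrK.
have rank_outer (x : 'cV[R]_m) (y : 'rV[R]_m) : (\rank (x *m y) <= 1)%N.
  exact: leq_trans (mxrankM_maxr _ _) (rank_leq_row _).
have rW' : (n.*2 <= (\rank W').+1)%N.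
  have : (\rank W <= \rank W' + 1 + 1)%N.
    rewrite {1}W'W; apply: leq_trans (mxrank_add _ _) _; apply: leq_add.
      by apply: leq_trans (mxrank_add _ _) _; rewrite leq_add2l rank_outer.
    by rewrite mxrank_opp rank_outer.
  by move: rW; rewrite doubleS; lia.
have [e [f sympl]] := IHn W' skewW' rW'.
exists (fun i => if i is i'.+1 then q (e i') else u).
exists (fun i => if i is i'.+1 then q (f i') else v).
case=> [|i] [|j] /= li lj; rewrite ?wdiag ?wuv ?uq ?vq ?qu ?qv ?eqxx //.
by rewrite eqSS -!W'E; apply: sympl.
Qed.

(** Otherwise W would have a symplectic family of length n + 1, and the
    exterior power would be positive on it. *)
Lemma wedge_exp_rank (W : 'M[R]_m) n : W^T = - W ->
    (forall v, wedge_exp (mform2 (bilin W)) n.+1 v = 0) ->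
  (\rank W <= n.*2)%N.
Proof.
move=> skewW W0; rewrite leqNgt; apply/negP => rW.
have [|e [f sympl]] := @exists_symplectic n.+1 W skewW; first by rewrite doubleS.
have := wedge_exp_symplectic_gt0 (fun u v => bilin_skew u v skewW) sympl.
by rewrite W0 ltxx.
Qed.

End Symplectic.

(** * Orthonormal frames *)

Lemma linear_mxE (R : realType) m n (f : 'rV[R]_m -> 'rV[R]_n) :
  (forall a u v, f (a *: u + v) = a *: f u + f v) ->
  forall u, f u = u *m \matrix_(i < m) f (delta_mx 0 i).
Proof.
move=> linf u.
have f0 : f 0 = 0 by have /eqP := linf 1 0 0; rewrite !scale1r addr0 -subr_eq0 opprD addNKr oppr_eq0 => /eqP.
have fD v w : f (v + w) = f v + f w by have := linf 1 v w; rewrite !scale1r.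
have fZ a v : f (a *: v) = a *: f v by have := linf a v 0; rewrite f0 !addr0.
rewrite {1}[u]row_sum_delta (big_morph f fD f0) mulmx_sum_row.
by apply: eq_bigr => i _; rewrite fZ rowK.
Qed.

Section Orthonormal.
Variables (R : realType) (m : nat) (G : 'M[R]_m).
Hypothesis G_sym : G^T = G.
Hypothesis G_pos : forall u : 'rV[R]_m, u != 0 -> 0 < bilin G u u.

Lemma G_unit : G \in unitmx.
Proof.
rewrite -row_free_unit; apply/row_freeP.
have : row_free G.
  rewrite -kermx_eq0; apply/rowV0P => u /sub_kermxP uG.
  apply: contraTeq isT => /G_pos; rewrite /bilin uG mul0mx mxE ltxx //.
by move/row_freeP.
Qed.

Lemma bilin_symG u v : bilin G u v = bilin G v u.
Proof. by rewrite -bilin_tr G_sym. Qed.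

Lemma gramE k l (E : 'M[R]_(k, m)) (F : 'M[R]_(l, m)) (A : 'M[R]_m) i j :
  (E *m A *m F^T) i j = bilin A (row i E) (row j F).
Proof.
rewrite /bilin -row_mul tr_row -[row i _ *m _]row_mul.
by rewrite -[_ *m col j _]/(mulmx _ _) colE mulmxA -colE !mxE; apply: eq_bigr => s _; rewrite !mxE.
Qed.

Lemma orthonormalP k (E : 'M[R]_(k, m)) :
  E *m G *m E^T = 1%:M <->
  forall i j, bilin G (row i E) (row j E) = (i == j)%:R.
Proof.
split=> [EG i j|EG]; first by rewrite -gramE EG mxE.
by apply/matrixP => i j; rewrite gramE EG mxE.
Qed.

Lemma gram_schmidt k l (L : 'M[R]_(l, m)) : \rank L = k ->
  exists2 E : 'M[R]_(k, m), (E == L)%MS & E *m G *m E^T = 1%:M.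
Proof.
elim: k l L => [|k IHk] l L rL.
  exists 0; last by apply/matrixP => -[].
  have /eqP : \rank L == 0%N by rewrite rL.
  by move/eqP; rewrite mxrank_eq0 => /eqP->; rewrite !sub0mx.
have Ln0 : L != 0 by rewrite -mxrank_eq0 rL.
have v_n0 : nz_row L != 0 by rewrite nz_row_eq0.
have nv_gt0 := G_pos v_n0.
pose u := (Num.sqrt (bilin G (nz_row L) (nz_row L)))^-1 *: nz_row L.
have uL : (u <= L)%MS by rewrite scalemx_sub // nz_row_sub.
have uu : u *m G *m u^T = 1%:M.
  rewrite [LHS]mx11_scalar -/(bilin G u u) bilinZl bilinZr mulrA -invfM -expr2.
  by rewrite sqr_sqrtr ?ltW // mulVf ?gt_eqF.
pose L' := (L :&: kermx (G *m u^T))%MS.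
have rL' : \rank L' = k.
  have := mxrank_mul_ker L (G *m u^T); rewrite rL -/L'.
  suff -> : \rank (L *m (G *m u^T)) = 1%N by case.
  apply/eqP; rewrite eqn_leq rank_leq_col lt0n mxrank_eq0.
  have /submxP[D uE] := uL.
  apply/eqP => L0; have := uu; rewrite {1}uE -!mulmxA L0 mulmx0.
  by move/matrixP/(_ 0 0)/eqP; rewrite !mxE eqxx eq_sym oner_eq0.
have [E' eqE' E'1] := IHk _ L' rL'.
have E'L' : (E' <= L')%MS by case/andP: eqE'.
have E'u : E' *m G *m u^T = 0.
  apply/eqP; rewrite -mulmxA; apply/eqP/sub_kermxP.
  exact: submx_trans E'L' (capmxSr _ _).
have uE' : u *m G *m (E')^T = 0.
  by apply: trmx_inj; rewrite !trmx_mul trmxK G_sym trmx0 mulmxA.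
pose E : 'M[R]_(1 + k, m) := col_mx u E'.
have E1 : E *m G *m E^T = 1%:M.
  by rewrite /E tr_col_mx mul_col_mx mul_col_row uu uE' E'u E'1 -scalar_mx_block.
exists E => //.
have EL : (E <= L)%MS by rewrite col_mx_sub uL (submx_trans E'L') ?capmxSl.
rewrite -(mxrank_leqif_eq EL) rL; apply/eqP/eqP.
by apply/row_freeP; exists (G *m E^T); rewrite mulmxA.
Qed.

Lemma rank_orthocomp (L : 'M[R]_m) : \rank (orthocomp G L) = (m - \rank L)%N.
Proof.
rewrite mxrank_ker -[\rank (G *m _)]mxrank_tr trmx_mul trmxK G_sym.
by rewrite mxrankMfree // row_free_unit G_unit.
Qed.

Lemma sub_orthocompP k (L : 'M[R]_m) (u : 'M[R]_(k, m)) :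
  reflect (u *m G *m L^T = 0) (u <= orthocomp G L)%MS.
Proof. by rewrite -mulmxA; apply: sub_kermxP. Qed.

(** The completeness relation of an orthonormal basis, which is what the
    computation of a trace needs: F^T F is the inverse metric. *)
Definition frame k (F : 'M[R]_(k, m)) := F^T *m F *m G = 1%:M.

(** The two families are orthogonal to each other and their sizes add up to m. *)
Lemma orthocomp_frame (L : 'M[R]_m) k l (E : 'M[R]_(k, m)) (E' : 'M[R]_(l, m)) :
    (E == L)%MS -> E *m G *m E^T = 1%:M ->
    (E' == orthocomp G L)%MS -> E' *m G *m (E')^T = 1%:M ->
  frame (col_mx E E').
Proof.
move=> eqE E1 eqE' E'1.
have /andP[EL LE] := eqE.
have rk : (k = \rank L)%N.
  have /eqmxP <- := eqE; symmetry; apply/eqP.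
  by apply/row_freeP; exists (G *m E^T); rewrite mulmxA.
have rl : (l = m - \rank L)%N.
  rewrite -rank_orthocomp; have /eqmxP <- := eqE'; symmetry; apply/eqP.
  by apply/row_freeP; exists (G *m (E')^T); rewrite mulmxA.
have E'E : E' *m G *m E^T = 0.
  have /submxP[D ->] := EL.
  have : (E' <= orthocomp G L)%MS by case/andP: eqE'.
  by move/sub_orthocompP; rewrite trmx_mul mulmxA => ->; rewrite mul0mx.
have EE' : E *m G *m (E')^T = 0.
  by apply: trmx_inj; rewrite !trmx_mul trmxK G_sym trmx0 mulmxA.
pose F := col_mx E E'.
have F1 : F *m G *m F^T = 1%:M.
  by rewrite /F tr_col_mx mul_col_mx mul_col_row E1 EE' E'E E'1 -scalar_mx_block.
have full : row_full F.
  rewrite /row_full; have : row_free F.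
    by apply/row_freeP; exists (G *m F^T); rewrite mulmxA.
  by move/eqP->; rewrite rk rl subnKC // rank_leq_col.
have [D DF] := row_fullP full.
have FE : F *m (G *m (F^T *m F)) = F by rewrite !mulmxA F1 mul1mx.
by apply: mulmx1C; rewrite -[LHS]mul1mx -DF -mulmxA FE.
Qed.

Lemma frame_trace k (F : 'M[R]_(k, m)) (A : 'M[R]_m) : frame F ->
  \tr A = \sum_i bilin G (row i F *m A) (row i F).
Proof.
move=> frF; transitivity (\tr (F *m (A *m G) *m F^T)).
  rewrite mxtrace_mulC !mulmxA mxtrace_mulC !mulmxA.
  by rewrite -(mulmxA G) (mulmx1C frF) mul1mx.
by apply: eq_bigr => i _; rewrite gramE bilin_mull.
Qed.

Lemma exists_frame : exists F : 'M[R]_m, frame F.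
Proof.
have [F _ F1] := gram_schmidt (@mxrank1 R m).
by exists F; rewrite /frame -mulmxA; apply: mulmx1C; rewrite -mulmxA mulmxA.
Qed.

(** Multiplied by G on the left, both sides become the orthogonal projector
    onto the common row space. *)
Lemma orthonormal_gram_unique k l (E : 'M[R]_(k, m)) (F : 'M[R]_(l, m)) :
    (E == F)%MS -> E *m G *m E^T = 1%:M -> F *m G *m F^T = 1%:M ->
  E^T *m E = F^T *m F.
Proof.
move=> /andP[/submxP[D defE] /submxP[D' defF]] E1 F1.
have eD : D = E *m G *m F^T by rewrite defE -!mulmxA (mulmxA F) F1 mulmx1.
have eD' : D' = F *m G *m E^T by rewrite {1}defF -!mulmxA (mulmxA E) E1 mulmx1.
rewrite {2}defE eD !mulmxA; congr (_ *m F).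
rewrite [in RHS]defF eD' !trmx_mul trmxK G_sym !mulmxA //.
Qed.

Lemma sum_bilin_gram k (E : 'M[R]_(k, m)) (A : 'M[R]_m) :
  \sum_i bilin A (row i E) (row i E) = \tr (A *m (E^T *m E)).
Proof.
transitivity (\tr (E *m A *m E^T)); first by apply: eq_bigr => i _; rewrite gramE.
by rewrite -mulmxA mxtrace_mulC mulmxA.
Qed.

Lemma sum_sqr_in k (E : 'M[R]_(k, m)) (L : 'M[R]_m) (z : 'rV[R]_m) :
    (E == L)%MS -> E *m G *m E^T = 1%:M -> (z <= L)%MS ->
  \sum_i bilin G (row i E) z ^+ 2 = bilin G z z.
Proof.
move=> /eqmxP eqE E1; rewrite -eqE => /submxP[D ->].
transitivity ((D *m D^T) 0 0); last first.
  by rewrite /bilin trmx_mul !mulmxA -(mulmxA _ G) -(mulmxA D) (mulmxA E) E1 mulmx1.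
rewrite mxE; apply: eq_bigr => i _; rewrite expr2 !mxE; congr (_ * _);
  rewrite /bilin trmx_mul !mulmxA -row_mul -row_mul E1 rowE mulmx1 -rowE !mxE //;
  by rewrite (bigD1 i) //= big1 ?addr0 => [|j ji]; rewrite !mxE ?eqxx ?mul1r // (negbTE ji) ?mul0r.
Qed.

Lemma sum_sqr_out k (E : 'M[R]_(k, m)) (L : 'M[R]_m) (z : 'rV[R]_m) :
    (E == L)%MS -> (z <= orthocomp G L)%MS ->
  \sum_i bilin G (row i E) z ^+ 2 = 0.
Proof.
move=> /andP[/submxP[D ->] _] /sub_orthocompP zL; apply: big1 => i _.
rewrite bilin_symG /bilin row_mul trmx_mul mulmxA zL mul0mx mxE.
by rewrite expr0n.
Qed.

Lemma sub_orthocompK (L : 'M[R]_m) (z : 'rV[R]_m) :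
  (z <= L)%MS -> (z <= orthocomp G (orthocomp G L))%MS.
Proof.
move=> /submxP[D ->]; apply/sub_orthocompP.
have := submx_refl (orthocomp G L) => /sub_orthocompP.
move: (orthocomp G L) => K KL; apply: trmx_inj.
by rewrite !trmx_mul trmxK G_sym trmx0 !mulmxA KL mul0mx.
Qed.

End Orthonormal.

(** * Scalar curvatures of a subspace and of its complement *)

Section ScalarCurvature.
Variables (R : realType) (m : nat) (g : 'rV[R]_m -> 'M[R]_m) (x : 'rV[R]_m).
Hypothesis G_sym : (g x)^T = g x.
Hypothesis G_pos : forall u : 'rV[R]_m, u != 0 -> 0 < bilin (g x) u u.
Let K (u v : 'rV[R]_m) := bilin (g x) (curv g x u v v) u.
Hypothesis K_sym : forall u v, K u v = K v u.
Hypothesis K_diag : forall u, K u u = 0.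
Hypothesis Ric_frame : forall k (F : 'M[R]_(k, m)), frame (g x) F ->
  forall u, Ric g x u u = \sum_i K (row i F) u.

(** On orthonormal vectors the denominator of [Sec] is 1, and the sum over i <
    j is half of the symmetric double sum. *)
Lemma scal_basis (L : 'M[R]_m) : exists E : 'M[R]_(\rank L, m),
  [/\ (E == L)%MS, E *m g x *m E^T = 1%:M &
     2 * scal g x L = \sum_i \sum_j K (row i E) (row j E)].
Proof.
pose B := [set E : 'M[R]_(\rank L, m) | orthonormal_basis (g x) L E].
have exB : exists E, B E.
  have [E eqE E1] := gram_schmidt G_sym G_pos (erefl (\rank L)).
  by exists E; split=> //; apply/orthonormalP.
have := xgetPex (0 : 'M[R]_(\rank L, m)) exB; rewrite /scal -/B.
move: (xget _ B) => E [eqE E1]; exists E; split=> //; first exact/orthonormalP.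
have -> : \sum_(i < \rank L) \sum_(j < \rank L | (i < j)%N) Sec g x (row i E) (row j E) =
          \sum_(i < \rank L) \sum_(j < \rank L | (i < j)%N) K (row i E) (row j E).
  apply: eq_bigr => i _; apply: eq_bigr => j ij.
  have nij : (i == j) = false by apply: ltn_eqF.
  by rewrite /Sec !E1 !eqxx nij expr0n subr0 mulr1 divr1.
rewrite mulr2n mulrDl mul1r; set S := (X in X + X).
have {2}-> : S = \sum_(i < \rank L) \sum_(j < \rank L | (j < i)%N) K (row i E) (row j E).
  rewrite /S (exchange_big_dep xpredT) //=; apply: eq_bigr => i _; apply: eq_bigr => j _.
  exact: K_sym.
rewrite -big_split; apply: eq_bigr => i _ /=.
rewrite [RHS](bigD1 i) //= K_diag add0r [RHS](bigID (fun j : 'I_(\rank L) => (i < j)%N)) /=.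
congr (_ + _); apply: eq_bigl => j; rewrite -val_eqE /=; lia.
Qed.

(** Each Ric(u, u) is the sum of the curvatures K(E_i, u) and K(E'_j, u). The
    mixed terms K(E_i, E'_j) occur once in either of the two Ricci sums and
    cancel in the difference. *)
Lemma scal_orthocomp (L : 'M[R]_m) :
  exists (E : 'M[R]_(\rank L, m))
         (E' : 'M[R]_(\rank (orthocomp (g x) L), m)),
  [/\ (E == L)%MS /\ E *m g x *m E^T = 1%:M,
     (E' == orthocomp (g x) L)%MS /\ E' *m g x *m (E')^T = 1%:M &
     2 * (scal g x L - scal g x (orthocomp (g x) L)) =
     \sum_i Ric g x (row i E) (row i E) - \sum_i Ric g x (row i E') (row i E')].
Proof.
have [E [eqE E1 sE]] := scal_basis L.
have [E' [eqE' E'1 sE']] := scal_basis (orthocomp (g x) L).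
exists E, E'; split=> //; rewrite mulrBr sE sE'.
have frF := orthocomp_frame G_sym G_pos eqE E1 eqE' E'1.
have RE u : Ric g x u u = \sum_i K (row i E) u + \sum_i K (row i E') u.
  rewrite (Ric_frame frF) big_split_ord /=; congr (_ + _); apply: eq_bigr => i _.
    by rewrite rowKu.
  by rewrite rowKd.
rewrite (eq_bigr _ (fun i _ => RE (row i E))) [in RHS](eq_bigr _ (fun i _ => RE (row i E'))).
rewrite !big_split /= [\sum_i \sum_j K (row j E) (row i E')]exchange_big /=.
have -> : \sum_i \sum_j K (row j E') (row i E) = \sum_j \sum_i K (row j E) (row i E').
  by apply: eq_bigr => i _; apply: eq_bigr => j _; apply: K_sym.
rewrite [X in _ = X + _ - _]exchange_big [X in _ = _ - (_ + X)]exchange_big /=.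
ring.
Qed.

End ScalarCurvature.

(** * The scalar curvature conditions at one point *)

Lemma polar_arith (R : realType) (l raa rab rbb gaa gab gbb : R) :
  raa = l * gaa -> rbb = l * gbb ->
  raa + rab + (rab + rbb) = l * (gaa + gab + (gab + gbb)) -> rab = l * gab.
Proof. by move=> -> -> ?; lra. Qed.

Section PointwiseEinstein.
Variables (R : realType) (m p q : nat) (G Rc : 'M[R]_m) (Z1 Z2 : 'rV[R]_m).
Variable s : 'M[R]_m -> R.
Hypothesis mE : m = (2 * p + 2 * q + 2)%N.
Hypothesis p_gt0 : (0 < p)%N.
Hypothesis q_gt0 : (0 < q)%N.
Hypothesis G_sym : G^T = G.
Hypothesis G_pos : forall u : 'rV[R]_m, u != 0 -> 0 < bilin G u u.
Hypothesis Rc_sym : Rc^T = Rc.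
Hypothesis G11 : bilin G Z1 Z1 = 1.
Hypothesis G22 : bilin G Z2 Z2 = 1.
Hypothesis G12 : bilin G Z1 Z2 = 0.
Hypothesis RcZ1 : forall u, bilin Rc u Z1 = 2 * p%:R * bilin G u Z1.
Hypothesis RcZ2 : forall u, bilin Rc u Z2 = 2 * q%:R * bilin G u Z2.
Hypothesis s_diff : forall L : 'M[R]_m,
  exists (E : 'M[R]_(\rank L, m)) (E' : 'M[R]_(\rank (orthocomp G L), m)),
  [/\ (E == L)%MS /\ E *m G *m E^T = 1%:M,
     (E' == orthocomp G L)%MS /\ E' *m G *m (E')^T = 1%:M &
     2 * (s L - s (orthocomp G L)) =
     \sum_i bilin Rc (row i E) (row i E)
     - \sum_i bilin Rc (row i E') (row i E')].

Definition scal_conditions (lambda : R) :=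
  [/\ forall P : 'M[R]_m, \rank P = (p + q + 1)%N ->
        (Z1 <= orthocomp G P)%MS -> (Z2 <= orthocomp G P)%MS ->
        s P + p%:R + q%:R - lambda = s (orthocomp G P),
      forall N : 'M[R]_m, \rank N = (p + q)%N ->
        (Z1 <= orthocomp G N)%MS -> (Z2 <= orthocomp G N)%MS ->
        s N + p%:R + q%:R = s (orthocomp G N) &
      forall K : 'M[R]_m, \rank K = (p + q + 1)%N ->
        (Z1 <= K)%MS -> (Z2 <= orthocomp G K)%MS ->
        s K + q%:R - p%:R = s (orthocomp G K)].

Definition quasi_einstein_at (lambda beta mu : R) := forall u v,
  bilin Rc u v = lambda * bilin G u v + beta * (bilin G u Z1 * bilin G v Z1)
                 + mu * (bilin G u Z2 * bilin G v Z2).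

Lemma quasi_einstein_sum lambda beta mu k (E : 'M[R]_(k, m)) :
    quasi_einstein_at lambda beta mu -> E *m G *m E^T = 1%:M ->
  \sum_i bilin Rc (row i E) (row i E) =
    lambda * k%:R + beta * (\sum_i bilin G (row i E) Z1 ^+ 2)
    + mu * (\sum_i bilin G (row i E) Z2 ^+ 2).
Proof.
move=> qe /orthonormalP E1.
rewrite !mulr_sumr -[k in k%:R]card_ord -sumr_const mulr_sumr -!big_split /=.
by apply: eq_bigr => i _; rewrite qe E1 eqxx -!expr2.
Qed.

(** Evaluation at (Z1, Z1) and (Z2, Z2) gives lambda + beta = 2p and lambda +
    mu = 2q. The rest is the dimension of each subspace and whether it contains
    Z1 and Z2. *)
Lemma quasi_einstein_scal lambda beta mu :
  quasi_einstein_at lambda beta mu -> scal_conditions lambda.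
Proof.
move=> qe.
have lam_beta : lambda + beta = 2 * p%:R.
  by have := qe Z1 Z1; rewrite RcZ1 G11 G12 !mulr1 mulr0 mulr0 addr0.
have lam_mu : lambda + mu = 2 * q%:R.
  have := qe Z2 Z2; rewrite RcZ2 G22 (bilin_symG G_sym Z2 Z1) G12.
  by rewrite !mulr1 !mulr0 addr0.
split=> L rL; have [E [E' [[eqE E1] [eqE' E'1]]]] := s_diff L;
  rewrite (quasi_einstein_sum qe E1) (quasi_einstein_sum qe E'1) => sE z1 z2;
  move: sE; rewrite ?(sum_sqr_out G_sym eqE z1) ?(sum_sqr_out G_sym eqE z2).
- rewrite (sum_sqr_in eqE' E'1 z1) (sum_sqr_in eqE' E'1 z2) G11 G22.
  rewrite (rank_orthocomp G_sym G_pos) rL.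
  have -> : (m - (p + q + 1) = p + q + 1)%N by lia.
  rewrite !natrD; lra.
- rewrite (sum_sqr_in eqE' E'1 z1) (sum_sqr_in eqE' E'1 z2) G11 G22.
  rewrite (rank_orthocomp G_sym G_pos) rL.
  have -> : (m - (p + q) = p + q + 2)%N by lia.
  rewrite !natrD; lra.
- rewrite (sum_sqr_in eqE E1 z1) (sum_sqr_in eqE' E'1 z2) G11 G22.
  rewrite (sum_sqr_out G_sym eqE' (sub_orthocompK G_sym z1)).
  rewrite (rank_orthocomp G_sym G_pos) rL.
  have -> : (m - (p + q + 1) = p + q + 1)%N by lia.
  rewrite !natrD; lra.
Qed.

(** Here tau is the full trace of Ric: the traces over L and over its
    complement add up to it, so the difference depends on the trace over L
    alone. *)
Lemma s_diff_trace : exists tau, forall (L : 'M[R]_m) k (F : 'M[R]_(k, m)),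
    (F == L)%MS -> F *m G *m F^T = 1%:M ->
  2 * (s L - s (orthocomp G L)) = 2 * (\sum_i bilin Rc (row i F) (row i F)) - tau.
Proof.
exists (\tr (Rc *m invmx G)) => L k F eqF F1.
have [E [E' [[eqE E1] [eqE' E'1] ->]]] := s_diff L.
have frE := orthocomp_frame G_sym G_pos eqE E1 eqE' E'1.
have -> : invmx G = E^T *m E + (E')^T *m E'.
  rewrite -[RHS](mulmxK (G_unit G_pos)) -mul_row_col -tr_col_mx.
  by rewrite frE mul1mx.
have eqFE : (F == E)%MS.
  by apply/eqmxP/(eqmx_trans (eqmxP eqF))/eqmx_sym/eqmxP.
have gr := orthonormal_gram_unique G_sym eqFE F1 E1.
rewrite !sum_bilin_gram gr mulmxDr mxtraceD; ring.
Qed.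

Lemma exists_subspace k l (L : 'M[R]_(l, m)) : (k <= \rank L)%N ->
  exists2 N : 'M[R]_m, (N <= L)%MS & \rank N = k.
Proof.
move=> kL; exists ((pid_mx k : 'M[R]_(m, \rank L)) *m row_base L).
  by rewrite -(eq_row_base L) submxMl.
rewrite mxrankMfree ?row_base_free // rank_pid_mx //.
by rewrite (leq_trans kL) // rank_leq_col.
Qed.

(** The first two conditions, taken for N + e and for N with N orthogonal to e,
    Z1 and Z2, differ by Ric(e, e). Such an N exists because m - 3 is at least
    p + q. *)
Lemma scal_Ric_horizontal lambda e : scal_conditions lambda ->
    bilin G e e = 1 -> bilin G Z1 e = 0 -> bilin G Z2 e = 0 ->
  bilin Rc e e = lambda.
Proof.
case=> condP condN _ ee Z1e Z2e.
have mx11 u v : u *m G *m v^T = (bilin G u v)%:M by rewrite [LHS]mx11_scalar.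
pose C := col_mx e (col_mx Z1 Z2).
pose L := kermx (G *m C^T).
have rL : (p + q <= \rank L)%N.
  have : (\rank (G *m C^T) <= 3)%N.
    by apply: leq_trans (mxrankM_maxr _ _) _; rewrite mxrank_tr rank_leq_row.
  rewrite mxrank_ker; move: (\rank (G *m C^T)) => r; move: mE p_gt0 q_gt0.
  clear; lia.
have [N NL rN] := exists_subspace rL.
have NC : N *m G *m C^T = 0 by rewrite -mulmxA; apply/sub_kermxP.
have : C *m G *m N^T = 0 by apply: trmx_inj; rewrite !trmx_mul trmxK G_sym trmx0 mulmxA.
rewrite /C !mul_col_mx -[0]vsubmxK => /eq_col_mx[]; rewrite linear0 => eN.
rewrite -[dsubmx _]vsubmxK => /eq_col_mx[]; rewrite !linear0 => Z1N Z2N.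
have [E eqE E1] := gram_schmidt G_sym G_pos rN.
have eE : e *m G *m E^T = 0.
  have /andP[/submxP[D ->] _] := eqE.
  by rewrite trmx_mul mulmxA eN mul0mx.
have Ee : E *m G *m e^T = 0 by apply: trmx_inj; rewrite !trmx_mul trmxK G_sym trmx0 mulmxA.
pose F := col_mx E e.
have F1 : F *m G *m F^T = 1%:M.
  by rewrite /F tr_col_mx mul_col_mx mul_col_row E1 eE Ee mx11 ee -scalar_mx_block.
pose P := (N + e)%MS.
have eqF : (F == P)%MS.
  apply/eqmxP/eqmx_sym; rewrite /P /F; apply: eqmx_trans (addsmxE _ _).
  by apply: adds_eqmx => //; apply/eqmx_sym/eqmxP.
have rP : \rank P = (p + q + 1)%N.
  rewrite -(eqmxP eqF); apply/eqP; apply/row_freeP.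
  by exists (G *m F^T); rewrite mulmxA.
have [tau st] := s_diff_trace.
have orthP z : bilin G z e = 0 -> z *m G *m N^T = 0 -> (z <= orthocomp G P)%MS.
  move=> ze zN; apply/sub_orthocompP.
  have /andP[_ /submxP[D ->]] := eqF.
  rewrite trmx_mul mulmxA /F tr_col_mx mul_mx_row mx11 ze.
  have /andP[/submxP[D' ->] _] := eqE.
  by rewrite trmx_mul mulmxA zN mul0mx raddf0 row_mx0 mul0mx.
have sumF : \sum_i bilin Rc (row i F) (row i F) =
            \sum_i bilin Rc (row i E) (row i E) + bilin Rc e e.
  rewrite [LHS]big_split_ord /= big_ord1; congr (_ + _).
    by apply: eq_bigr => i _; rewrite rowKu.
  by rewrite rowKd row_id.
have := condP P rP (orthP _ Z1e Z1N) (orthP _ Z2e Z2N).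
have := condN N rN (introT (sub_orthocompP _ _ _) Z1N) (introT (sub_orthocompP _ _ _) Z2N).
have := st P _ F eqF F1; have := st N _ E eqE E1.
rewrite sumF; lra.
Qed.

(** The quadratic form Ric - lambda g vanishes on the orthogonal of Z1 and Z2,
    hence so does its polar form; h is the projection onto this orthogonal, and
    the remaining values of Ric are those on Z1 and Z2. *)
Lemma scal_quasi_einstein lambda : scal_conditions lambda ->
  quasi_einstein_at lambda (2 * p%:R - lambda) (2 * q%:R - lambda).
Proof.
move=> cond.
have G_symm := bilin_symG G_sym.
have Rc_symm u v : bilin Rc u v = bilin Rc v u by rewrite -bilin_tr Rc_sym.
have quad e : bilin G Z1 e = 0 -> bilin G Z2 e = 0 ->
    bilin Rc e e = lambda * bilin G e e.
  move=> Z1e Z2e; have [->|en0] := eqVneq e 0; first by rewrite !bilin0l mulr0.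
  have gt0 := G_pos en0; set n := bilin G e e in gt0 *.
  have nn : (Num.sqrt n)^-1 * (Num.sqrt n)^-1 = n^-1.
    by rewrite -invfM -expr2 sqr_sqrtr // ltW.
  have := @scal_Ric_horizontal lambda ((Num.sqrt n)^-1 *: e) cond.
  rewrite !(bilinZl, bilinZr) Z1e Z2e !mulr0 !mulrA nn -/n mulVf ?gt_eqF //.
  by move=> /(_ erefl erefl erefl) <-; rewrite mulrAC mulVf ?mul1r ?gt_eqF.
pose h u := u - bilin G u Z1 *: Z1 - bilin G u Z2 *: Z2.
have hZ1 u : bilin G Z1 (h u) = 0.
  rewrite /h !(bilinDr, bilinNr, bilinZr) G11 G12 (G_symm Z1); ring.
have hZ2 u : bilin G Z2 (h u) = 0.
  rewrite /h !(bilinDr, bilinNr, bilinZr) G22 (G_symm Z2 Z1) G12 (G_symm Z2); ring.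
have hh u v : bilin Rc (h u) (h v) = lambda * bilin G (h u) (h v).
  have e0 z : bilin G z (h u) = 0 -> bilin G z (h v) = 0 -> bilin G z (h u + h v) = 0.
    by move=> zu zv; rewrite bilinDr zu zv addr0.
  have := quad (h u + h v) (e0 _ (hZ1 u) (hZ1 v)) (e0 _ (hZ2 u) (hZ2 v)).
  have := quad _ (hZ1 u) (hZ2 u); have := quad _ (hZ1 v) (hZ2 v).
  move: (h u) (h v) => a b; rewrite !(bilinDl, bilinDr) (Rc_symm b) (G_symm b).
  by move=> e1 e2 e3; apply: (polar_arith e2 e1 e3).
move=> u v.
have Rc1 w : bilin Rc Z1 w = 2 * p%:R * bilin G w Z1 by rewrite Rc_symm RcZ1.
have Rc2 w : bilin Rc Z2 w = 2 * q%:R * bilin G w Z2 by rewrite Rc_symm RcZ2.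
have := hh u v; rewrite /h !(bilinDl, bilinNl, bilinZl, bilinDr, bilinNr, bilinZr).
rewrite !(RcZ1, RcZ2, Rc1, Rc2) (G_symm Z2 Z1) G11 G22 G12.
rewrite (G_symm Z1 v) (G_symm Z2 v).
move=> e; apply/eqP; rewrite -subr_eq0; move/eqP: e; rewrite -subr_eq0 => /eqP e.
by apply/eqP; rewrite -[RHS]e; ring.
Qed.

End PointwiseEinstein.

(** * Calculus of matrix-valued maps *)

Section Line.
Variables (R : realType) (V : normedModType R).

Lemma is_derive_line (f : V -> R) (a u : V) (s : R) : derivable f (a + s *: u) u ->
  is_derive s 1 (fun r : R => f (a + r *: u)) ('D_u f (a + s *: u)).
Proof.
have qE : (fun h : R => h^-1 *: (((fun r : R => f (a + r *: u)) \o shift s) (h *: 1) - f (a + s *: u))) =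
          (fun h : R => h^-1 *: ((f \o shift (a + s *: u)) (h *: u) - f (a + s *: u))).
  apply: funext => h; rewrite /= [h *: 1]mulr1 scalerDl addrCA.
  by rewrite [_ + (_ *: u)]addrC.
move=> df; split; first by rewrite /derivable qE.
by rewrite /derive qE.
Qed.

End Line.

(* From here on derivatives are used only through their rules of calculation. *)
Opaque derive.

Section MatrixCalculus.
Variables (R : realType) (V : normedModType R).
Implicit Types (x u v : V).

Lemma differentiable_entry a b (F : V -> 'M[R]_(a, b)) x i j :
  differentiable F x -> differentiable (fun y => F y i j) x.
Proof.
move=> dF; apply: (@differentiable_comp _ _ _ _ F (fun N : 'M[R]_(a, b) => N i j)) => //.
exact: differentiable_coord.
Qed.

Lemma differentiable_sumf (I : Type) (r : seq I) (W : normedModType R) (f : I -> V -> W) x :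
  (forall i, differentiable (f i) x) -> differentiable (fun y => \sum_(i <- r) f i y) x.
Proof.
move=> df; elim: r => [|i r IH].
  have -> : (fun y => \sum_(i <- [::]) f i y) = cst 0 by apply: funext => y; rewrite big_nil.
  exact: differentiable_cst.
have -> : (fun y => \sum_(j <- i :: r) f j y) = f i + (fun y => \sum_(j <- r) f j y).
  by apply: funext => y; rewrite big_cons.
exact: differentiableD.
Qed.

Lemma differentiable_prodf (I : Type) (r : seq I) (f : I -> V -> R) x :
  (forall i, differentiable (f i) x) -> differentiable (fun y => \prod_(i <- r) f i y) x.
Proof.
move=> df; elim: r => [|i r IH].
  have -> : (fun y => \prod_(i <- [::]) f i y) = cst 1 by apply: funext => y; rewrite big_nil.
  exact: differentiable_cst.
have -> : (fun y => \prod_(j <- i :: r) f j y) = f i * (fun y => \prod_(j <- r) f j y).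
  by apply: funext => y; rewrite big_cons.
exact: differentiableM.
Qed.

Lemma differentiable_mxP a b (F : V -> 'M[R]_(a, b)) x :
  (forall i j, differentiable (fun y => F y i j) x) -> differentiable F x.
Proof.
move=> dF.
have -> : F = (fun y => \sum_i \sum_j F y i j *: delta_mx i j).
  by apply: funext => y; rewrite -matrix_sum_delta.
apply: differentiable_sumf => i; apply: differentiable_sumf => j.
exact: differentiableZl.
Qed.

Lemma derive_entry a b (F : V -> 'M[R]_(a, b)) x u i j :
  differentiable F x -> 'D_u (fun y => F y i j) x = ('D_u F x) i j.
Proof. by move=> dF; rewrite derive_mx ?mxE //; apply: diff_derivable. Qed.

Lemma differentiable_mulmx a b c (F : V -> 'M[R]_(a, b)) (H : V -> 'M[R]_(b, c)) x :
  differentiable F x -> differentiable H x -> differentiable (fun y => F y *m H y) x.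
Proof.
move=> dF dH; apply: differentiable_mxP => i j.
have -> : (fun y => (F y *m H y) i j) = (fun y => \sum_k F y i k * H y k j).
  by apply: funext => y; rewrite mxE.
apply: differentiable_sumf => k.
by apply: differentiableM; apply: differentiable_entry.
Qed.

Lemma derive_sumf (I : Type) (r : seq I) (W : normedModType R) (f : I -> V -> W) x u :
  (forall i, derivable (f i) x u) ->
  derivable (fun y => \sum_(i <- r) f i y) x u /\
  'D_u (fun y => \sum_(i <- r) f i y) x = \sum_(i <- r) 'D_u (f i) x.
Proof.
move=> df; elim: r => [|i r [IHd IH]].
  have -> : (fun y => \sum_(i <- [::]) f i y) = cst 0 by apply: funext => y; rewrite big_nil.
  by rewrite big_nil derive_cst; split=> //; apply: derivable_cst.
have -> : (fun y => \sum_(j <- i :: r) f j y) = f i + (fun y => \sum_(j <- r) f j y).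
  by apply: funext => y; rewrite big_cons.
split; first exact: derivableD (df i) IHd.
by rewrite big_cons -IH; apply: deriveD (df i) IHd.
Qed.

Lemma derive_mulmx a b c (F : V -> 'M[R]_(a, b)) (H : V -> 'M[R]_(b, c)) x u :
    differentiable F x -> differentiable H x ->
  'D_u (fun y => F y *m H y) x = 'D_u F x *m H x + F x *m 'D_u H x.
Proof.
move=> dF dH; apply/matrixP => i j.
rewrite -derive_entry; last exact: differentiable_mulmx.
have -> : (fun y => (F y *m H y) i j) =
    (fun y => \sum_k ((fun y => F y i k) * (fun y => H y k j)) y).
  by apply: funext => y; rewrite mxE.
have dFk k : derivable (fun y => F y i k) x u by apply/diff_derivable/differentiable_entry.
have dHk k : derivable (fun y => H y k j) x u by apply/diff_derivable/differentiable_entry.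
rewrite (derive_sumf _ _).2; last by move=> k; apply: derivableM.
rewrite !mxE -big_split /=; apply: eq_bigr => k _.
rewrite deriveM // !derive_entry // addrC; congr (_ + _).
by rewrite mulrC.
Qed.

Lemma differentiable_lin_mx a b c d (L : 'M[R]_(a, b) -> 'M[R]_(c, d))
    (F : V -> 'M[R]_(a, b)) x :
    (forall k A B, L (k *: A + B) = k *: L A + L B) ->
    differentiable F x ->
  differentiable (fun y => L (F y)) x /\
  forall u, 'D_u (fun y => L (F y)) x = L ('D_u F x).
Proof.
move=> linL dF.
have L0 : L 0 = 0.
  by have /eqP := linL 1 0 0; rewrite !scale1r addr0 -subr_eq0 opprD addNKr oppr_eq0 => /eqP.
have LD A B : L (A + B) = L A + L B by have := linL 1 A B; rewrite !scale1r.
have LZ k A : L (k *: A) = k *: L A by have := linL k A 0; rewrite L0 !addr0.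
have LE A : L A = \sum_i \sum_j A i j *: L (delta_mx i j).
  rewrite {1}[A]matrix_sum_delta (big_morph L LD L0); apply: eq_bigr => i _.
  by rewrite (big_morph L LD L0); apply: eq_bigr => j _; rewrite LZ.
have dFij i j : differentiable (fun y => F y i j *: L (delta_mx i j)) x.
  exact/differentiableZl/differentiable_entry.
have -> : (fun y => L (F y)) = (fun y => \sum_i \sum_j F y i j *: L (delta_mx i j)).
  by apply: funext => y; rewrite LE.
split=> [|u].
  by apply: differentiable_sumf => i; apply: differentiable_sumf.
rewrite (derive_sumf _ _).2 => [|i]; last first.
  by apply/diff_derivable/differentiable_sumf.
rewrite LE; apply: eq_bigr => i _; rewrite (derive_sumf _ _).2 => [|j]; last first.
  exact/diff_derivable.
apply: eq_bigr => j _; rewrite -derive_entry //.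
rewrite deriveE // diffZl /=; last exact: differentiable_entry.
by rewrite deriveE //; apply: differentiable_entry.
Qed.

Lemma differentiable_tr a b (F : V -> 'M[R]_(a, b)) x :
  differentiable F x -> differentiable (fun y => (F y)^T) x.
Proof.
by move=> dF; apply: (differentiable_lin_mx _ dF).1 => k A B; rewrite linearP.
Qed.

Lemma derive_tr a b (F : V -> 'M[R]_(a, b)) x u :
  differentiable F x -> 'D_u (fun y => (F y)^T) x = ('D_u F x)^T.
Proof.
by move=> dF; apply: (differentiable_lin_mx _ dF).2 => k A B; rewrite linearP.
Qed.

Lemma differentiable_det n (F : V -> 'M[R]_n) x :
  differentiable F x -> differentiable (fun y => \det (F y)) x.
Proof.
move=> dF; apply: differentiable_sumf => s.
apply: differentiableM; first exact: differentiable_cst.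
by apply: differentiable_prodf => i; apply: differentiable_entry.
Qed.

(** Cramer's formula is differentiable on its own, whereas [invmx] is defined
    by cases; the two agree on invertible matrices. *)
Lemma differentiable_invmx n (F : V -> 'M[R]_n) x :
    differentiable F x -> (\forall y \near x, F y \in unitmx) ->
  differentiable (fun y => (\det (F y))^-1 *: \adj (F y)) x.
Proof.
move=> dF uF; apply: differentiable_mxP => i j.
have -> : (fun y => ((\det (F y))^-1 *: \adj (F y)) i j) =
  (fun y => (\det (F y))^-1) * (fun y => (-1) ^+ (j + i) * \det (row' j (col' i (F y)))).
  by apply: funext => y; rewrite !mxE.
apply: differentiableM.
  apply: differentiableV; first exact: differentiable_det.
  by have := nbhs_singleton uF; rewrite unitmxE unitfE.
apply: differentiableM; first exact: differentiable_cst.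
apply: differentiable_det; apply: differentiable_mxP => k l.
have -> : (fun y => row' j (col' i (F y)) k l) = (fun y => F y (lift j k) (lift i l)).
  by apply: funext => y; rewrite !mxE.
exact: differentiable_entry.
Qed.

Lemma derive_linear_dir (W : normedModType R) (F : V -> W) x a u v :
  differentiable F x -> 'D_(a *: u + v) F x = a *: 'D_u F x + 'D_v F x.
Proof. by move=> dF; rewrite !deriveE // linearP. Qed.

Lemma derive_eq_open (W : normedModType R) (U : set V) (F H : V -> W) x u :
  open U -> U x -> (forall y, U y -> F y = H y) -> 'D_u F x = 'D_u H x.
Proof.
move=> oU Ux FH; apply: near_eq_derive.
by apply: filterS (open_nbhs_nbhs (conj oU Ux)) => y /FH.
Qed.

Lemma differentiable_eq_open (W : normedModType R) (U : set V) (F H : V -> W) x :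
    open U -> U x -> (forall y, U y -> F y = H y) -> differentiable F x ->
  differentiable H x.
Proof.
move=> oU Ux FH dF; have nU : nbhs x U by apply: open_nbhs_nbhs.
have dH : H \o shift x = cst (H x) + 'd F x +o_ 0 id.
  have /eqadd_some_oP dF' := diff_locally dF.
  apply/eqaddoP => e e0; have := dF' e e0; rewrite !near_simpl => dF0.
  have nU0 : \forall y \near (0 : V), U (y + x).
    by have := nU; rewrite -[nbhs x U]/(\near x, U x) (near_shift 0) subr0.
  apply: filterS2 nU0 dF0 => y Uy.
  suff -> : (F \o shift x - (cst (F x) + 'd F x)) y =
            (H \o shift x - (cst (H x) + 'd F x)) y by [].
  change (F (y + x) - (F x + 'd F x y) = H (y + x) - (H x + 'd F x y)).
  by rewrite !FH.
have dHE := diff_unique (@diff_continuous _ _ _ _ _ dF) dH.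
by apply/diff_locallyP; rewrite dHE; split=> //; apply: diff_continuous.
Qed.

End MatrixCalculus.

Lemma norm_sub_half (R : realType) (a b c e : R) :
  `|a - c| < e / 2 -> `|b - c| < e / 2 -> `|a - b| <= e.
Proof.
move=> ac bc; have -> : a - b = (a - c) - (b - c) by rewrite opprB addrA subrK.
by rewrite (le_trans (ler_normB _ _)) // [leRHS]splitr ltW // ltrD.
Qed.

Section Schwarz.
Variables (R : realType) (V : normedModType R).
Implicit Types (f : V -> R) (U : set V) (x u v : V).

(** The mean value theorem, applied along u to a difference in the direction v
    and then along v to the derivative in the direction u. *)
Lemma second_difference f U x u v (h : R) : 0 < h ->
    (forall s t : R, 0 <= s <= h -> 0 <= t <= h -> U (x + s *: u + t *: v)) ->
    (forall y, U y -> differentiable f y) ->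
    (forall y, U y -> differentiable ('D_u f) y) ->
  exists s t : R, [/\ 0 <= s <= h, 0 <= t <= h &
    f (x + h *: u + h *: v) - f (x + h *: u) - (f (x + h *: v) - f x) =
    'D_v ('D_u f) (x + s *: u + t *: v) * h * h].
Proof.
move=> h0 Uh df ddf.
have h00 : 0 <= (0 : R) <= h by rewrite lexx ltW.
have hhh : 0 <= h <= h by rewrite lexx ltW.
pose F (s : R) := f ((x + h *: v) + s *: u) - f (x + s *: u).
have dF s : s \in `[0, h] -> is_derive s 1 F
    ('D_u f ((x + h *: v) + s *: u) - 'D_u f (x + s *: u)).
  rewrite in_itv /= => sh; apply: is_deriveB; apply: is_derive_line.
    by apply/diff_derivable/df; rewrite addrAC; apply: Uh.
  by apply/diff_derivable/df; rewrite -[_ + _]addr0 -(scale0r v); apply: Uh.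
have Fd s : s \in `]0, h[ -> is_derive s 1 F
    ('D_u f ((x + h *: v) + s *: u) - 'D_u f (x + s *: u)).
  move=> sh; apply: dF; exact: (subset_itv_oo_cc sh).
have Fc : {within `[0, h], continuous F}.
  apply: derivable_within_continuous => s sh; by have [] := dF s sh.
have mvt := MVT h0 Fd Fc.
have [s] := mvt => /subset_itv_oo_cc; rewrite in_itv /= => sh.
rewrite subr0 => Fh.
have dG t : t \in `[0, h] -> is_derive t 1
    (fun t : R => 'D_u f (x + s *: u + t *: v)) ('D_v ('D_u f) (x + s *: u + t *: v)).
  rewrite in_itv /= => th; apply: is_derive_line.
  by apply/diff_derivable/ddf; apply: Uh.
have Gd t : t \in `]0, h[ -> is_derive t 1
    (fun t : R => 'D_u f (x + s *: u + t *: v)) ('D_v ('D_u f) (x + s *: u + t *: v)).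
  move=> th; apply: dG; exact: (subset_itv_oo_cc th).
have Gc : {within `[0, h], continuous (fun t : R => 'D_u f (x + s *: u + t *: v))}.
  apply: derivable_within_continuous => t th; by have [] := dG t th.
have mvt' := MVT h0 Gd Gc.
have [t] := mvt' => /subset_itv_oo_cc; rewrite in_itv /= => th.
rewrite subr0 scale0r addr0 => Gh.
exists s, t; split=> //; rewrite -Gh [X in (X - _) * _]/=.
rewrite (addrAC x (s *: u)) -Fh /F scale0r !addr0 (addrAC x (h *: u)).
ring.
Qed.

(** Both mixed derivatives are limits of the same second difference on a square
    shrinking to x. *)
Lemma schwarz f U x u v : open U -> U x ->
    (forall y, U y -> differentiable f y) ->
    (forall w y, U y -> differentiable ('D_w f) y) ->
    {for x, continuous ('D_u ('D_v f))} -> {for x, continuous ('D_v ('D_u f))} ->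
  'D_u ('D_v f) x = 'D_v ('D_u f) x.
Proof.
move=> oU Ux df ddf cuv cvu; apply/eqP; rewrite -subr_eq0 -normr_le0.
apply/ler_addgt0Pl => e e0; rewrite addr0.
have e20 : 0 < e / 2 by rewrite divr_gt0.
have nU : nbhs x U by apply: open_nbhs_nbhs.
have : \forall y \near x, [/\ U y, `|'D_u ('D_v f) x - 'D_u ('D_v f) y| < e / 2 &
    `|'D_v ('D_u f) x - 'D_v ('D_u f) y| < e / 2].
  have c1 : \forall y \near x, `|'D_u ('D_v f) x - 'D_u ('D_v f) y| < e / 2.
    by move/cvgrPdist_lt: cuv; apply.
  have c2 : \forall y \near x, `|'D_v ('D_u f) x - 'D_v ('D_u f) y| < e / 2.
    by move/cvgrPdist_lt: cvu; apply.
  by apply: (filter_app _ _ (filterI nU (filterI c1 c2))); apply: nearW => y [? [? ?]]; split.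
move=> /nbhs_ballP[d /= d0 dP].
(* This size keeps the square of side h along u and v inside the ball of radius
   d. *)
pose h := d / 2 / (1 + `|u| + `|v|).
have k0 : 0 < 1 + `|u| + `|v|.
  by rewrite -addrA ltr_pwDl // addr_ge0.
have h0 : 0 < h by rewrite !divr_gt0.
have inball a b s t : a = u /\ b = v \/ a = v /\ b = u ->
    0 <= s <= h -> 0 <= t <= h -> ball x d (x + s *: a + t *: b).
  move=> ab /andP[s0 sh] /andP[t0 th]; rewrite -ball_normE /= -addrA opprD addNKr.
  rewrite normrN (le_lt_trans (ler_normD _ _)) // !normrZ !ger0_norm //.
  apply: (@le_lt_trans _ _ (h * (1 + `|u| + `|v|))).
    have : s * `|a| + t * `|b| <= h * `|a| + h * `|b|.
      by apply: lerD; apply: ler_wpM2r.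
    case: ab => -[-> ->] /le_trans; apply; rewrite -addrA !mulrDr mulr1; lra.
  rewrite /h mulfVK ?gt_eqF //; lra.
have [s [t [sh th E1]]] := second_difference h0
  (fun s t sh th => let: And3 a _ _ := dP _ (@inball u v s t (or_introl (conj erefl erefl)) sh th) in a) df (ddf u).
have [s' [t' [sh' th' E2]]] := second_difference h0
  (fun s t sh th => let: And3 a _ _ := dP _ (@inball v u s t (or_intror (conj erefl erefl)) sh th) in a) df (ddf v).
have [_ _ B1] := dP _ (@inball u v s t (or_introl (conj erefl erefl)) sh th).
have [_ A1 _] := dP _ (@inball v u s' t' (or_intror (conj erefl erefl)) sh' th').
have : 'D_v ('D_u f) (x + s *: u + t *: v) = 'D_u ('D_v f) (x + s' *: v + t' *: u).
  apply: (mulIf (lt0r_neq0 h0)); apply: (mulIf (lt0r_neq0 h0)).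
  apply: etrans (esym E1) _; apply: etrans _ E2.
  by rewrite (addrAC x (h *: u)) !opprB addrACA [X in _ + X]addrC -addrACA.
move=> b1E; rewrite b1E in B1; exact: norm_sub_half A1 B1.
Qed.

End Schwarz.

(** * Partial derivatives of smooth maps *)

Section Smooth.
Variables (R : realType) (V : normedModType R).
Implicit Types (U : set V) (x u v : V).

Lemma smooth_differentiable (W : normedModType R) U (F : V -> W) x :
  smooth_on U F -> U x -> differentiable F x.
Proof. by move=> /(_ 1%N)[dF _]; apply: dF. Qed.

Lemma smooth_differentiableD (W : normedModType R) U (F : V -> W) x u :
  smooth_on U F -> U x -> differentiable ('D_u F) x.
Proof. by move=> /(_ 2%N)[_ /(_ u)[dF _]]; apply: dF. Qed.

Lemma smooth_continuousDD (W : normedModType R) U (F : V -> W) x u v :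
  smooth_on U F -> U x -> {for x, continuous ('D_u ('D_v F))}.
Proof. by move=> /(_ 2%N)[_ /(_ v)[_ /(_ u)]]; apply. Qed.

Lemma continuous_eq_open (W : normedModType R) U (F H : V -> W) x :
    open U -> U x -> (forall y, U y -> F y = H y) -> {for x, continuous F} ->
  {for x, continuous H}.
Proof.
move=> oU Ux FH cF; rewrite /prop_for /continuous_at -FH //.
apply: cvg_trans cF; apply: near_eq_cvg.
by apply: filterS (open_nbhs_nbhs (conj oU Ux)) => y /FH.
Qed.

Lemma schwarz_mx a b U (F : V -> 'M[R]_(a, b)) x u v :
  open U -> smooth_on U F -> U x -> 'D_u ('D_v F) x = 'D_v ('D_u F) x.
Proof.
move=> oU sF Ux; apply/matrixP => i j.
have dF y : U y -> differentiable F y by apply: smooth_differentiable.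
have ddF w y : U y -> differentiable ('D_w F) y by apply: smooth_differentiableD.
have D1 w y : U y -> ('D_w F y) i j = 'D_w (fun z => F z i j) y.
  by move=> Uy; rewrite derive_entry //; apply: dF.
have D2 w w' y : U y -> ('D_w' ('D_w F) y) i j = 'D_w' ('D_w (fun z => F z i j)) y.
  move=> Uy; rewrite -derive_entry; last exact: ddF.
  by apply: (derive_eq_open _ oU Uy) => z /D1.
have C2 w w' : {for x, continuous ('D_w' ('D_w (fun z => F z i j)))}.
  apply: (continuous_eq_open oU Ux (D2 w w')).
  have cDD : {for x, continuous ('D_w' ('D_w F))} by apply: smooth_continuousDD sF Ux.
  apply: (@continuous_comp _ _ _ ('D_w' ('D_w F)) (fun N : 'M[R]_(a, b) => N i j)) => //.
  exact: coord_continuous.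
apply: etrans (D2 v u x Ux) _; apply: etrans _ (esym (D2 u v x Ux)).
apply: (@schwarz R V (fun z => F z i j) U x u v oU Ux).
- by move=> y Uy; apply/differentiable_entry/dF.
- move=> w y Uy; apply: (differentiable_eq_open oU Uy (D1 w)).
  exact/differentiable_entry/ddF.
- exact: C2.
- exact: C2.
Qed.

Lemma derive_bilin n (F : V -> 'M[R]_n) x u (a b : 'rV[R]_n) : differentiable F x ->
  differentiable (fun y => bilin (F y) a b) x /\
  'D_u (fun y => bilin (F y) a b) x = bilin ('D_u F x) a b.
Proof.
move=> dF.
have lin k (A B : 'M[R]_n) : a *m (k *: A + B) *m b^T = k *: (a *m A *m b^T) + a *m B *m b^T.
  by rewrite mulmxDr mulmxDl -scalemxAr -scalemxAl.
have [dL DL] := differentiable_lin_mx lin dF; split.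
  exact: (differentiable_entry 0 0 dL).
by rewrite (derive_entry _ _ _ dL) DL.
Qed.

End Smooth.

Section PartialDerivative.
Variables (R : realType) (m a b : nat).

(** The directional derivative of a matrix-valued map, kept abstract so that
    only its rules of calculation enter the computations below. *)
Fact pd_subproof : {D : ('rV[R]_m -> 'M[R]_(a, b)) -> 'rV[R]_m -> 'rV[R]_m -> 'M[R]_(a, b) |
  forall F u x, D F u x = 'D_u F x}.
Proof. by exists (fun F u x => 'D_u F x). Qed.

Definition pd := sval pd_subproof.

Lemma pdE F u x : pd F u x = 'D_u F x.
Proof. exact: (svalP pd_subproof). Qed.

Lemma pd_fun F u : pd F u = 'D_u F.
Proof. by apply: funext => x; rewrite pdE. Qed.

End PartialDerivative.

Section PartialDerivativeTheory.
Variables (R : realType) (m : nat).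
Implicit Types (U : set 'rV[R]_m) (x y u v w : 'rV[R]_m).

Lemma smooth_pd a b U (F : 'rV[R]_m -> 'M[R]_(a, b)) x u :
  smooth_on U F -> U x -> differentiable (pd F u) x.
Proof. by rewrite pd_fun; apply: smooth_differentiableD. Qed.

Lemma pd_schwarz a b U (F : 'rV[R]_m -> 'M[R]_(a, b)) x u v :
  open U -> smooth_on U F -> U x -> pd (pd F v) u x = pd (pd F u) v x.
Proof. by rewrite !pd_fun; apply: schwarz_mx. Qed.

Lemma pd_eq a b U (F H : 'rV[R]_m -> 'M[R]_(a, b)) x u :
  open U -> U x -> (forall y, U y -> F y = H y) -> pd F u x = pd H u x.
Proof. by rewrite !pdE; apply: derive_eq_open. Qed.

Lemma pd_dir a b (F : 'rV[R]_m -> 'M[R]_(a, b)) x (k : R) u v : differentiable F x ->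
  pd F (k *: u + v) x = k *: pd F u x + pd F v x.
Proof. by rewrite !pdE; apply: derive_linear_dir. Qed.

Lemma pd_cst a b (A : 'M[R]_(a, b)) x u : pd (fun=> A) u x = 0.
Proof. by rewrite pdE; apply: derive_cst. Qed.

Lemma pd_mul a b c (F : 'rV[R]_m -> 'M[R]_(a, b)) (H : 'rV[R]_m -> 'M[R]_(b, c)) x u :
    differentiable F x -> differentiable H x ->
  pd (fun y => F y *m H y) u x = pd F u x *m H x + F x *m pd H u x.
Proof. by rewrite !pdE; apply: derive_mulmx. Qed.

Lemma pd_lin a b c d (L : 'M[R]_(a, b) -> 'M[R]_(c, d)) (F : 'rV[R]_m -> 'M[R]_(a, b)) x u :
    (forall k A B, L (k *: A + B) = k *: L A + L B) -> differentiable F x ->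
  pd (fun y => L (F y)) u x = L (pd F u x).
Proof. by rewrite !pdE => linL dF; apply: (differentiable_lin_mx linL dF).2. Qed.

Lemma pd_tr a b (F : 'rV[R]_m -> 'M[R]_(a, b)) x u :
  differentiable F x -> pd (fun y => (F y)^T) u x = (pd F u x)^T.
Proof. by rewrite !pdE; apply: derive_tr. Qed.

Lemma differentiable_addf a b (F H : 'rV[R]_m -> 'M[R]_(a, b)) x :
  differentiable F x -> differentiable H x -> differentiable (fun y => F y + H y) x.
Proof. exact: differentiableD. Qed.

Lemma pd_add a b (F H : 'rV[R]_m -> 'M[R]_(a, b)) x u :
  differentiable F x -> differentiable H x ->
  pd (fun y => F y + H y) u x = pd F u x + pd H u x.
Proof. by rewrite !pdE => dF dH; apply: deriveD; apply: diff_derivable. Qed.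

Lemma differentiable_oppf a b (F : 'rV[R]_m -> 'M[R]_(a, b)) x :
  differentiable F x -> differentiable (fun y => - F y) x.
Proof. exact: differentiableN. Qed.

Lemma pd_opp a b (F : 'rV[R]_m -> 'M[R]_(a, b)) x u :
  differentiable F x -> pd (fun y => - F y) u x = - pd F u x.
Proof. by rewrite !pdE => dF; apply: deriveN; apply: diff_derivable. Qed.

Lemma pd_bilin n (F : 'rV[R]_m -> 'M[R]_n) x u (a b : 'rV[R]_n) : differentiable F x ->
  'D_u (fun y => bilin (F y) a b) x = bilin (pd F u x) a b.
Proof. by move=> dF; rewrite pdE; apply: (derive_bilin _ _ _ dF).2. Qed.

End PartialDerivativeTheory.

Lemma linear_sumE (R : realType) m (f : 'rV[R]_m -> R) :
    (forall a u v, f (a *: u + v) = a * f u + f v) ->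
  forall u, f u = \sum_i f (delta_mx 0 i) * u 0 i.
Proof.
move=> linf u.
pose h w : 'rV[R]_1 := (f w)%:M.
have linh a v w : h (a *: v + w) = a *: h v + h w.
  by rewrite /h linf raddfD /= -scale_scalar_mx.
have /matrixP/(_ 0 0) := linear_mxE linh u.
rewrite !mxE eqxx mulr1n => ->; apply: eq_bigr => i _.
by rewrite !mxE eqxx mulr1n mulrC.
Qed.

(** * Curvature of a metric in a chart *)

(** The Christoffel map and, below, the curvature are kept abstract for the
    same reason as [pd]. *)
Fact chr_subproof (R : realType) (m : nat) :
  {C : ('rV[R]_m -> 'M[R]_m) -> 'rV[R]_m -> 'rV[R]_m -> 'rV[R]_m -> 'rV[R]_m |
   forall G y u v, C G y u v = christoffel G y u v}.
Proof. by exists (@christoffel R m). Qed.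

Definition chr (R : realType) (m : nat) := sval (chr_subproof R m).

Lemma chrE (R : realType) (m : nat) G (y u v : 'rV[R]_m) : chr G y u v = christoffel G y u v.
Proof. exact: (svalP (chr_subproof R m)). Qed.

Fact cvt_subproof (R : realType) (m : nat) :
  {C : ('rV[R]_m -> 'M[R]_m) -> 'rV[R]_m -> 'rV[R]_m -> 'rV[R]_m -> 'rV[R]_m -> 'rV[R]_m |
   forall G y u v w, C G y u v w = curv G y u v w}.
Proof. by exists (@curv R m). Qed.

Definition cvt (R : realType) (m : nat) := sval (cvt_subproof R m).

Lemma cvtE (R : realType) (m : nat) G (y u v w : 'rV[R]_m) : cvt G y u v w = curv G y u v w.
Proof. exact: (svalP (cvt_subproof R m)). Qed.

(** The identities closed after this hold for arbitrary values of the tensors. *)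
Ltac abstract_atoms := repeat match goal with
  | |- context [bilin ?A ?u ?v] => generalize (bilin A u v); intro
  | |- context [pd ?f ?x ?v] => generalize (pd f x v); intro
  | |- context [cvt ?A ?y ?u ?v ?w] => generalize (cvt A y u v w); intro
  | |- context [chr ?A ?y ?u ?v] => generalize (chr A y u v); intro
  end.

Section Curvature.
Variables (R : realType) (m : nat) (U : set 'rV[R]_m) (G : 'rV[R]_m -> 'M[R]_m).
Hypothesis oU : open U.
Hypothesis G_smooth : smooth_on U G.
Hypothesis G_sym : forall y, U y -> (G y)^T = G y.
Hypothesis G_pos : forall y, U y -> forall u : 'rV[R]_m, u != 0 -> 0 < bilin (G y) u u.
Implicit Types (x y u v w z : 'rV[R]_m).

Let dG y : U y -> differentiable G y. Proof. exact: smooth_differentiable. Qed.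
Let ddG u y : U y -> differentiable (pd G u) y.
Proof. exact: smooth_pd. Qed.

Lemma dG_sym y u : U y -> (pd G u y)^T = pd G u y.
Proof.
move=> Uy; rewrite -pd_tr; last exact: dG.
exact: (pd_eq _ oU Uy G_sym).
Qed.

Lemma bilin_dG_sym y u v w : U y -> bilin (pd G u y) v w = bilin (pd G u y) w v.
Proof. by move=> Uy; rewrite -bilin_tr dG_sym. Qed.

Lemma bilin_dG_dir y a u u' v w : U y ->
  bilin (pd G (a *: u + u') y) v w = a * bilin (pd G u y) v w + bilin (pd G u' y) v w.
Proof.
move=> Uy; apply: etrans (bilin_mxP _ _ _ _ _).
by congr (bilin _ v w); apply: pd_dir; apply: dG.
Qed.

Lemma metric_inj y u v : U y ->
  (forall w, bilin (G y) u w = bilin (G y) v w) -> u = v.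
Proof.
move=> Uy e; apply: (can_inj (mulmxK (G_unit (G_pos Uy)))).
by apply: rowbilinP => w; rewrite -!bilinE; apply: e.
Qed.

(** Koszul's formula for arbitrary w; [koszul] records it on the basis vectors,
    and both sides are linear in w. *)
Lemma christoffelE y u v w : U y -> bilin (G y) (chr G y u v) w =
  2^-1 * (bilin (pd G u y) v w + bilin (pd G v y) u w - bilin (pd G w y) u v).
Proof.
move=> Uy; rewrite chrE bilinE mulmxKV ?(G_unit (G_pos Uy)) //.
rewrite [RHS](linear_sumE (f := fun w => 2^-1 * (bilin (pd G u y) v w +
  bilin (pd G v y) u w - bilin (pd G w y) u v))).
  rewrite mxE; apply: eq_bigr => i _; rewrite !mxE; congr (_ * (_ + _ - _) * _);
  by apply: pd_bilin; apply: dG.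
by move=> a w1 w2; rewrite (bilin_dG_dir a w1 w2) // !(bilinDr, bilinZr); abstract_atoms; ring.
Qed.

Lemma christoffelC y u v : U y -> chr G y u v = chr G y v u.
Proof.
move=> Uy; apply: (metric_inj Uy) => w; rewrite !christoffelE //.
by rewrite (bilin_dG_sym w v u Uy) [_ + bilin (pd G v y) u w]addrC.
Qed.

Lemma christoffelP y a u u' v : U y -> chr G y (a *: u + u') v =
  a *: chr G y u v + chr G y u' v.
Proof.
move=> Uy; apply: (metric_inj Uy) => w.
rewrite bilinDl bilinZl !christoffelE // (bilin_dG_dir a u u') // !(bilinDl, bilinZl).
abstract_atoms; ring.
Qed.

Lemma christoffelPr y a u v v' : U y -> chr G y u (a *: v + v') =
  a *: chr G y u v + chr G y u v'.
Proof. by move=> Uy; rewrite christoffelC // christoffelP // !(christoffelC u). Qed.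

Lemma metric_compat y u v w : U y -> bilin (pd G u y) v w =
  bilin (G y) (chr G y u v) w + bilin (G y) v (chr G y u w).
Proof.
move=> Uy; rewrite [bilin (G y) v _](bilin_symG (G_sym Uy)) !christoffelE //.
rewrite (bilin_dG_sym u w v Uy).
abstract_atoms; lra.
Qed.

Lemma differentiable_christoffel y u v : U y ->
  differentiable (fun y => chr G y u v) y.
Proof.
move=> Uy; have -> : (fun y => chr G y u v) = (fun y => koszul G y u v *m invmx (G y)).
  by apply: funext => z; rewrite chrE.
have dbil a w1 w2 : differentiable (fun z => bilin (pd G a z) w1 w2) y.
  by have [] := derive_bilin u w1 w2 (ddG a Uy).
apply: differentiable_mulmx.
  apply: (@differentiable_eq_open _ _ _ U (fun z => \row_j (2^-1 *
    (bilin (pd G u z) v (delta_mx 0 j) + bilin (pd G v z) u (delta_mx 0 j)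
     - bilin (pd G (delta_mx 0 j) z) u v)))) => //.
    move=> z Uz; apply/rowP => j; rewrite !mxE; congr (_ * (_ + _ - _));
    by symmetry; apply: pd_bilin; apply: dG.
  apply: differentiable_mxP => i j.
  have -> : (fun z => (\row_k (2^-1 *
      (bilin (pd G u z) v (delta_mx 0 k) + bilin (pd G v z) u (delta_mx 0 k)
       - bilin (pd G (delta_mx 0 k) z) u v))) i j) =
    (fun=> 2^-1) * ((fun z => bilin (pd G u z) v (delta_mx 0 j))
      + (fun z => bilin (pd G v z) u (delta_mx 0 j))
      - (fun z => bilin (pd G (delta_mx 0 j) z) u v)).
    by apply: funext => z; rewrite mxE.
  apply: differentiableM; first exact: differentiable_cst.
  by apply: differentiableB; [apply: differentiableD|]; apply: dbil.
apply: (@differentiable_eq_open _ _ _ U (fun z => (\det (G z))^-1 *: \adj (G z))) => //.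
  by move=> z Uz; rewrite /invmx (G_unit (G_pos Uz)).
apply: differentiable_invmx; first exact: dG.
apply: filterS (open_nbhs_nbhs (conj oU Uy)) => z Uz.
exact: (G_unit (G_pos Uz)).
Qed.

Lemma christoffel0l y v : U y -> chr G y 0 v = 0.
Proof.
move=> Uy; have := christoffelP (-1) 0 0 v Uy.
by rewrite scaler0 addr0 scaleN1r addNr.
Qed.

(** All brackets of constant fields vanish, as do their derivatives. *)
Lemma curvE x u v w : U x -> cvt G x u v w =
  pd (fun y => chr G y v w) u x - pd (fun y => chr G y u w) v x
  + chr G x u (chr G x v w) - chr G x v (chr G x u w).
Proof.
move=> Ux; rewrite cvtE /curv /riemann.
have nablaE a b : nabla G (fun=> a) (fun=> b) = (fun y => chr G y a b).
  by apply: funext => y; rewrite /nabla derive_cst add0r chrE.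
have nablaX X y a : nabla G (fun=> a) X y = pd X a y + chr G y a (X y).
  by rewrite /nabla pdE chrE.
rewrite !nablaX !nablaE /nabla /lie_bracket !derive_cst subrr.
rewrite -chrE christoffel0l // addr0 subr0.
by rewrite opprD addrACA addrA !pd_cst !add0r.
Qed.

Lemma derive_christoffel_lin x a u v v' w : U x ->
  pd (fun y => chr G y (a *: v + v') u) w x =
  a *: pd (fun y => chr G y v u) w x + pd (fun y => chr G y v' u) w x.
Proof.
move=> Ux; have dC b c := differentiable_christoffel b c Ux.
have linZ k (A B : 'rV[R]_m) : a *: (k *: A + B) = k *: (a *: A) + a *: B.
  by rewrite scalerDr !scalerA mulrC.
rewrite -(pd_lin _ linZ) // -pd_add //; last exact: (differentiable_lin_mx linZ _).1.
by apply: (pd_eq _ oU Ux) => y Uy; rewrite christoffelP.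
Qed.

Lemma curv_skew x u v w : U x -> cvt G x u v w = - cvt G x v u w.
Proof.
move=> Ux; rewrite !curvE //; abstract_atoms; apply/rowP => i; rewrite !mxE; ring.
Qed.

Lemma curvP1 x a u u' v w : U x ->
  cvt G x (a *: u + u') v w = a *: cvt G x u v w + cvt G x u' v w.
Proof.
move=> Ux; rewrite !curvE // pd_dir; last exact: differentiable_christoffel.
rewrite derive_christoffel_lin // !christoffelP // christoffelPr //.
abstract_atoms; apply/rowP => i; rewrite !mxE; ring.
Qed.

Lemma curvP2 x a u v v' w : U x ->
  cvt G x u (a *: v + v') w = a *: cvt G x u v w + cvt G x u v' w.
Proof.
move=> Ux; rewrite curv_skew // curvP1 // (curv_skew v) // (curv_skew v') //.
abstract_atoms; apply/rowP => i; rewrite !mxE; ring.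
Qed.

(** The terms cancel cyclically because the connection is symmetric. *)
Lemma bianchi x u v w : U x -> cvt G x u v w + cvt G x v w u + cvt G x w u v = 0.
Proof.
move=> Ux; rewrite !curvE //.
have sw a b c : pd (fun y => chr G y b c) a x = pd (fun y => chr G y c b) a x.
  by apply: (pd_eq _ oU Ux) => y; apply: christoffelC.
rewrite (sw v u w) (sw w v u) (sw u w v).
rewrite (christoffelC u w) // (christoffelC v u) // (christoffelC w v) //.
abstract_atoms; apply/rowP => i; rewrite !mxE; ring.
Qed.

Lemma bilin_curv_skew x u v w z : U x ->
  bilin (G x) (cvt G x u v w) z = - bilin (G x) (cvt G x v u w) z.
Proof. by move=> Ux; rewrite curv_skew // bilinNl. Qed.

(** Differentiating twice the equation that makes the connection metric, and
    antisymmetrising in the two directions, leaves exactly the curvature terms,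
    since second derivatives of G commute. *)
Lemma bilin_curv_skewr x u v w z : U x ->
  bilin (G x) (cvt G x u v w) z = - bilin (G x) (cvt G x u v z) w.
Proof.
move=> Ux.
have symG a b : bilin (G x) a b = bilin (G x) b a by apply/bilin_symG/G_sym.
have second a b : bilin (pd (pd G b) a x) w z =
    bilin (G x) (chr G x a (chr G x b w)) z +
    bilin (G x) (chr G x b w) (chr G x a z) +
    bilin (G x) (pd (fun y => chr G y b w) a x) z +
    (bilin (G x) (chr G x a (chr G x b z)) w +
    bilin (G x) (chr G x b z) (chr G x a w) +
    bilin (G x) (pd (fun y => chr G y b z) a x) w).
  have prod c d : differentiable (fun y => chr G y b c *m G y *m d^T) x /\
      (pd (fun y => chr G y b c *m G y *m d^T) a x) 0 0 =
      bilin (pd G a x) (chr G x b c) d + bilin (G x) (pd (fun y => chr G y b c) a x) d.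
    have dC := differentiable_christoffel b c Ux.
    have dGx := dG Ux.
    have dCG := differentiable_mulmx dC dGx.
    have dd : differentiable (fun=> d^T : 'cV[R]_m) x by apply: differentiable_cst.
    split; first exact: differentiable_mulmx.
    rewrite pd_mul // pd_cst mulmx0 addr0 pd_mul // mulmxDl mxE addrC.
    by rewrite !bilinE.
  have linb k (A B : 'M[R]_m) : w *m (k *: A + B) *m z^T = k *: (w *m A *m z^T) + w *m B *m z^T.
    by rewrite mulmxDr mulmxDl -scalemxAr -scalemxAl.
  rewrite bilinE -(pd_lin _ linb); last exact: ddG.
  transitivity ((pd (fun y => chr G y b w *m G y *m z^T + chr G y b z *m G y *m w^T) a x) 0 0).
    congr (fun_of_matrix _ 0 0); apply: (pd_eq _ oU Ux) => y Uy.
    apply/matrixP => i j; rewrite !ord1 [RHS]mxE -!bilinE metric_compat //; congr (_ + _).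
    by rewrite (bilin_symG (G_sym Uy)).
  rewrite pd_add; [|exact: (prod _ _).1..].
  by rewrite mxE !(prod _ _).2 !metric_compat.
have := second u v; rewrite (pd_schwarz u v oU G_smooth Ux) second !curvE //.
rewrite !(bilinDl, bilinNl).
rewrite (symG (chr G x u w)) (symG (chr G x u z)).
abstract_atoms; lra.
Qed.

(** The octahedron argument: the four Bianchi identities obtained by omitting
    one of the vectors, combined with the two skew symmetries. *)
Lemma bilin_curv_pair x u v w z : U x ->
  bilin (G x) (cvt G x u v w) z = bilin (G x) (cvt G x w z u) v.
Proof.
move=> Ux.
have B a b c d : bilin (G x) (cvt G x a b c) d + bilin (G x) (cvt G x b c a) d
    + bilin (G x) (cvt G x c a b) d = 0.
  by rewrite -!bilinDl bianchi // bilin0l.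
have S a b c d := bilin_curv_skewr a b c d Ux.
have A a b c d := bilin_curv_skew a b c d Ux.
have := S v w z u; have := S w z v u; have := A z v w u; have := S v z w u.
have := A u w z v; have := S w u z v; have := S z u v w; have := S u v z w.
have := B u v w z; have := B v w z u; have := B w z u v; have := B z u v w.
clear; abstract_atoms; lra.
Qed.

Lemma Ric_frame x k (F : 'M[R]_(k, m)) u v : U x -> frame (G x) F ->
  Ric G x u v = \sum_i bilin (G x) (cvt G x (row i F) u v) (row i F).
Proof.
move=> Ux frF; have linc a w w' : cvt G x (a *: w + w') u v = a *: cvt G x w u v + cvt G x w' u v.
  exact: curvP1.
under eq_bigr do rewrite (linear_mxE linc).
rewrite -(frame_trace _ frF); apply: eq_bigr => i _.
by rewrite -cvtE [RHS]mxE.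
Qed.

Lemma Ric_sym x u v : U x -> Ric G x u v = Ric G x v u.
Proof.
move=> Ux; have [F frF] := exists_frame (G_sym Ux) (G_pos Ux).
rewrite !(Ric_frame _ _ Ux frF); apply: eq_bigr => i _.
by rewrite bilin_curv_pair // bilin_curv_skew // bilin_curv_skewr // opprK.
Qed.

Lemma RicP x a u u' v : U x -> Ric G x (a *: u + u') v = a * Ric G x u v + Ric G x u' v.
Proof.
move=> Ux; rewrite /Ric mulr_sumr -big_split /=; apply: eq_bigr => i _.
by rewrite -!cvtE curvP2 // !mxE.
Qed.

Definition Ric_mx x : 'M[R]_m := \matrix_(i, j) Ric G x (delta_mx 0 i) (delta_mx 0 j).

Lemma Ric_mxE x u v : U x -> bilin (Ric_mx x) u v = Ric G x u v.
Proof.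
move=> Ux; have RP w : forall a u1 u2, Ric G x (a *: u1 + u2) w = a * Ric G x u1 w + Ric G x u2 w.
  by move=> *; apply: RicP.
rewrite (linear_sumE (RP v)) (linear_sumE (f := fun u => bilin (Ric_mx x) u v)); last first.
  by move=> a u1 u2; rewrite bilinDl bilinZl.
apply: eq_bigr => i _; congr (_ * _); rewrite Ric_sym // (linear_sumE (RP _)).
rewrite (linear_sumE (f := fun v => bilin (Ric_mx x) (delta_mx 0 i) v)); last first.
  by move=> a u1 u2; rewrite bilinDr bilinZr.
by apply: eq_bigr => j _; rewrite bilin_delta mxE Ric_sym.
Qed.

(** The matrix of the connection one-form evaluated at u. *)
Definition chr_mx y u : 'M[R]_m := \matrix_i chr G y u (delta_mx 0 i).

Lemma chr_mxE y u v : U y -> v *m chr_mx y u = chr G y u v.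
Proof. by move=> Uy; rewrite (linear_mxE (f := chr G y u)) // => *; apply: christoffelPr. Qed.

Lemma differentiable_chr_mx y u : U y -> differentiable (fun y => chr_mx y u) y.
Proof.
move=> Uy; apply: differentiable_mxP => i j.
have -> : (fun y => chr_mx y u i j) = (fun y => chr G y u (delta_mx 0 i) 0 j).
  by apply: funext => z; rewrite mxE.
exact/differentiable_entry/differentiable_christoffel.
Qed.

Section RicciIdentity.
Variables (Z : 'rV[R]_m -> 'rV[R]_m) (B : 'rV[R]_m -> 'M[R]_m) (x : 'rV[R]_m).
Hypothesis Ux : U x.
Hypothesis Z_smooth : smooth_on U Z.
Hypothesis dB : differentiable B x.
Hypothesis BE : forall y u, U y -> u *m B y = pd Z u y + chr G y u (Z y).

Definition cov_deriv w := pd B w x + B x *m chr_mx x w - chr_mx x w *m B x.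

(** With B the covariant derivative of Z, this antisymmetrises the second
    covariant derivative of Z; the terms in the derivative of Z cancel because
    the connection is symmetric. *)
Lemma ricci_identity u w :
  cvt G x w u (Z x) = u *m cov_deriv w - w *m cov_deriv u.
Proof.
have dZ y : U y -> differentiable Z y by apply: smooth_differentiable.
have ddZ a y : U y -> differentiable (pd Z a) y by apply: smooth_pd.
have key a b : b *m pd B a x = pd (pd Z b) a x + (chr G x b (pd Z a x)
     + pd (fun y => chr G y b (Z x)) a x).
  have linb k (M N : 'M[R]_m) : b *m (k *: M + N) = k *: (b *m M) + b *m N.
    by rewrite mulmxDr -scalemxAr.
  have linZ k (M N : 'M[R]_m) : Z x *m (k *: M + N) = k *: (Z x *m M) + Z x *m N.
    by rewrite mulmxDr -scalemxAr.
  have dC := differentiable_chr_mx b Ux.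
  rewrite -(pd_lin _ linb) //.
  transitivity (pd (fun y => pd Z b y + Z y *m chr_mx y b) a x).
    by apply: (pd_eq _ oU Ux) => y Uy; rewrite BE // chr_mxE.
  rewrite pd_add; [|exact: ddZ|apply: differentiable_mulmx => //; exact: dZ].
  rewrite pd_mul //; last exact: dZ.
  rewrite chr_mxE //; congr (_ + (_ + _)).
  by rewrite -(pd_lin _ linZ) //; apply: (pd_eq _ oU Ux) => y Uy; rewrite chr_mxE.
have covE a b : b *m cov_deriv a = pd (pd Z b) a x + (chr G x b (pd Z a x)
     + pd (fun y => chr G y b (Z x)) a x) + (chr G x a (pd Z b x) + chr G x a (chr G x b (Z x)))
     - (pd Z (chr G x a b) x + chr G x (chr G x a b) (Z x)).
  rewrite /cov_deriv mulmxBr mulmxDr key !mulmxA chr_mxE // chr_mxE // !BE //.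
  by rewrite -[in chr G x a (_ + _)](scale1r (pd Z b x)) christoffelPr // scale1r.
rewrite !covE curvE // (pd_schwarz u w oU Z_smooth Ux) (christoffelC u w) //.
abstract_atoms; apply/rowP => i; rewrite !mxE; ring.
Qed.

End RicciIdentity.

End Curvature.

(** * Lie derivatives and the Nijenhuis tensor *)

(** For identities that hold in the additive group of matrices once all
    products are expanded. *)
Ltac mx_abelian :=
  repeat match goal with
    | |- context [@mulmx ?R ?a ?b ?c ?A ?B] =>
        move: (@mulmx R a b c A B) => ?
    | |- context [pd ?f ?x ?v] => move: (pd f x v) => ?
    end;
  apply/matrixP => ? ?; rewrite !mxE; ring.

Section GaugeDerivative.
Variables (R : realType) (m : nat) (x u : 'rV[R]_m).

(** A single Leibniz calculus serves two derivations of the field F. With the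
    Jacobian of a vector field Z for A and B (0 where there is no index, minus
    its transpose for a covariant index on the right) it is the Lie derivative
    along Z; with minus the connection matrix in place of the Jacobian, it is
    the covariant derivative. *)
Definition gd a b (A : 'M[R]_a) (B : 'M[R]_b) (F : 'rV[R]_m -> 'M[R]_(a, b)) :=
  pd F u x + A *m F x - F x *m B.

Lemma gd_mul a b c (A : 'M[R]_a) (B : 'M[R]_b) (C : 'M[R]_c)
    (F : 'rV[R]_m -> 'M[R]_(a, b)) (H : 'rV[R]_m -> 'M[R]_(b, c)) :
    differentiable F x -> differentiable H x ->
  gd A C (fun y => F y *m H y) = gd A B F *m H x + F x *m gd B C H.
Proof.
move=> dF dH; rewrite /gd pd_mul // mulmxBl mulmxDl mulmxBr mulmxDr !mulmxA.
mx_abelian.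
Qed.

Lemma gd_add a b (A : 'M[R]_a) (B : 'M[R]_b) (F H : 'rV[R]_m -> 'M[R]_(a, b)) :
    differentiable F x -> differentiable H x ->
  gd A B (fun y => F y + H y) = gd A B F + gd A B H.
Proof.
move=> dF dH; rewrite /gd pd_add // mulmxDl mulmxDr.
mx_abelian.
Qed.

Lemma gd_opp a b (A : 'M[R]_a) (B : 'M[R]_b) (F : 'rV[R]_m -> 'M[R]_(a, b)) :
  differentiable F x -> gd A B (fun y => - F y) = - gd A B F.
Proof. by move=> dF; rewrite /gd pd_opp // mulmxN mulNmx !opprD. Qed.

Lemma gd_tr a b (A : 'M[R]_a) (B : 'M[R]_b) (F : 'rV[R]_m -> 'M[R]_(a, b)) :
  differentiable F x -> gd (- B^T) (- A^T) (fun y => (F y)^T) = (gd A B F)^T.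
Proof.
move=> dF; rewrite /gd pd_tr // mulNmx mulmxN opprK linearB linearD /= !trmx_mul.
by rewrite addrAC.
Qed.

Lemma gd_eq U a b (A : 'M[R]_a) (B : 'M[R]_b) (F H : 'rV[R]_m -> 'M[R]_(a, b)) :
  open U -> U x -> (forall y, U y -> F y = H y) -> gd A B F = gd A B H.
Proof. by move=> oU Ux FH; rewrite /gd (pd_eq _ oU Ux FH) FH. Qed.

Lemma gd_cst a (c : R) (A : 'M[R]_a) : gd A A (fun=> c%:M) = 0.
Proof. by rewrite /gd pd_cst add0r mul_mx_scalar mul_scalar_mx subrr. Qed.

Lemma gd_cst0 a b (A : 'M[R]_a) (B : 'M[R]_b) : gd A B (fun=> 0) = 0.
Proof. by rewrite /gd pd_cst add0r mul0mx mulmx0 subrr. Qed.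

End GaugeDerivative.

Section JacobianMatrix.
Variables (R : realType) (m : nat) (U : set 'rV[R]_m).
Hypothesis oU : open U.

Definition dmat n (Z : 'rV[R]_m -> 'rV[R]_n) y : 'M[R]_(m, n) :=
  \matrix_i pd Z (delta_mx 0 i) y.

Lemma dmatE n (Z : 'rV[R]_m -> 'rV[R]_n) y u : differentiable Z y -> u *m dmat Z y = pd Z u y.
Proof.
by move=> dZ; rewrite (linear_mxE (f := fun u => pd Z u y)) // => *; apply: pd_dir.
Qed.

Lemma differentiable_dmat n (Z : 'rV[R]_m -> 'rV[R]_n) y :
  smooth_on U Z -> U y -> differentiable (dmat Z) y.
Proof.
move=> sZ Uy; apply: differentiable_mxP => i j.
have -> : (fun z => dmat Z z i j) = (fun z => pd Z (delta_mx 0 i) z 0 j).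
  by apply: funext => z; rewrite mxE.
exact/differentiable_entry/(smooth_pd _ sZ).
Qed.

Lemma pd_dmat n (Z : 'rV[R]_m -> 'rV[R]_n) y u v : smooth_on U Z -> U y ->
  u *m pd (dmat Z) v y = pd (pd Z u) v y.
Proof.
move=> sZ Uy.
have linu k (A B : 'M[R]_(m, n)) : u *m (k *: A + B) = k *: (u *m A) + u *m B.
  by rewrite mulmxDr -scalemxAr.
rewrite -(pd_lin _ linu); last exact: differentiable_dmat.
apply: (pd_eq _ oU Uy) => z Uz; rewrite dmatE //; exact: (smooth_differentiable sZ).
Qed.

End JacobianMatrix.

Section Nijenhuis.
Variables (R : realType) (m n : nat) (U : set 'rV[R]_m) (J : 'rV[R]_m -> 'M[R]_m).
Variables (psi : 'rV[R]_m -> 'rV[R]_(n + n)) (psi' : 'rV[R]_(n + n) -> 'rV[R]_m).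
Hypothesis oU : open U.
Hypothesis psiK : {in U, cancel psi psi'}.
Hypothesis psi_smooth : smooth_on U psi.
Hypothesis psi'_smooth : smooth_on (psi @` U) psi'.
Hypothesis psi_holo : forall y u, U y -> 'd psi y (u *m J y) = mul_i ('d psi y u).

(** Vanishing of the Nijenhuis tensor of J on constant fields u and v: the
    brackets of u J, v J, u and v are written as derivatives of J. *)
Definition nijenhuis_free x := forall u v : 'rV[R]_m,
  v *m pd J (u *m J x) x - u *m pd J (v *m J x) x
  + (u *m pd J v x - v *m pd J u x) *m J x = 0.

(** With D the Jacobian of psi and Ii the matrix of multiplication by i, the
    hypothesis reads J D = D Ii. Its derivative expresses that of J by second
    derivatives of psi, which are symmetric, and D can be cancelled. *)
Lemma complex_coord_nijenhuis x : U x -> differentiable J x -> nijenhuis_free x.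
Proof.
move=> Ux dJ u v.
have dpsi y : U y -> differentiable psi y by apply: smooth_differentiable.
have pdd y w : U y -> pd psi w y = 'd psi y w by move=> Uy; rewrite pdE deriveE //; apply: dpsi.
have mulilin k (a b : 'rV[R]_(n + n)) : mul_i (k *: a + b) = k *: mul_i a + mul_i b.
  by apply/rowP => j; rewrite /mul_i !mxE; case: (fintype.split j) => l; rewrite !mxE; ring.
pose Ii := \matrix_i mul_i (delta_mx 0 i : 'rV[R]_(n + n)).
have IiE w : mul_i w = w *m Ii by rewrite (linear_mxE mulilin).
pose D := dmat psi.
have dD : differentiable D x by apply: (differentiable_dmat psi_smooth).
have DE y w : U y -> w *m D y = pd psi w y by move=> Uy; apply/dmatE/dpsi.
have JD y : U y -> J y *m D y = D y *m Ii.
  move=> Uy; apply/row_matrixP => i; rewrite !rowE !mulmxA DE // pdd // psi_holo //.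
  by rewrite IiE -pdd // -DE // mulmxA.
(* The map psi' inverts psi on the left, so the differential of psi is
   injective. *)
have D_inj (w : 'rV[R]_m) : w *m D x = 0 -> w = 0.
  rewrite DE // => w0.
  have dpsi' : differentiable psi' (psi x).
    by apply: smooth_differentiable psi'_smooth _; exists x.
  have : 'D_w (psi' \o psi) x = 'D_w id x.
    by apply: (derive_eq_open _ oU Ux) => y Uy /=; rewrite psiK // inE.
  rewrite derive_id => <-; rewrite deriveE; last exact: differentiable_comp (dpsi _ Ux) dpsi'.
  rewrite diff_comp; [|exact: dpsi|exact: dpsi'].
  have dw0 : 'd psi x w = 0 by rewrite -pdd.
  by rewrite /= dw0 linear0.
have key (a w : 'rV[R]_m) : a *m pd J w x *m D x = pd (pd psi a) w x *m Ii - pd (pd psi (a *m J x)) w x.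
  have dc : differentiable (fun=> Ii) x by apply: differentiable_cst.
  have : pd (fun y => J y *m D y) w x = pd (fun y => D y *m Ii) w x.
    by apply: (pd_eq _ oU Ux) => y; apply: JD.
  rewrite !pd_mul // pd_cst mulmx0 addr0 => /(congr1 (mulmx a)).
  rewrite mulmxDr !mulmxA !(pd_dmat oU _ _ psi_smooth Ux) => <-.
  by rewrite addrK.
apply: D_inj; rewrite mulmxDl mulmxBl -[_ *m J x *m D x]mulmxA JD // !mulmxA !mulmxBl !key.
rewrite !mulmxBl (pd_schwarz u v oU psi_smooth Ux).
rewrite (pd_schwarz (u *m J x) (v *m J x) oU psi_smooth Ux).
rewrite (pd_schwarz (u *m J x) v oU psi_smooth Ux).
rewrite (pd_schwarz (v *m J x) u oU psi_smooth Ux).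
mx_abelian.
Qed.

End Nijenhuis.

Section LieEndomorphism.
Variables (R : realType) (m : nat) (U : set 'rV[R]_m).
Hypothesis oU : open U.

Definition lie_endo (Z : 'rV[R]_m -> 'rV[R]_m) (F : 'rV[R]_m -> 'M[R]_m) x :=
  gd x (Z x) (dmat Z x) (dmat Z x) F.

(** The difference of the two sides, applied to v, is the Nijenhuis tensor of J
    on Y and v. *)
Lemma lie_nijenhuis (J : 'rV[R]_m -> 'M[R]_m) (Y Y' : 'rV[R]_m -> 'rV[R]_m) x :
    U x -> differentiable J x -> differentiable Y x -> differentiable Y' x ->
    (forall y, U y -> Y y *m J y = Y' y) -> nijenhuis_free J x ->
  lie_endo Y' J x = lie_endo Y J x *m J x.
Proof.
move=> Ux dJ dY dY' YJ nij; apply/row_matrixP => i; rewrite !rowE mulmxA.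
move: (delta_mx 0 i) => v.
have dYJ w : Y x *m pd J w x = pd Y' w x - pd Y w x *m J x.
  apply/eqP; rewrite eq_sym subr_eq addrC -pd_mul //; apply/eqP.
  by apply: (pd_eq _ oU Ux) => y /YJ.
have := nij (Y x) v; rewrite YJ // !dYJ.
rewrite /lie_endo /gd !(mulmxBl, mulmxBr, mulmxDl, mulmxDr) !mulmxA !dmatE //.
move=> e; apply/eqP; rewrite -subr_eq0 -[X in _ == X]e; apply/eqP.
rewrite mulNmx; mx_abelian.
Qed.

End LieEndomorphism.

(** * Exterior derivative of a one-form *)

Lemma scale_sub00 (R : realType) (c : R) (A B : 'M[R]_1) :
  (c *: (A - B)) 0 0 = c * (A 0 0 - B 0 0).
Proof. by rewrite !mxE. Qed.

Section ExteriorDerivative.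
Variables (R : realType) (m : nat) (U : set 'rV[R]_m) (a : 'rV[R]_m -> 'rV[R]_m).
Hypothesis oU : open U.
Hypothesis a_smooth : smooth_on U a.

(** Matrix of the two-form d a, with the normalisation of [ext_d]. *)
Definition dform y : 'M[R]_m := 2^-1 *: (dmat a y - (dmat a y)^T).

Let da y : U y -> differentiable a y. Proof. exact: smooth_differentiable. Qed.

Lemma dform_skew y : (dform y)^T = - dform y.
Proof. by rewrite /dform linearZ linearB /= trmxK -scalerN opprB. Qed.

Lemma dformE y u v : U y ->
  bilin (dform y) u v = 2^-1 * ((pd a u y *m v^T) 0 0 - (pd a v y *m u^T) 0 0).
Proof.
move=> Uy; have day := da Uy; rewrite bilinE -scalemxAr -scalemxAl mulmxBr mulmxBl dmatE //.
rewrite scale_sub00; congr (_ * (_ - _)).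
have -> : (pd a v y *m u^T) 0 0 = ((pd a v y *m u^T)^T) 0 0 by rewrite [RHS]mxE.
by rewrite -dmatE // !trmx_mul trmxK !mulmxA.
Qed.

Lemma dform_d_at y u v : U y -> d_at a y u v = bilin (dform y) u v.
Proof.
move=> Uy; rewrite dformE // /d_at /ext_d.
have pairE b w : pairing b w = (b *m w^T) 0 0.
  by rewrite /pairing mxE; apply: eq_bigr => i _; rewrite !mxE.
have dpair b w : 'D_b (fun z => pairing (a z) w) y = (pd a b y *m w^T) 0 0.
  have linw k (A B : 'rV[R]_m) : (k *: A + B) *m w^T = k *: (A *m w^T) + B *m w^T.
    by rewrite mulmxDl -scalemxAl.
  have [dw Dw] := differentiable_lin_mx linw (da Uy).
  rewrite pdE -Dw -(derive_entry _ _ _ dw).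
  by congr ('D_b _ y); apply: funext => z; rewrite pairE.
have pair0 : pairing (a y) 0 = 0 by rewrite pairE trmx0 mulmx0 mxE.
by rewrite !dpair /lie_bracket !derive_cst subrr pair0 subr0.
Qed.

Lemma differentiable_dform y : U y -> differentiable dform y.
Proof.
move=> Uy; have dd := differentiable_dmat a_smooth Uy.
have lin k (A B : 'M[R]_m) : 2^-1 *: ((k *: A + B) - (k *: A + B)^T) =
    k *: (2^-1 *: (A - A^T)) + 2^-1 *: (B - B^T).
  by apply/matrixP => i j; rewrite !mxE; ring.
exact: (differentiable_lin_mx lin dd).1.
Qed.

Lemma pd_dform y u v w : U y ->
  bilin (pd dform w y) u v =
  2^-1 * ((pd (pd a u) w y *m v^T) 0 0 - (pd (pd a v) w y *m u^T) 0 0).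
Proof.
move=> Uy; have dd := differentiable_dmat a_smooth Uy.
have lin k (A B : 'M[R]_m) : 2^-1 *: ((k *: A + B) - (k *: A + B)^T) =
    k *: (2^-1 *: (A - A^T)) + 2^-1 *: (B - B^T).
  by apply/matrixP => i j; rewrite !mxE; ring.
rewrite (pd_lin _ lin dd) bilinE -scalemxAr -scalemxAl mulmxBr mulmxBl.
rewrite scale_sub00 (pd_dmat oU _ _ a_smooth) //; congr (_ * (_ - _)).
have -> : (pd (pd a v) w y *m u^T) 0 0 = ((pd (pd a v) w y *m u^T)^T) 0 0 by rewrite [RHS]mxE.
by rewrite -(pd_dmat oU _ _ a_smooth) // !trmx_mul trmxK !mulmxA.
Qed.

Lemma dform_closed y u v w : U y ->
  bilin (pd dform u y) v w + bilin (pd dform v y) w u + bilin (pd dform w y) u v = 0.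
Proof.
move=> Uy; rewrite !pd_dform // (pd_schwarz u v oU a_smooth Uy).
rewrite (pd_schwarz v w oU a_smooth Uy) (pd_schwarz w u oU a_smooth Uy); ring.
Qed.

End ExteriorDerivative.

(** * Splitting of the horizontal space *)

Lemma idempotent_trace (F : fieldType) m (E : 'M[F]_m) :
  E *m E = E -> \tr E = (\rank E)%:R.
Proof.
move=> EE; have [C' C'C] := row_fullP (col_base_full E).
have [D' DD'] := row_freeP (row_base_free E).
have := mulmx_base E; move: C'C DD'; move: (col_base E) (row_base E) => C D C'C DD' CD.
have DC : D *m C = 1%:M.
  have : C' *m (C *m D *m (C *m D)) *m D' = C' *m (C *m D) *m D' by rewrite CD EE.
  by rewrite !mulmxA C'C !mul1mx -!mulmxA DD' mulmx1.
by rewrite -[in LHS]CD mxtrace_mulC DC mxtrace1.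
Qed.

Section ReebSplitting.
Variables (R : realType) (m p q : nat).
Variables (a Z : bool -> 'rV[R]_m) (W : bool -> 'M[R]_m) (phi G : 'M[R]_m).
Hypothesis mE : m = (p.*2 + q.*2).+2.
Hypothesis G_sym : G^T = G.
Hypothesis G_unit : G \in unitmx.
Hypothesis W_skew : forall i, (W i)^T = - W i.
Hypothesis Za : forall i j, Z i *m (a j)^T = (i == j)%:R%:M.
Hypothesis ZW : forall i j, Z i *m W j = 0.
Hypothesis GZ : forall i, G *m (Z i)^T = (a i)^T.
Hypothesis phi_sqr :
  phi *m phi = (a true)^T *m Z true + (a false)^T *m Z false - 1%:M.
Hypothesis Zphi : forall i, Z i *m phi = 0.
Hypothesis phi_G : phi *m G = - (W true + W false).
Hypothesis decomp : forall u : 'rV[R]_m, u *m (a true)^T = 0 -> u *m W true = 0 ->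
  u *m phi *m W true = 0.
Hypothesis rank_t : (\rank (W true) <= p.*2)%N.
Hypothesis rank_f : (\rank (W false) <= q.*2)%N.

Let H := invmx G.
(** With the indices [true] and [false] for 1 and 2, W i will be d alpha_i and
    B i the covariant derivative of Z i. *)
Let B i := W i *m H.

Let phiE : phi = - (B true + B false).
Proof. by rewrite -[LHS](mulmxK G_unit) phi_G mulNmx mulmxDl. Qed.

Let ker_sum (u : 'rV[R]_m) : u *m (W true + W false) = 0 -> (u <= col_mx (Z true) (Z false))%MS.
Proof.
move=> uW; have u0 : u *m phi = 0.
  by apply: (can_inj (mulmxK G_unit)); rewrite -mulmxA phi_G mulmxN uW oppr0 mul0mx.
have : u *m (phi *m phi) = 0 by rewrite mulmxA u0 mul0mx.
rewrite phi_sqr mulmxBr mulmx1 => /eqP; rewrite subr_eq0 => /eqP <-.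
rewrite mulmxDr !mulmxA -mul_row_col; exact: submxMl.
Qed.

Let rank_ker_sum : (\rank (kermx (W true + W false)) <= 2)%N.
Proof.
apply: leq_trans (rank_leq_row (col_mx (Z true) (Z false))); apply: mxrankS.
apply/row_subP => i; apply: ker_sum.
by apply/sub_kermxP; apply: row_sub.
Qed.

Let rank_sum : (p.*2 + q.*2 <= \rank (W true + W false)%R)%N.
Proof.
have := rank_ker_sum; rewrite mxrank_ker; have := rank_leq_row (W true + W false).
move: (\rank _) => r; move: mE; lia.
Qed.

(** A vector killed by W 1 + W 2 is killed by phi, hence lies in the span of
    the Reeb vectors; so the rank of the sum is at least m - 2, which is the
    sum of the two upper bounds. *)
Lemma rank_dforms : \rank (W true) = p.*2 /\ \rank (W false) = q.*2.
Proof.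
have := leq_trans rank_sum (mxrank_add _ _); move: rank_t rank_f; lia.
Qed.

(** The kernels have dimensions m - 2p and m - 2q and meet in at most the
    two-dimensional span of the Reeb vectors; hence they span everything. *)
Let kernels_span (u : 'rV[R]_m) : exists k1 k2 : 'rV[R]_m,
  [/\ u = k1 + k2, k1 *m W true = 0 & k2 *m W false = 0].
Proof.
have full : row_full (kermx (W true) + kermx (W false))%MS.
  rewrite /row_full eqn_leq rank_leq_col /=.
  have cap : (\rank (kermx (W true) :&: kermx (W false))%MS <= 2)%N.
    apply: leq_trans rank_ker_sum; apply: mxrankS; apply/sub_kermxP.
    rewrite mulmxDr (sub_kermxP (capmxSl _ _)) (sub_kermxP (capmxSr _ _)).
    by rewrite addr0.
  have := mxrank_sum_cap (kermx (W true)) (kermx (W false)).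
  have [rt rf] := rank_dforms.
  rewrite !mxrank_ker rt rf; move: cap.
  move: (\rank (_ :&: _)%MS) (\rank (_ + _)%MS) => c s; move: mE; lia.
have /sub_addsmxP[[D1 D2] /= ->] := submx_full u full.
exists (D1 *m kermx (W true)), (D2 *m kermx (W false)).
by split=> //; rewrite -mulmxA mulmx_ker mulmx0.
Qed.

(** By [kernels_span] only vectors k of the kernel of W 1 matter, and after
    removing the component along Z 1 they satisfy a 1 = 0. On them W 2 H is -
    phi, and phi k is again killed by W 1 because phi is decomposable. *)
Lemma dform_orth : W false *m H *m W true = 0.
Proof.
apply/row_matrixP => i; rewrite row0 rowE; move: (delta_mx 0 i) => u.
have [k1 [k2 [-> k1W k2W]]] := kernels_span u.
rewrite mulmxDl !mulmxA k2W !mul0mx addr0.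
pose k := k1 - (k1 *m (a true)^T) *m Z true.
have kW : k *m W true = 0 by rewrite /k mulmxBl k1W -(mulmxA _ (Z true)) ZW mulmx0 subr0.
have ka : k *m (a true)^T = 0 by rewrite /k mulmxBl -(mulmxA _ (Z true)) Za eqxx mulmx1 subrr.
have := decomp ka kW; rewrite /k mulmxBl -(mulmxA _ (Z true)) Zphi mulmx0 subr0.
rewrite phiE mulmxN mulmxDr mulNmx mulmxDl /B !mulmxA k1W !mul0mx add0r => /eqP.
by rewrite oppr_eq0 => /eqP.
Qed.

Let H_sym : H^T = H.
Proof. by rewrite /H trmx_inv G_sym. Qed.

Lemma reeb_endo_orth i j : i != j -> B i *m B j = 0.
Proof.
have ft : B false *m B true = 0 by rewrite /B !mulmxA dform_orth mul0mx.
have tf : B true *m B false = 0.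
  rewrite /B !mulmxA; suff -> : W true *m H *m W false = 0 by rewrite mul0mx.
  apply: trmx_inj; rewrite !trmx_mul H_sym !W_skew mulNmx !mulmxN opprK mulmxA.
  by rewrite dform_orth trmx0.
by case: i; case: j.
Qed.

Let B_a i j : B i *m (a j)^T = 0.
Proof.
rewrite /B -GZ -mulmxA (mulmxA H) mulVmx // mul1mx; apply: trmx_inj.
by rewrite trmx_mul trmxK W_skew mulmxN ZW oppr0 trmx0.
Qed.

Lemma reeb_endo_sqr : B true *m B true + B false *m B false = phi *m phi.
Proof.
by rewrite phiE mulNmx mulmxN opprK mulmxDl !mulmxDr
  (@reeb_endo_orth true false) // (@reeb_endo_orth false true) // addr0 add0r.
Qed.

(** The endomorphism - (B i)^2 is a projector with the rank of W i. *)
Lemma reeb_endo_trace i : \tr (B i *m B i) = - (2 * (if i then p else q)%:R).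
Proof.
have cube : B i *m (B i *m B i) = - B i.
  have : B i *m (phi *m phi) = - B i.
    by rewrite phi_sqr mulmxBr mulmx1 mulmxDr !mulmxA !B_a !mul0mx addr0 sub0r.
  rewrite -reeb_endo_sqr mulmxDr; case: i.
    by rewrite [X in _ + X]mulmxA (@reeb_endo_orth true false) // mul0mx addr0.
  by rewrite [X in X + _]mulmxA (@reeb_endo_orth false true) // mul0mx add0r.
pose E := - (B i *m B i).
have EE : E *m E = E by rewrite /E mulNmx mulmxN opprK -mulmxA cube mulmxN.
have rB : \rank (B i) = \rank (W i) by rewrite mxrankMfree // row_free_unit unitmx_inv.
have rE : \rank E = \rank (B i).
  apply/eqP; rewrite eqn_leq; apply/andP; split.
    by rewrite mxrank_opp mxrankM_maxr.
  have -> : \rank (B i) = \rank (B i *m E).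
    by rewrite /E mulmxN cube opprK.
  exact: mxrankM_maxr.
have := idempotent_trace EE; rewrite /E linearN /= => /eqP; rewrite eqr_oppLR => /eqP->.
rewrite -/E rE rB -natrM mul2n; congr (- _%:R).
by have [rt rf] := rank_dforms; case: (i).
Qed.

End ReebSplitting.

Section SignedSum.
Variables (R : comNzRingType) (m : nat) (e : R).
Hypothesis ee : e * e = 1.
Implicit Types A B : 'M[R]_m.

(** The divergences of B_1 and B_2 are separated by treating B_1 + e B_2 for e
    = 1 and e = -1 alike: the terms with a factor e cancel in pairs. *)
Lemma signed_sum_anticomm A1 A2 B1 B2 :
    A1 *m B2 + B1 *m A2 = 0 -> A2 *m B1 + B2 *m A1 = 0 ->
  (A1 + e *: A2) *m (B1 + e *: B2) + (B1 + e *: B2) *m (A1 + e *: A2) =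
  A1 *m B1 + B1 *m A1 + (A2 *m B2 + B2 *m A2).
Proof.
move=> /eqP; rewrite addr_eq0 => /eqP e1 /eqP; rewrite addr_eq0 => /eqP e2.
rewrite !(mulmxDl, mulmxDr) -!(scalemxAl, scalemxAr) !scalerA ee !scale1r e1 e2 !scalerN.
move: (A1 *m B1) (B1 *m A1) (A2 *m B2) (B2 *m A2) (e *: (B1 *m A2)) (e *: (B2 *m A1)).
move=> *; apply/matrixP => i j; rewrite !mxE; ring.
Qed.

Lemma signed_sum_sqr B1 B2 : B1 *m B2 = 0 -> B2 *m B1 = 0 ->
  (B1 + e *: B2) *m (B1 + e *: B2) = B1 *m B1 + B2 *m B2.
Proof.
move=> e1 e2; rewrite !(mulmxDl, mulmxDr) -!(scalemxAl, scalemxAr) !scalerA ee scale1r.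
by rewrite e1 e2 !scaler0 addr0 add0r.
Qed.

End SignedSum.

Lemma signed_sums_eq0 (R : realType) m (A B : 'rV[R]_m) (D : 'cV[R]_m) :
  (A + 1 *: B) *m D = 0 -> (A + (-1) *: B) *m D = 0 ->
  (A *m D) 0 0 = 0 /\ (B *m D) 0 0 = 0.
Proof.
rewrite !mulmxDl -!scalemxAl; move: (A *m D) (B *m D) => s t.
by move=> /matrixP/(_ 0 0) + /matrixP/(_ 0 0); rewrite !mxE => e1 e2; split; lra.
Qed.

Section Contraction.
Variables (R : realType) (m : nat) (G B : 'M[R]_m) (T dP : 'rV[R]_m -> 'M[R]_m).
Hypothesis G_sym : G^T = G.
Hypothesis G_unit : G \in unitmx.
Hypothesis W_skew : (B *m G)^T = - (B *m G).
Hypothesis S_skew : forall w, (T w *m G)^T = - (T w *m G).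
Hypothesis S_cyclic : forall u v w,
  bilin (T u *m G) v w + bilin (T v *m G) w u + bilin (T w *m G) u v = 0.
Hypothesis dPE : forall w, T w *m B + B *m T w = dP w.
Hypothesis dP_trace : forall w, \tr (dP w) = 0.
Let H := invmx G.
Hypothesis dP_div : \sum_i row i H *m dP (delta_mx 0 i) = 0.

(** Contracting dPE over a frame, it remains to see that the contraction of B T
    vanishes. Let K be the skew bivector H B. Contracting the cyclic identity
    of T G with K, the first two terms give twice this contraction and the
    third the trace of B T_Y, which is half the trace of dP and therefore zero. *)
Lemma contraction : (\sum_i row i H *m T (delta_mx 0 i)) *m B = 0.
Proof.
have H_sym : H^T = H by rewrite /H trmx_inv G_sym.
pose K := H *m B.
have K_skew : K^T = - K.
  have -> : K = H *m (B *m G) *m H by rewrite /K -!mulmxA mulmxV // mulmx1.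
  by rewrite !trmx_mul H_sym -trmx_mul W_skew mulNmx mulmxN mulmxA.
have tr0 w : \tr (B *m T w) = 0.
  have := dP_trace w; rewrite -dPE mxtraceD mxtrace_mulC -mulr2n => /eqP.
  by rewrite mulrn_eq0 => /eqP.
have key (Y : 'rV[R]_m) : (\sum_i row i K *m (T (delta_mx 0 i) *m G)) *m Y^T = 0.
  pose c i j := bilin (T (delta_mx 0 i) *m G) (delta_mx 0 j) Y.
  have A1E : ((\sum_i row i K *m (T (delta_mx 0 i) *m G)) *m Y^T) 0 0 = \sum_i \sum_j K i j * c i j.
    rewrite mulmx_suml summxE; apply: eq_bigr => i _.
    rewrite -mulmxA mxE; apply: eq_bigr => j _; rewrite mxE; congr (_ * _).
    by rewrite /c bilinE -[in RHS]mulmxA -[in RHS]rowE [RHS]mxE.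
  have A2E : \sum_i \sum_j K i j * bilin (T (delta_mx 0 j) *m G) Y (delta_mx 0 i) =
             \sum_i \sum_j K i j * c i j.
    rewrite exchange_big /=; apply: eq_bigr => i _; apply: eq_bigr => j _.
    have -> : K j i = - K i j by have /matrixP/(_ i j) := K_skew; rewrite [LHS]mxE [RHS]mxE.
    by rewrite bilin_skew // mulrNN.
  have A3E : \sum_i \sum_j K i j * bilin (T Y *m G) (delta_mx 0 i) (delta_mx 0 j) = 0.
    transitivity (\tr (K *m (T Y *m G)^T)).
      apply: eq_bigr => i _; rewrite mxE; apply: eq_bigr => j _.
      by rewrite bilin_delta [_^T j i]mxE.
    rewrite S_skew mulmxN linearN /= /K -mulmxA mxtrace_mulC -!mulmxA mulmxV //.
    by rewrite mulmx1 tr0 oppr0.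
  have tot : \sum_i \sum_j K i j * c i j
      + \sum_i \sum_j K i j * bilin (T (delta_mx 0 j) *m G) Y (delta_mx 0 i)
      + \sum_i \sum_j K i j * bilin (T Y *m G) (delta_mx 0 i) (delta_mx 0 j) = 0.
    rewrite -!big_split /=; apply: big1 => i _; rewrite -!big_split /=; apply: big1 => j _.
    by rewrite -!mulrDr S_cyclic mulr0.
  apply/matrixP => i0 j0; rewrite !ord1 [RHS]mxE A1E.
  move: tot; rewrite A2E A3E addr0 -mulr2n => /eqP.
  by rewrite mulrn_eq0 => /eqP.
have key0 : \sum_i row i H *m (B *m T (delta_mx 0 i)) = 0.
  apply: (can_inj (mulmxK G_unit)); rewrite mul0mx.
  transitivity (\sum_i row i K *m (T (delta_mx 0 i) *m G)).
    by rewrite mulmx_suml; apply: eq_bigr => i _; rewrite /K row_mul !mulmxA.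
  by apply: rowbilinP => Y; rewrite key mul0mx.
rewrite -[RHS]dP_div; transitivity (\sum_i (row i H *m T (delta_mx 0 i) *m B
    + row i H *m (B *m T (delta_mx 0 i)))).
  by rewrite big_split /= key0 addr0 mulmx_suml.
by apply: eq_bigr => i _; rewrite -mulmxA -mulmxDr dPE.
Qed.

End Contraction.

(** * The Reeb fields of a normal pair are Killing fields *)

Lemma col_eqP (R : realType) m (A B : 'cV[R]_m) :
  (forall u : 'rV[R]_m, u *m A = u *m B) -> A = B.
Proof. by move=> e; apply/row_matrixP => i; rewrite !rowE. Qed.

Lemma mx1_eqP (R : realType) (A B : 'M[R]_1) : A 0 0 = B 0 0 -> A = B.
Proof. by move=> e; apply/matrixP => i j; rewrite !ord1. Qed.

Lemma mx1_tr (R : realType) (A : 'M[R]_1) : A^T = A.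
Proof. by apply: mx1_eqP; rewrite mxE. Qed.

(** The indices [true] and [false] stand for 1 and 2. *)
Section NormalContactPair.
Variables (R : realType) (m : nat) (U : set 'rV[R]_m).
Variables (a Z : bool -> 'rV[R]_m -> 'rV[R]_m) (phi G : 'rV[R]_m -> 'M[R]_m).
Hypothesis oU : open U.
Hypothesis a_smooth : forall i, smooth_on U (a i).
Hypothesis Z_smooth : forall i, smooth_on U (Z i).
Hypothesis phi_smooth : smooth_on U phi.
Hypothesis G_smooth : smooth_on U G.
Hypothesis G_sym : forall y, U y -> (G y)^T = G y.
Hypothesis G_pos : forall y, U y -> forall u : 'rV[R]_m, u != 0 -> 0 < bilin (G y) u u.
Hypothesis Za : forall y i j, U y -> Z i y *m (a j y)^T = (i == j)%:R%:M.
Hypothesis Zda : forall y i j, U y -> Z i y *m dform (a j) y = 0.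

(** The projector onto the span of the Reeb vectors along the horizontal space. *)
Definition reeb_proj y : 'M[R]_m :=
  (a true y)^T *m Z true y + (a false y)^T *m Z false y.

Hypothesis phi_sqr : forall y, U y -> phi y *m phi y = reeb_proj y - 1%:M.
Hypothesis Zphi : forall y i, U y -> Z i y *m phi y = 0.
Hypothesis Gphi : forall y, U y ->
  G y *m (phi y)^T = dform (a true) y + dform (a false) y.
Hypothesis GZ : forall y i, U y -> G y *m (Z i y)^T = (a i y)^T.

Let da i y : U y -> differentiable (a i) y.
Proof. exact: smooth_differentiable. Qed.
Let dat i y : U y -> differentiable (fun y => (a i y)^T) y.
Proof. by move=> Uy; apply/differentiable_tr/da. Qed.
Let dZ i y : U y -> differentiable (Z i) y.
Proof. exact: smooth_differentiable. Qed.
Let dphi y : U y -> differentiable phi y.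
Proof. exact: smooth_differentiable. Qed.
Let dG y : U y -> differentiable G y.
Proof. exact: smooth_differentiable. Qed.
Let dda i y : U y -> differentiable (dform (a i)) y.
Proof. exact: differentiable_dform. Qed.

Lemma reeb_proj_a y i : U y -> reeb_proj y *m (a i y)^T = (a i y)^T.
Proof.
move=> Uy; rewrite /reeb_proj mulmxDl -!mulmxA !Za //.
by case: i; rewrite /= ?mulmx1 raddf0 mulmx0 ?addr0 ?add0r.
Qed.

Lemma phi_a y i : U y -> phi y *m (a i y)^T = 0.
Proof.
move=> Uy.
have e : phi y *m phi y *m phi y = - phi y.
  by rewrite phi_sqr // mulmxBl mul1mx /reeb_proj mulmxDl -!mulmxA !Zphi // !mulmx0 addr0 sub0r.
have : phi y *m reeb_proj y = 0.
  have : phi y *m (phi y *m phi y) = - phi y by rewrite mulmxA.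
  rewrite phi_sqr // mulmxBr mulmx1 => /eqP.
  by rewrite subr_eq addNr => /eqP.
by move=> /(congr1 (mulmx^~ (a i y)^T)); rewrite -mulmxA reeb_proj_a // mul0mx.
Qed.

Lemma phi_G y : U y -> phi y *m G y = - (dform (a true) y + dform (a false) y).
Proof.
move=> Uy; apply: trmx_inj; rewrite trmx_mul G_sym // Gphi //.
by rewrite linearN linearD /= !dform_skew opprD !opprK.
Qed.

Lemma phi_inj y (k : nat) (b : 'M[R]_(k, m)) : U y ->
  (forall i, b *m (a i y)^T = 0) -> b *m phi y = 0 -> b = 0.
Proof.
move=> Uy ba /(congr1 (mulmx^~ (phi y))); rewrite mul0mx -mulmxA phi_sqr //.
rewrite mulmxBr mulmx1 /reeb_proj mulmxDr !mulmxA !ba !mul0mx addr0 sub0r => /eqP.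
by rewrite oppr_eq0 => /eqP.
Qed.

Section AtPoint.
Variable x : 'rV[R]_m.
Hypothesis Ux : U x.

Let pd_Za i j u : pd (Z i) u x *m (a j x)^T + Z i x *m (pd (a j) u x)^T = 0.
Proof.
rewrite -pd_tr; last exact: da.
rewrite -pd_mul; [|exact: dZ|exact: dat].
rewrite (pd_eq u oU Ux (H := fun=> (i == j)%:R%:M)) ?pd_cst // => y Uy.
exact: Za.
Qed.

Let pd_Zda i j u : pd (Z i) u x *m dform (a j) x + Z i x *m pd (dform (a j)) u x = 0.
Proof.
rewrite -pd_mul; [|exact: dZ|exact: dda].
rewrite (pd_eq u oU Ux (H := fun=> 0)) ?pd_cst // => y Uy.
exact: Zda.
Qed.

Let da_Z i j u : pd (a j) (Z i x) x *m u^T = pd (a j) u x *m (Z i x)^T.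
Proof.
apply: mx1_eqP.
have : bilin (dform (a j) x) (Z i x) u = 0 by rewrite bilinE Zda // mul0mx mxE.
rewrite (dformE (a_smooth j)) // => /eqP.
by rewrite mulf_eq0 invr_eq0 pnatr_eq0 /= subr_eq0 => /eqP.
Qed.

(** Cartan's formula: both the contraction of d a_j with Z_i and the function
    a_j(Z_i), which is constant, contribute zero. *)
Lemma lie_form i j : gd x (Z i x) (dmat (Z i) x) (0 : 'M[R]_1) (fun y => (a j y)^T) = 0.
Proof.
apply: col_eqP => u; rewrite /gd mulmx0 subr0 mulmx0 mulmxDr mulmxA dmatE; last exact: dZ.
rewrite pd_tr; last exact: da.
rewrite -[X in X + _]mx1_tr trmx_mul trmxK da_Z -[X in X + _]mx1_tr trmx_mul trmxK.
by rewrite addrC pd_Za.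
Qed.

Lemma pd_dform_skew i u : (pd (dform (a i)) u x)^T = - pd (dform (a i)) u x.
Proof.
rewrite -pd_tr; last exact: dda.
rewrite -pd_opp; last exact: dda.
by apply: (pd_eq u oU Ux) => y Uy; apply: dform_skew.
Qed.

Let dform_Z i j : dform (a j) x *m (Z i x)^T = 0.
Proof.
by apply: trmx_inj; rewrite trmx_mul trmxK dform_skew mulmxN Zda // trmx0 oppr0.
Qed.

Let pd_dform_ZZ i j k u : bilin (pd (dform (a k)) u x) (Z i x) (Z j x) = 0.
Proof.
have /eqP := pd_Zda i k u; rewrite addr_eq0 => /eqP e.
have -> : bilin (pd (dform (a k)) u x) (Z i x) (Z j x) =
          - ((pd (Z i) u x *m dform (a k) x) *m (Z j x)^T) 0 0.
  by rewrite e mulNmx mxE opprK bilinE.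
by rewrite -mulmxA dform_Z mulmx0 mxE oppr0.
Qed.

(** The bracket of Z_i and Z_j is annihilated by every a_k and, as d a_k is
    closed, by every d a_k. Hence it is killed by phi, which is injective on
    the common kernel of the a_k. *)
Lemma lie_reeb i j : gd x (Z i x) (0 : 'M[R]_1) (dmat (Z i) x) (Z j) = 0.
Proof.
rewrite /gd mul0mx addr0 dmatE; last exact: dZ.
set b := _ - _.
have ba k : b *m (a k x)^T = 0.
  have /eqP := pd_Za j k (Z i x); rewrite addr_eq0 => /eqP e1.
  have /eqP := pd_Za i k (Z j x); rewrite addr_eq0 => /eqP e2.
  rewrite /b mulmxBl e1 e2 opprK addrC; apply/eqP; rewrite subr_eq0; apply/eqP.
  by rewrite -[RHS]mx1_tr trmx_mul trmxK da_Z -[RHS]mx1_tr trmx_mul trmxK.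
have bd k : b *m dform (a k) x = 0.
  have /eqP := pd_Zda j k (Z i x); rewrite addr_eq0 => /eqP e1.
  have /eqP := pd_Zda i k (Z j x); rewrite addr_eq0 => /eqP e2.
  rewrite /b mulmxBl e1 e2; apply: rowbilinP => v.
  rewrite mul0mx [RHS]mxE mulmxBl !mulNmx opprK.
  have -> (A B : 'M[R]_1) : (- A + B) 0 0 = B 0 0 - A 0 0 by rewrite !mxE addrC.
  rewrite -!bilinE; have := dform_closed oU (a_smooth k) (Z i x) (Z j x) v Ux.
  rewrite pd_dform_ZZ addr0 (bilin_skew v (Z i x)) ?pd_dform_skew // => /eqP.
  by rewrite subr_eq0 => /eqP->; rewrite subrr.
apply: (phi_inj Ux ba).
apply: (can_inj (mulmxK (G_unit (G_pos Ux)))).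
by rewrite -mulmxA phi_G // mulmxN mulmxDr !bd addr0 oppr0 mul0mx.
Qed.

(** Cartan's formula again: d a_k is closed and its contraction with Z_i
    vanishes. *)
Lemma lie_dform i k :
  gd x (Z i x) (dmat (Z i) x) (- (dmat (Z i) x)^T) (dform (a k)) = 0.
Proof.
apply: bilinP => u v; rewrite /gd mulmxN opprK.
rewrite -[X in bilin X]addrA -(scale1r (pd _ _ _)) bilin_mxP mul1r.
rewrite -(scale1r (_ *m dform _ _)) bilin_mxP mul1r.
rewrite -bilin_mull -bilin_mulr !dmatE; try exact: dZ.
have -> : bilin 0 u v = 0 by rewrite bilinE mulmx0 mul0mx mxE.
have e1 w z : bilin (dform (a k) x) (pd (Z i) w x) z = - bilin (pd (dform (a k)) w x) (Z i x) z.
  have /eqP := pd_Zda i k w; rewrite addr_eq0 => /eqP e.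
  by rewrite bilinE e mulNmx mxE.
rewrite e1 (bilin_skew u (pd (Z i) v x)) ?dform_skew // e1.
have := dform_closed oU (a_smooth k) (Z i x) u v Ux.
rewrite (bilin_skew v (Z i x)) ?pd_dform_skew //; abstract_atoms; lra.
Qed.

(** The part of J, and up to sign of T, that rotates the plane of the Reeb
    vectors: Z_1 goes to Z_2 and Z_2 to - Z_1. *)
Definition reeb_rot y : 'M[R]_m :=
  (a true y)^T *m Z false y - (a false y)^T *m Z true y.

Let daZ i j y : U y -> differentiable (fun y => (a i y)^T *m Z j y) y.
Proof. by move=> Uy; apply: differentiable_mulmx; [apply: dat|apply: dZ]. Qed.

Let drot y : U y -> differentiable reeb_rot y.
Proof.
move=> Uy; apply: differentiable_addf; first exact: daZ.
by apply: differentiable_oppf; apply: daZ.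
Qed.

Lemma lie_reeb_rot i : lie_endo (Z i) reeb_rot x = 0.
Proof.
rewrite /lie_endo /reeb_rot gd_add; [|exact: daZ|apply: differentiable_oppf; exact: daZ].
rewrite gd_opp; last exact: daZ.
have z j k : gd x (Z i x) (dmat (Z i) x) (dmat (Z i) x) (fun y => (a j y)^T *m Z k y) = 0.
  rewrite (gd_mul _ _ (0 : 'M[R]_1)); [|exact: dat|exact: dZ].
  by rewrite lie_form lie_reeb mul0mx mulmx0 addr0.
by rewrite !z subr0.
Qed.

Hypothesis nij_plus : nijenhuis_free (fun y => phi y + reeb_rot y) x.
Hypothesis nij_minus : nijenhuis_free (fun y => phi y - reeb_rot y) x.

Lemma phi_rot y : U y -> phi y *m reeb_rot y = 0.
Proof. by move=> Uy; rewrite /reeb_rot mulmxBr !mulmxA !phi_a // !mul0mx subr0. Qed.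

Lemma rot_phi y : U y -> reeb_rot y *m phi y = 0.
Proof. by move=> Uy; rewrite /reeb_rot mulmxBl -!mulmxA !Zphi // !mulmx0 subr0. Qed.

Lemma rot_sqr y : U y -> reeb_rot y *m reeb_rot y = - reeb_proj y.
Proof.
move=> Uy; rewrite /reeb_rot /reeb_proj mulmxBl !mulmxBr.
have aZ i j k l : (a i y)^T *m Z j y *m ((a k y)^T *m Z l y) =
    (j == k)%:R *: ((a i y)^T *m Z l y).
  by rewrite mulmxA -(mulmxA _ (Z j y)) Za // mul_mx_scalar scalemxAl.
by rewrite !aZ /= !scale0r !scale1r sub0r subr0 opprD.
Qed.

(** Write L_i for the Lie derivative of phi along Z_i; it is also that of J and
    of T, since [reeb_rot] is invariant. The Nijenhuis tensor of J with J Z_1 =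
    Z_2 gives L_2 = L_1 J, that of T with T Z_2 = Z_1 gives L_1 = L_2 T. In
    terms of matrices acting on rows, L_1 = L_1 J T, and J T = - 1 + 2
    [reeb_proj], whose last term is annihilated by L_1: therefore L_1 = - L_1. *)
Lemma lie_phi i : lie_endo (Z i) phi x = 0.
Proof.
have lieJ j : lie_endo (Z j) (fun y => phi y + reeb_rot y) x = lie_endo (Z j) phi x.
  rewrite /lie_endo gd_add; [|exact: dphi|exact: drot].
  by rewrite -/(lie_endo _ reeb_rot x) lie_reeb_rot addr0.
have lieT j : lie_endo (Z j) (fun y => phi y - reeb_rot y) x = lie_endo (Z j) phi x.
  rewrite /lie_endo gd_add; [|exact: dphi|apply: differentiable_oppf; exact: drot].
  rewrite gd_opp; last exact: drot.
  by rewrite -/(lie_endo _ reeb_rot x) lie_reeb_rot subr0.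
have ZJ y : U y -> Z true y *m (phi y + reeb_rot y) = Z false y.
  move=> Uy; rewrite mulmxDr Zphi // add0r /reeb_rot mulmxBr !mulmxA !Za //=.
  by rewrite mul1mx raddf0 mul0mx subr0.
have ZT y : U y -> Z false y *m (phi y - reeb_rot y) = Z true y.
  move=> Uy; rewrite mulmxBr Zphi // sub0r /reeb_rot mulmxBr !mulmxA !Za //=.
  by rewrite mul1mx raddf0 mul0mx sub0r opprK.
have dJ : differentiable (fun y => phi y + reeb_rot y) x.
  by apply: differentiable_addf; [apply: dphi|apply: drot].
have dT : differentiable (fun y => phi y - reeb_rot y) x.
  by apply: differentiable_addf; [apply: dphi|apply/differentiable_oppf/drot].
have := lie_nijenhuis oU Ux dJ (dZ true Ux) (dZ false Ux) ZJ nij_plus.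
have := lie_nijenhuis oU Ux dT (dZ false Ux) (dZ true Ux) ZT nij_minus.
rewrite !lieJ !lieT => eT eJ.
have La j k : lie_endo (Z j) phi x *m (a k x)^T = 0.
  have := gd_mul (Z j x) (dmat (Z j) x) (dmat (Z j) x) (0 : 'M[R]_1) (dphi Ux) (dat k Ux).
  rewrite lie_form mulmx0 addr0 => <-.
  by rewrite (gd_eq _ _ _ oU Ux (H := fun=> 0)) ?gd_cst0 // => y; apply: phi_a.
have Lt : lie_endo (Z true) phi x = 0.
  have JT : (phi x + reeb_rot x) *m (phi x - reeb_rot x) = reeb_proj x - 1%:M + reeb_proj x.
    by rewrite mulmxDl (mulmxBr (phi x) (phi x)) (mulmxBr (reeb_rot x) (phi x)) phi_rot // rot_phi // rot_sqr // phi_sqr // sub0r subr0 opprK.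
  have : lie_endo (Z true) phi x = - lie_endo (Z true) phi x.
    rewrite {1}eT eJ -mulmxA JT mulmxDr mulmxBr mulmx1.
    have -> : lie_endo (Z true) phi x *m reeb_proj x = 0.
      by rewrite /reeb_proj mulmxDr !mulmxA !La !mul0mx addr0.
    by rewrite sub0r addr0.
  move=> /eqP; rewrite -addr_eq0 -mulr2n -scaler_nat scaler_eq0 pnatr_eq0 /=.
  by move/eqP.
by case: i => //; rewrite eJ Lt mul0mx.
Qed.

(** The metric satisfies phi G = - (d a_1 + d a_2) and G Z_j = a_j, where
    everything else is invariant under Z_i; so its Lie derivative K satisfies
    phi K = 0 and K Z_j = 0. *)
Lemma reeb_killing i : gd x (Z i x) (dmat (Z i) x) (- (dmat (Z i) x)^T) G = 0.
Proof.
set N := dmat (Z i) x; set K := gd _ _ _ _ _.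
have phiK : phi x *m K = 0.
  have dGx := dG Ux; have dphix := dphi Ux.
  have := gd_mul (Z i x) N N (- N^T) dphix dGx.
  rewrite -/(lie_endo (Z i) phi x) lie_phi mul0mx add0r -/K => <-.
  rewrite (gd_eq _ _ _ oU Ux (H := fun y => - (dform (a true) y + dform (a false) y))) //; last first.
    by move=> y; apply: phi_G.
  have dd := differentiable_addf (dda true Ux) (dda false Ux).
  by rewrite gd_opp // gd_add ?lie_dform ?addr0 ?oppr0 //; apply: dda.
have K_sym : K^T = K.
  rewrite /K -gd_tr ?trmxK ?opprK; last exact: dG.
  by rewrite raddfN /= trmxK opprK; apply: (gd_eq _ _ _ oU Ux) => y; apply: G_sym.
have KZ j : K *m (Z j x)^T = 0.
  have dZt : differentiable (fun y => (Z j y)^T) x by apply/differentiable_tr/dZ.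
  have := gd_mul (Z i x) N (- N^T) (0 : 'M[R]_1) (dG Ux) dZt.
  rewrite (gd_eq _ _ _ oU Ux (H := fun y => (a j y)^T)) ?lie_form //; last first.
    by move=> y; apply: GZ.
  have -> : gd x (Z i x) (- N^T) (0 : 'M[R]_1) (fun y => (Z j y)^T) = 0.
    have := gd_tr (Z i x) (0 : 'M[R]_1) N (dZ j Ux); rewrite trmx0 oppr0 => ->.
    by rewrite lie_reeb trmx0.
  by rewrite mulmx0 addr0.
have ZK j : Z j x *m K = 0 by apply: trmx_inj; rewrite trmx_mul K_sym KZ trmx0.
have : phi x *m phi x *m K = 0 by rewrite -mulmxA phiK mulmx0.
rewrite phi_sqr // mulmxBl mul1mx /reeb_proj mulmxDl -!mulmxA !ZK !mulmx0 addr0 sub0r.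
by move/eqP; rewrite oppr_eq0 => /eqP.
Qed.

(** For a Killing field the covariant derivative is skew, hence equal to its
    skew part, which is d a_i with an index raised. *)
Lemma nabla_reeb i u :
  u *m (dform (a i) x *m invmx (G x)) = pd (Z i) u x + chr G x u (Z i x).
Proof.
apply: (metric_inj G_pos Ux) => w.
have -> : bilin (G x) (u *m (dform (a i) x *m invmx (G x))) w = bilin (dform (a i) x) u w.
  by rewrite bilin_mull mulmxKV // (G_unit (G_pos Ux)).
rewrite (dformE (a_smooth i)) // bilinDl (christoffelE G_smooth G_pos) //.
have pda v z : (pd (a i) v x *m z^T) 0 0 = bilin (G x) (pd (Z i) v x) z + bilin (pd G v x) (Z i x) z.
  have -> : pd (a i) v x = pd (Z i) v x *m G x + Z i x *m pd G v x.
    rewrite -pd_mul; [|exact: dZ|exact: dG].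
    apply: (pd_eq v oU Ux) => y Uy; apply: trmx_inj.
    by rewrite trmx_mul G_sym // GZ.
  rewrite mulmxDl !bilinE.
  have E (A B : 'M[R]_1) : (A + B) 0 0 = A 0 0 + B 0 0 by rewrite mxE.
  by rewrite E.
have kil : bilin (pd G (Z i x) x) u w + bilin (G x) (pd (Z i) u x) w + bilin (G x) (pd (Z i) w x) u = 0.
  have /(congr1 (fun A => bilin A u w)) := reeb_killing i.
  rewrite /gd mulmxN opprK -[X in bilin X]addrA -(scale1r (pd _ _ _)) bilin_mxP mul1r.
  rewrite -(scale1r (_ *m G x)) bilin_mxP mul1r -bilin_mull -bilin_mulr !dmatE; try exact: dZ.
  have -> : bilin 0 u w = 0 by rewrite bilinE mulmx0 mul0mx mxE.
  by rewrite (bilin_symG (G_sym Ux) u) addrA scale1r.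
rewrite !pda (bilin_dG_sym oU G_smooth G_sym w u (Z i x) Ux).
move: kil; abstract_atoms; lra.
Qed.

End AtPoint.

(** * Ricci curvature along the Reeb fields *)

Section Ricci.
Variables (p q : nat).
Hypothesis mE : m = (p.*2 + q.*2).+2.
Hypothesis nij_plus : forall y, U y -> nijenhuis_free (fun y => phi y + reeb_rot y) y.
Hypothesis nij_minus : forall y, U y -> nijenhuis_free (fun y => phi y - reeb_rot y) y.
Hypothesis decomp : forall y, U y -> forall u : 'rV[R]_m, u *m (a true y)^T = 0 ->
  u *m dform (a true) y = 0 -> u *m phi y *m dform (a true) y = 0.
Hypothesis rank_t : forall y, U y -> (\rank (dform (a true) y) <= p.*2)%N.
Hypothesis rank_f : forall y, U y -> (\rank (dform (a false) y) <= q.*2)%N.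

Definition reeb_endo i y := dform (a i) y *m invmx (G y).

Let uG y : U y -> G y \in unitmx. Proof. by move=> Uy; apply/G_unit/G_pos. Qed.

Let dB i y : U y -> differentiable (reeb_endo i) y.
Proof.
move=> Uy; apply: differentiable_mulmx; first exact: dda.
apply: (@differentiable_eq_open _ _ _ U (fun z => (\det (G z))^-1 *: \adj (G z))) => //.
  by move=> z Uz; rewrite /invmx uG.
apply: differentiable_invmx; first exact: dG.
by apply: filterS (open_nbhs_nbhs (conj oU Uy)) => z; apply: uG.
Qed.

Let phi_G' y : U y -> phi y *m G y = - (dform (a true) y + dform (a false) y).
Proof. exact: phi_G. Qed.

Let endo_orth y i j : U y -> i != j -> reeb_endo i y *m reeb_endo j y = 0.
Proof.
move=> Uy; apply: (reeb_endo_orth mE (G_sym Uy) (uG Uy) (fun i => dform_skew (a i) y)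
  (fun i j => Za i j Uy) (fun i j => Zda i j Uy) (phi_sqr Uy) (fun i => Zphi i Uy)
  (phi_G' Uy) (decomp Uy) (rank_t Uy) (rank_f Uy)).
Qed.

Let endo_sqr y : U y -> reeb_endo true y *m reeb_endo true y
  + reeb_endo false y *m reeb_endo false y = reeb_proj y - 1%:M.
Proof.
move=> Uy; rewrite -phi_sqr //.
apply: (reeb_endo_sqr mE (G_sym Uy) (uG Uy) (fun i => dform_skew (a i) y)
  (fun i j => Za i j Uy) (fun i j => Zda i j Uy) (phi_sqr Uy) (fun i => Zphi i Uy)
  (phi_G' Uy) (decomp Uy) (rank_t Uy) (rank_f Uy)).
Qed.

Let endo_trace y i : U y ->
  \tr (reeb_endo i y *m reeb_endo i y) = - (2 * (if i then p else q)%:R).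
Proof.
move=> Uy; apply: (reeb_endo_trace mE (G_sym Uy) (uG Uy) (fun i => dform_skew (a i) y)
  (fun i j => Za i j Uy) (fun i j => Zda i j Uy) (fun i => GZ i Uy)
  (phi_sqr Uy) (fun i => Zphi i Uy)
  (phi_G' Uy) (decomp Uy) (rank_t Uy) (rank_f Uy)).
Qed.

Let nabla y i u : U y -> u *m reeb_endo i y = pd (Z i) u y + chr G y u (Z i y).
Proof. by move=> Uy; apply: nabla_reeb => //; [apply: nij_plus|apply: nij_minus]. Qed.

Let Z_endo y i j : U y -> Z i y *m reeb_endo j y = 0.
Proof. by move=> Uy; rewrite mulmxA Zda // mul0mx. Qed.

Let endo_a y i j : U y -> reeb_endo i y *m (a j y)^T = 0.
Proof.
move=> Uy; rewrite /reeb_endo -GZ // -mulmxA (mulmxA (invmx _)) mulVmx ?uG // mul1mx.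
by apply: trmx_inj; rewrite trmx_mul trmxK dform_skew mulmxN Zda // oppr0 trmx0.
Qed.

Variable x : 'rV[R]_m.
Hypothesis Ux : U x.
Let C w := chr_mx G x w.
Let B i := reeb_endo i x.
Let T i w := cov_deriv G (reeb_endo i) x w.
Let H := invmx (G x).

Let H_sym : H^T = H. Proof. by rewrite /H trmx_inv G_sym. Qed.

Let chrC w (u : 'rV[R]_m) : u *m C w = chr G x w u.
Proof. exact: (chr_mxE oU G_smooth G_sym G_pos). Qed.

(** Thus [gd] with - C w in place of a Jacobian is the covariant derivative
    along w; it is applied below to all the tensors of the structure. *)
Let TE i w : T i w = gd x w (- C w) (- C w) (reeb_endo i).
Proof. by rewrite /T /cov_deriv /gd mulNmx mulmxN opprK addrAC. Qed.

Let cov_G w : gd x w (- C w) (C w)^T G = 0.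
Proof.
apply: bilinP => u v; have -> : bilin 0 u v = 0 by rewrite bilinE mulmx0 mul0mx mxE.
have -> : gd x w (- C w) (C w)^T G = (-1) *: (G x *m (C w)^T) + ((-1) *: (C w *m G x) + pd G w x).
  by rewrite /gd mulNmx !scaleN1r addrC [X in _ + X]addrC.
rewrite !bilin_mxP -(bilin_mulr (G x) (C w)) -(bilin_mull (G x) (C w)) !chrC.
rewrite (metric_compat oU G_smooth G_sym G_pos) //; abstract_atoms; ring.
Qed.

Let SE i w : T i w *m G x = gd x w (- C w) (C w)^T (dform (a i)).
Proof.
have dBx := dB i Ux; have dGx := dG Ux.
have := gd_mul w (- C w) (- C w) (C w)^T dBx dGx.
rewrite cov_G mulmx0 addr0 -TE => <-; apply: (gd_eq _ _ _ oU Ux) => y Uy.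
by rewrite mulmxKV ?uG.
Qed.

Let S_skew i w : (T i w *m G x)^T = - (T i w *m G x).
Proof.
rewrite SE; have := gd_tr w (- C w) (C w)^T (dda i Ux).
rewrite trmxK [(- C w)^T]raddfN opprK => <-.
rewrite -gd_opp; last exact: dda.
by apply: (gd_eq _ _ _ oU Ux) => y Uy; apply: dform_skew.
Qed.

(** The cyclic sum of the covariant derivatives of d a_i is its exterior
    derivative. *)
Let S_cyclic i u v w : bilin (T i u *m G x) v w + bilin (T i v *m G x) w u
  + bilin (T i w *m G x) u v = 0.
Proof.
have bS k b c : bilin (T i k *m G x) b c = bilin (pd (dform (a i)) k x) b c
    - bilin (dform (a i) x) (chr G x k b) c - bilin (dform (a i) x) b (chr G x k c).
  have -> : T i k *m G x = (-1) *: (dform (a i) x *m (C k)^T)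
      + ((-1) *: (C k *m dform (a i) x) + pd (dform (a i)) k x).
    by rewrite SE /gd mulNmx !scaleN1r addrC [X in _ + X]addrC.
  rewrite !bilin_mxP -(bilin_mulr (dform (a i) x) (C k)) -(bilin_mull (dform (a i) x) (C k)).
  rewrite !chrC; abstract_atoms; ring.
have cC := christoffelC oU G_smooth G_sym G_pos.
have sk b c := bilin_skew b c (dform_skew (a i) x).
rewrite !bS (cC _ v u Ux) (cC _ w u Ux) (cC _ w v Ux).
rewrite (sk v (chr G x u w)) (sk w (chr G x u v)) (sk u (chr G x v w)).
have := dform_closed oU (a_smooth i) u v w Ux; abstract_atoms; lra.
Qed.

Let cov_Z i w : gd x w (0 : 'M[R]_1) (- C w) (Z i) = w *m B i.
Proof. by rewrite /gd mul0mx addr0 mulmxN opprK chrC /B nabla. Qed.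

Let cov_a i w : gd x w (- C w) (0 : 'M[R]_1) (fun y => (a i y)^T) = G x *m (w *m B i)^T.
Proof.
have dZt : differentiable (fun y => (Z i y)^T) x by apply/differentiable_tr/dZ.
have := gd_mul w (- C w) (C w)^T (0 : 'M[R]_1) (dG Ux) dZt.
rewrite cov_G mul0mx add0r.
have -> : gd x w (C w)^T (0 : 'M[R]_1) (fun y => (Z i y)^T) = (w *m B i)^T.
  have := gd_tr w (0 : 'M[R]_1) (- C w) (dZ i Ux); rewrite trmx0 oppr0 cov_Z.
  by rewrite raddfN /= opprK.
by move=> <-; apply: (gd_eq _ _ _ oU Ux) => y Uy; rewrite GZ.
Qed.

(** The covariant derivative of [reeb_proj], as [cov_proj] shows. *)
Let dP w : 'M[R]_m := \sum_i (G x *m (w *m B i)^T *m Z i x + (a i x)^T *m (w *m B i)).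

Let cov_proj w : gd x w (- C w) (- C w) reeb_proj = dP w.
Proof.
have daZ i y : U y -> differentiable (fun y => (a i y)^T *m Z i y) y.
  by move=> Uy; apply: differentiable_mulmx; [apply: dat|apply: dZ].
rewrite /reeb_proj gd_add; [|exact: daZ|exact: daZ].
rewrite (gd_mul _ _ (0 : 'M[R]_1)); [|exact: dat|exact: dZ].
rewrite (gd_mul _ _ (0 : 'M[R]_1)); [|exact: dat|exact: dZ].
by rewrite !cov_a !cov_Z /dP big_bool.
Qed.

Let cov_mul i j w : T i w *m B j + B i *m T j w =
  gd x w (- C w) (- C w) (fun y => reeb_endo i y *m reeb_endo j y).
Proof. by rewrite (gd_mul _ _ (- C w)) -?TE; [|exact: dB|exact: dB]. Qed.

Let cov_sqr w : T true w *m B true + B true *m T true w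
  + (T false w *m B false + B false *m T false w) = dP w.
Proof.
have dBx i := dB i Ux.
rewrite !cov_mul -gd_add; [|exact: differentiable_mulmx|exact: differentiable_mulmx].
have dproj : differentiable reeb_proj x.
  apply: differentiable_addf; (apply: differentiable_mulmx; [exact: dat|exact: dZ]).
have d1 : differentiable (fun=> 1%:M : 'M[R]_m) x by apply: differentiable_cst.
have := gd_add w (- C w) (- C w) dproj (differentiable_oppf d1).
rewrite gd_opp // gd_cst subr0 cov_proj => <-.
by apply: (gd_eq _ _ _ oU Ux) => y; apply: endo_sqr.
Qed.

Let cov_orth w i j : i != j -> T i w *m B j + B i *m T j w = 0.
Proof.
move=> ij; rewrite cov_mul (gd_eq _ _ _ oU Ux (H := fun=> 0)) ?gd_cst0 // => y Uy.
exact: endo_orth.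
Qed.

Let dP_trace w : \tr (dP w) = 0.
Proof.
rewrite /dP raddf_sum big1 // => i _.
rewrite [LHS]mxtraceD -mulmxA mxtrace_mulC -mulmxA [\tr (_ *m (w *m _))]mxtrace_mulC.
rewrite -(mulmxA w) endo_a // mulmx0 mxtrace0 addr0.
have -> : (w *m B i)^T *m (Z i x *m G x) = ((G x *m (Z i x)^T) *m (w *m B i))^T.
  by rewrite !trmx_mul trmxK G_sym // !mulmxA.
rewrite mxtrace_tr GZ // mxtrace_mulC -mulmxA endo_a // mulmx0 mxtrace0 //.
Qed.

Let endo_trace0 i : \tr (B i) = 0.
Proof.
have : \tr (B i) = - \tr (B i).
  rewrite -[LHS]mxtrace_tr {1}/B /reeb_endo trmx_mul -/H H_sym dform_skew mulmxN.
  by rewrite raddfN /= mxtrace_mulC.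
by move/eqP; rewrite -addr_eq0 -mulr2n mulrn_eq0 => /eqP.
Qed.

(** The two parts of dP contract to the trace of B_i, zero because B_i is skew,
    and to the value of B_i at Z_i. *)
Let dP_div : \sum_k row k H *m dP (delta_mx 0 k) = 0.
Proof.
under eq_bigr do rewrite /dP mulmx_sumr.
rewrite exchange_big /= big1 // => i _.
under eq_bigr do rewrite mulmxDr.
rewrite big_split /=.
have -> : \sum_k row k H *m (G x *m (delta_mx 0 k *m B i)^T *m Z i x) = \tr (B i) *: Z i x.
  rewrite /mxtrace scaler_suml; apply: eq_bigr => k _.
  rewrite rowE !mulmxA -(mulmxA _ H) mulVmx ?uG // mulmx1.
  rewrite [X in X *m _]mx11_scalar mul_scalar_mx; congr (_ *: _).
  by rewrite -(mulmxA (delta_mx 0 k) (dform (a i) x)) -rowE mxE mxE -rowE mxE.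
have -> : \sum_k row k H *m ((a i x)^T *m (delta_mx 0 k *m B i)) = Z i x *m B i.
  rewrite [in RHS](row_sum_delta (Z i x)) mulmx_suml; apply: eq_bigr => k _.
  have -> : row k H *m ((a i x)^T *m (delta_mx 0 k *m B i)) = (Z i x 0 k)%:M *m (delta_mx 0 k *m B i).
    rewrite [LHS]mulmxA; congr (_ *m _); rewrite rowE -GZ // mulmxA -(mulmxA _ H) mulVmx ?uG // mulmx1.
    by rewrite [LHS]mx11_scalar -rowE !mxE.
  by rewrite mul_scalar_mx scalemxAl.
by rewrite endo_trace0 scale0r add0r Z_endo.
Qed.

Let div i := \sum_k row k H *m T i (delta_mx 0 k).

(** [contraction] for Be = B_1 + e B_2 shows that the divergence d of Be
    satisfies d Be = 0. As Be^2 is minus the projector onto the horizontal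
    space, d is a combination of the Reeb vectors, which are orthogonal to Y. *)
Let div_horizontal e (Y : 'rV[R]_m) : e * e = 1 ->
  (forall i, Y *m (a i x)^T = 0) -> (div true + e *: div false) *m G x *m Y^T = 0.
Proof.
move=> ee Ya.
pose Be := B true + e *: B false; pose Te w := T true w + e *: T false w.
have TG w : Te w *m G x = T true w *m G x + e *: (T false w *m G x).
  by rewrite /Te mulmxDl scalemxAl.
have BG : Be *m G x = dform (a true) x + e *: dform (a false) x.
  by rewrite /Be mulmxDl -scalemxAl !mulmxKV ?uG.
have skew_comb (A A' : 'M[R]_m) : A^T = - A -> (A')^T = - A' -> (A + e *: A')^T = - (A + e *: A').
  by move=> hA hA'; rewrite linearD linearZ /= hA hA' scalerN opprD.
have W_skew : (Be *m G x)^T = - (Be *m G x).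
  by rewrite BG; apply: skew_comb; apply: dform_skew.
have S_skew' w : (Te w *m G x)^T = - (Te w *m G x).
  by rewrite TG; apply: skew_comb; apply: S_skew.
have S_cyc' u v w : bilin (Te u *m G x) v w + bilin (Te v *m G x) w u + bilin (Te w *m G x) u v = 0.
  rewrite !TG ![_ + e *: _]addrC !bilin_mxP.
  have := S_cyclic true u v w; have := S_cyclic false u v w; abstract_atoms.
  move=> h1 h2; apply/eqP; rewrite -[X in _ == X](mulr0 e) -h1; apply/eqP.
  by rewrite -[LHS]addr0 -[X in _ + X = _]oppr0 -h2; ring.
have BT w : Te w *m Be + Be *m Te w = dP w.
  rewrite -cov_sqr; apply: signed_sum_anticomm => //; exact: cov_orth.
have := contraction (G_sym Ux) (uG Ux) W_skew S_skew' S_cyc' BT dP_trace dP_div.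
have -> : \sum_k row k (invmx (G x)) *m Te (delta_mx 0 k) = div true + e *: div false.
  rewrite /div scaler_sumr -big_split /=; apply: eq_bigr => k _.
  by rewrite /Te mulmxDr -scalemxAr.
set d := _ + _ => dB0.
have BB : Be *m Be = reeb_proj x - 1%:M.
  by rewrite -endo_sqr //; apply: signed_sum_sqr => //; apply: endo_orth.
have : d *m (Be *m Be) = 0 by rewrite mulmxA dB0 mul0mx.
rewrite BB mulmxBr mulmx1 => /eqP; rewrite subr_eq0 => /eqP <-.
have ZGY i : Z i x *m G x *m Y^T = 0.
  by apply: trmx_inj; rewrite !trmx_mul trmxK G_sym // GZ // Ya trmx0.
rewrite /reeb_proj -!mulmxA (mulmxDl _ _ (G x *m _)) -!mulmxA !(mulmxA (Z _ x)) !ZGY.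
by rewrite !mulmx0 addr0 mulmx0.
Qed.

Let T_trace i w : \tr (T i w) = 0.
Proof.
have e : \tr (T i w) = \tr (H *m (T i w *m G x)).
  by rewrite mxtrace_mulC -mulmxA mulmxV ?uG // mulmx1.
have : \tr (T i w) = - \tr (T i w).
  by rewrite {1}e -mxtrace_tr trmx_mul S_skew H_sym mulNmx raddfN /= mxtrace_mulC -e.
by move/eqP; rewrite -addr_eq0 -mulr2n mulrn_eq0 => /eqP.
Qed.

(** The contraction of the Ricci identity; its second term is the trace of the
    skew endomorphism T i Y. *)
Let Ric_T i Y : Ric G x Y (Z i x) = \sum_k (Y *m T i (delta_mx 0 k)) 0 k.
Proof.
have RI := ricci_identity oU G_smooth G_sym G_pos Ux (Z_smooth i) (dB i Ux)
  (fun y u Uy => nabla i u Uy) Y.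
rewrite -[RHS]subr0 -[X in _ = _ - X](T_trace i Y) -sumrB; apply: eq_bigr => k _.
rewrite -cvtE RI -/(T i _) -/(T i _) mxE [X in _ + X]mxE -rowE; congr (_ - _).
by rewrite mxE.
Qed.

Let Ric_div i (Y : 'rV[R]_m) : Ric G x Y (Z i x) = - (div i *m G x *m Y^T) 0 0.
Proof.
rewrite Ric_T /div !mulmx_suml summxE -sumrN; apply: eq_bigr => k _.
have TSH : T i (delta_mx 0 k) = T i (delta_mx 0 k) *m G x *m H by rewrite mulmxK ?uG.
have e : Y *m T i (delta_mx 0 k) *m (delta_mx 0 k : 'rV[R]_m)^T =
    - (row k H *m T i (delta_mx 0 k) *m G x *m Y^T).
  rewrite -[LHS]mx1_tr {1}TSH trmx_mul trmxK trmx_mul trmx_mul H_sym S_skew.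
  by rewrite mulmxN mulNmx mulmxN rowE !mulmxA.
have -> : (Y *m T i (delta_mx 0 k)) 0 k =
    (Y *m T i (delta_mx 0 k) *m (delta_mx 0 k : 'rV[R]_m)^T) 0 0.
  by rewrite trmx_delta -colE [RHS]mxE.
by rewrite e mxE.
Qed.

(** The two signs in [div_horizontal] isolate the divergence of each B_i. *)
Let Ric_horizontal i (Y : 'rV[R]_m) : (forall j, Y *m (a j x)^T = 0) -> Ric G x Y (Z i x) = 0.
Proof.
move=> Ya; have hp := @div_horizontal 1 Y (mulr1 1) Ya.
have hm := @div_horizontal (-1) Y (etrans (mulrNN _ _) (mulr1 1)) Ya.
rewrite -!mulmxA in hp hm; have [dt df] := signed_sums_eq0 hp hm.
by rewrite Ric_div -mulmxA; case: (i); rewrite ?dt ?df oppr0.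
Qed.

(** The covariant derivative of Z_k B_i = 0, in which that of Z_k is B_k. *)
Let Z_cov k i w : Z k x *m T i w = - (w *m (B k *m B i)).
Proof.
have := gd_mul w (0 : 'M[R]_1) (- C w) (- C w) (dZ k Ux) (dB i Ux).
rewrite (gd_eq _ _ _ oU Ux (H := fun=> 0)) ?gd_cst0; last by move=> y; apply: Z_endo.
rewrite cov_Z -TE => /esym/eqP; rewrite addrC addr_eq0 => /eqP ->.
by rewrite mulmxA.
Qed.

Let Ric_reeb_reeb k i : Ric G x (Z k x) (Z i x) = - \tr (B k *m B i).
Proof.
rewrite Ric_T /mxtrace -sumrN; apply: eq_bigr => l _.
by rewrite Z_cov mxE -rowE [in LHS]mxE.
Qed.

Lemma Ric_reeb i u : Ric G x u (Z i x) =
  2 * (if i then p else q)%:R * (u *m (a i x)^T) 0 0.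
Proof.
pose al j := (u *m (a j x)^T) 0 0.
pose h := u - al true *: Z true x - al false *: Z false x.
have ha j : h *m (a j x)^T = 0.
  have E (c d : R) (M N P : 'M[R]_1) : (M - c *: N - d *: P) 0 0 =
      M 0 0 - c * N 0 0 - d * P 0 0 by rewrite !mxE.
  have E1 (b : bool) : (b%:R%:M : 'M[R]_1) 0 0 = b%:R by rewrite mxE mulr1n.
  apply: mx1_eqP; rewrite /h !mulmxBl -!scalemxAl !Za // E !E1 [RHS]mxE.
  by case: j; rewrite /= ?mulr1 ?mulr0 ?subr0 ?subrr.
have uE : u = al true *: Z true x + (al false *: Z false x + h).
  by rewrite /h [X in _ = _ + X]addrC subrK addrC subrK.
have RP := RicP oU G_smooth G_sym G_pos.
have e2 : Ric G x (al false *: Z false x + h) (Z i x) =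
    al false * (- \tr (B false *m B i)) + 0 :=
  etrans (RP x (al false) (Z false x) h (Z i x) Ux)
    (congr2 (fun s t => al false * s + t) (Ric_reeb_reeb false i) (Ric_horizontal i ha)).
have -> : Ric G x u (Z i x) =
    al true * (- \tr (B true *m B i)) + (al false * (- \tr (B false *m B i)) + 0).
  rewrite {1}uE; apply: etrans (RP x (al true) (Z true x) _ (Z i x) Ux) _.
  by rewrite e2 (Ric_reeb_reeb true i).
rewrite addr0; have orth0 j k : j != k -> \tr (B j *m B k) = 0.
  by move=> jk; have e : B j *m B k = 0 := endo_orth Ux jk; rewrite e mxtrace0.
have sq j : \tr (B j *m B j) = - (2 * (if j then p else q)%:R) := endo_trace j Ux.
rewrite -/(al i) {uE ha h e2}; case: i.
  by rewrite sq (orth0 false true isT) oppr0 mulr0 addr0 opprK mulrC.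
by rewrite sq (orth0 true false isT) oppr0 mulr0 add0r opprK mulrC.
Qed.

End Ricci.
End NormalContactPair.

(** * Metric contact pairs *)

Lemma pairing_mul (R : realType) (m : nat) (b w : 'rV[R]_m) : pairing b w = (w *m b^T) 0 0.
Proof. by rewrite /pairing mxE; apply: eq_bigr => i _; rewrite mxE mulrC. Qed.

Section InChart.
Variables (R : realType) (m p q : nat) (M : manifold R m).
Variables (S : metric_contact_pair M p q) (c : chart R m M).
Hypothesis S_normal : is_normal S.
Hypothesis c_atlas : atlas c.
Let U := chart_cod c.
Let a (i : bool) := if i then fcomp (alpha1 S) c else fcomp (alpha2 S) c.
Let Z (i : bool) := if i then vcomp (reeb1 S) c else vcomp (reeb2 S) c.
Let F := ecomp (phi S) c.
Let G := gcomp (metric S) c.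

Let oU : open U. Proof. by have [] := atlas_chart c_atlas. Qed.
Let a_smooth i : smooth_on U (a i). Proof. by case: i; apply: fcomp_smooth. Qed.
Let Z_smooth i : smooth_on U (Z i). Proof. by case: i; apply: vcomp_smooth. Qed.
Let F_smooth : smooth_on U F. Proof. exact: ecomp_smooth. Qed.
Let G_smooth : smooth_on U G. Proof. exact: gcomp_smooth. Qed.

Let G_sym y : U y -> (G y)^T = G y.
Proof. by move=> Uy; apply: bilinP => u v; rewrite bilin_tr; apply: gcomp_sym. Qed.

Let G_pos y : U y -> forall u : 'rV[R]_m, u != 0 -> 0 < bilin (G y) u u.
Proof. by move=> Uy; apply: gcomp_pos. Qed.

Let Za y i j : U y -> Z i y *m (a j y)^T = (i == j)%:R%:M.
Proof.
move=> Uy; rewrite [LHS]mx11_scalar -pairing_mul; congr (_%:M).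
by have [[e11 e12] [e21 e22] _ _] := mcp_reeb S c_atlas Uy; case: i; case: j.
Qed.

Let Zda y i j : U y -> Z i y *m dform (a j) y = 0.
Proof.
move=> Uy; apply: rowbilinP => v; rewrite mul0mx [RHS]mxE -bilinE.
rewrite -(dform_d_at (a_smooth j)) //.
have [_ _ d1 d2] := mcp_reeb S c_atlas Uy.
by case: i; case: j; [exact: (d1 v).1|exact: (d2 v).1|exact: (d1 v).2|exact: (d2 v).2].
Qed.

Let F_sqr y : U y -> F y *m F y = reeb_proj a Z y - 1%:M.
Proof.
move=> Uy; apply/row_matrixP => i; rewrite !rowE mulmxA; move: (delta_mx 0 i) => u.
have [-> _ _] := mcp_almost S c_atlas Uy.
rewrite mulmxBr mulmx1 /reeb_proj mulmxDr !mulmxA -addrA addrC !pairing_mul.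
by rewrite -!mul_scalar_mx -!mx11_scalar.
Qed.

Let ZF y i : U y -> Z i y *m F y = 0.
Proof. by move=> Uy; have [_ ? ?] := mcp_almost S c_atlas Uy; case: i. Qed.

Let GF y : U y -> G y *m (F y)^T = dform (a true) y + dform (a false) y.
Proof.
move=> Uy; apply: bilinP => u v; rewrite -bilin_mulr.
have [-> _ _] := mcp_associated S c_atlas Uy.
have := dform_d_at (a_smooth true) u v Uy; rewrite /a /= => ->.
have := dform_d_at (a_smooth false) u v Uy; rewrite /a /= => ->.
have add00 (A B : 'M[R]_1) : (A + B) 0 0 = A 0 0 + B 0 0 by rewrite mxE.
by rewrite !bilinE mulmxDr mulmxDl add00.
Qed.

Let GZ y i : U y -> G y *m (Z i y)^T = (a i y)^T.
Proof.
move=> Uy; apply: col_eqP => u; apply: mx1_eqP; rewrite mulmxA -bilinE -pairing_mul.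
have [_ e1 e2] := mcp_associated S c_atlas Uy; by case: i; [apply: e1|apply: e2].
Qed.

Let decomp y : U y -> forall u : 'rV[R]_m, u *m (a true y)^T = 0 ->
  u *m dform (a true) y = 0 -> u *m F y *m dform (a true) y = 0.
Proof.
move=> Uy u ua uda; have [+ _] := mcp_decomposable S c_atlas Uy u.
case=> [|_ Fu].
  split=> [|v]; first by rewrite pairing_mul ua mxE.
  by rewrite (dform_d_at (a_smooth true)) // bilinE uda mul0mx mxE.
apply: rowbilinP => v; rewrite mul0mx [RHS]mxE -bilinE.
by rewrite -(dform_d_at (a_smooth true)).
Qed.

Let rank_le i y n : U y ->
    (forall v, wedge_exp (mform2 (d_at (a i) y)) n.+1 v = 0) ->
  (\rank (dform (a i) y) <= n.*2)%N.
Proof.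
move=> Uy w0; apply: wedge_exp_rank; first exact: dform_skew.
suff -> : mform2 (bilin (dform (a i) y)) = mform2 (d_at (a i) y) by [].
by apply: funext => v; rewrite /mform2 (dform_d_at (a_smooth i)).
Qed.

Let rank_t y : U y -> (\rank (dform (a true) y) <= p.*2)%N.
Proof.
move=> Uy; apply: rank_le => //.
by have [_ _ _ /(_ c y c_atlas Uy)[]] := mcp_contact S.
Qed.

Let rank_f y : U y -> (\rank (dform (a false) y) <= q.*2)%N.
Proof.
move=> Uy; apply: rank_le => //.
by have [_ _ _ /(_ c y c_atlas Uy)[]] := mcp_contact S.
Qed.

Let mE : m = (2 * p + 2 * q + 2)%N. Proof. by have [] := mcp_contact S. Qed.
Let p_gt0 : (0 < p)%N. Proof. by have [] := mcp_contact S. Qed.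
Let q_gt0 : (0 < q)%N. Proof. by have [] := mcp_contact S. Qed.

Let d_rot y : U y -> differentiable (reeb_rot a Z) y.
Proof.
move=> Uy; apply: differentiable_addf; last apply: differentiable_oppf;
  (apply: differentiable_mulmx; first apply: differentiable_tr);
  apply: smooth_differentiable => //; exact.
Qed.

(** An integrable structure is given on all of the chart by a matrix field, but
    complex coordinates exist only near each point. *)
Let nij (J : 'rV[R]_m -> 'M[R]_m) (A : chart R m M -> 'rV[R]_m -> 'rV[R]_m -> 'rV[R]_m) :
    (forall y, U y -> differentiable J y) ->
    (forall y u, A c y u = u *m J y) -> integrable_acs A ->
  forall y, U y -> nijenhuis_free J y.
Proof.
move=> dJ AE intA y Uy.
have [n [V [psi [psi' [[oV Vy VU] [psiK opsi spsi spsi'] hol]]]]] := intA _ _ c_atlas Uy.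
apply: (complex_coord_nijenhuis oV psiK spsi spsi' _ Vy (dJ y Uy)).
by move=> z u Vz; rewrite -AE hol.
Qed.

Let nij_plus y : U y -> nijenhuis_free (fun y => F y + reeb_rot a Z y) y.
Proof.
apply: (nij _ _ S_normal.1) => [z Uz|z u].
  by apply: differentiable_addf; [apply: smooth_differentiable Uz|apply: d_rot].
rewrite /acs_J /reeb_rot mulmxDr mulmxBr !mulmxA !pairing_mul.
by rewrite -!mul_scalar_mx -!mx11_scalar addrA addrAC.
Qed.

Let nij_minus y : U y -> nijenhuis_free (fun y => F y - reeb_rot a Z y) y.
Proof.
apply: (nij _ _ S_normal.2) => [z Uz|z u].
  apply: differentiable_addf; first exact: smooth_differentiable Uz.
  by apply/differentiable_oppf/d_rot.
rewrite /acs_T /reeb_rot mulmxBr mulmxBr !mulmxA !pairing_mul opprB.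
by rewrite -!mul_scalar_mx -!mx11_scalar addrA.
Qed.

Variable x : 'rV[R]_m.
Hypothesis Ux : U x.
Let Rc := Ric_mx G x.

Let bilin_Z i u : bilin (G x) u (Z i x) = (u *m (a i x)^T) 0 0.
Proof. by rewrite bilinE -mulmxA GZ. Qed.

Let RcE u v : bilin Rc u v = Ric G x u v.
Proof. exact: (Ric_mxE oU G_smooth G_sym G_pos). Qed.

Let RcZ i u : bilin Rc u (Z i x) = 2 * (if i then p else q)%:R * bilin (G x) u (Z i x).
Proof.
have mE2 : m = (p.*2 + q.*2).+2 by rewrite mE; lia.
rewrite RcE bilin_Z; apply: (@Ric_reeb _ _ U a Z F G) => //.
Qed.

Let Rc_sym : Rc^T = Rc.
Proof.
apply: bilinP => u v; rewrite bilin_tr !RcE.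
exact: (Ric_sym oU G_smooth G_sym G_pos).
Qed.

Let s_diff (L : 'M[R]_m) :
  exists (E : 'M[R]_(\rank L, m)) (E' : 'M[R]_(\rank (orthocomp (G x) L), m)),
  [/\ (E == L)%MS /\ E *m G x *m E^T = 1%:M,
     (E' == orthocomp (G x) L)%MS /\ E' *m G x *m (E')^T = 1%:M &
     2 * (scal G x L - scal G x (orthocomp (G x) L)) =
     \sum_i bilin Rc (row i E) (row i E)
     - \sum_i bilin Rc (row i E') (row i E')].
Proof.
have K_sym u v : bilin (G x) (curv G x u v v) u = bilin (G x) (curv G x v u u) v.
  by rewrite -!cvtE (bilin_curv_pair oU G_smooth G_sym G_pos).
have K_diag u : bilin (G x) (curv G x u u u) u = 0.
  have := bilin_curv_skew G_smooth G_pos u u u u Ux.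
  by rewrite cvtE; move: (bilin _ _ _) => r; lra.
have RF k (E : 'M[R]_(k, m)) : frame (G x) E -> forall u,
    Ric G x u u = \sum_i bilin (G x) (curv G x (row i E) u u) (row i E).
  move=> frE u; rewrite (Ric_frame oU G_smooth G_sym G_pos u u Ux frE).
  by apply: eq_bigr => i _; rewrite cvtE.
have [E [E' [oE oE' ->]]] := scal_orthocomp (G_sym Ux) (G_pos Ux) K_sym K_diag RF L.
by exists E, E'; split=> //; congr (_ - _); apply: eq_bigr => i _; rewrite RcE.
Qed.

Let bilin_ZZ i j : bilin (G x) (Z i x) (Z j x) = (i == j)%:R.
Proof. by rewrite bilin_Z Za // mxE mulr1n. Qed.

Let pair1 u : pairing (alpha1 S c x) u = bilin (G x) u (Z true x).
Proof. by rewrite bilin_Z pairing_mul. Qed.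

Let pair2 u : pairing (alpha2 S c x) u = bilin (G x) u (Z false x).
Proof. by rewrite bilin_Z pairing_mul. Qed.

Lemma Ric_scal_conditions lambda beta mu :
    (forall u v, Ric G x u v = lambda * bilin (G x) u v
      + beta * (pairing (alpha1 S c x) u * pairing (alpha1 S c x) v)
      + mu * (pairing (alpha2 S c x) u * pairing (alpha2 S c x) v)) ->
  scal_conditions p q (G x) (reeb1 S c x) (reeb2 S c x) (scal G x) lambda.
Proof.
move=> qe.
have qe' : quasi_einstein_at (G x) Rc (Z true x) (Z false x) lambda beta mu.
  by move=> u v; rewrite RcE qe !pair1 !pair2.
exact: (quasi_einstein_scal mE p_gt0 q_gt0 (G_sym Ux) (G_pos Ux) (bilin_ZZ true true)
  (bilin_ZZ false false) (bilin_ZZ true false) (RcZ true) (RcZ false) s_diff qe').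
Qed.

Lemma scal_conditions_Ric lambda :
    scal_conditions p q (G x) (reeb1 S c x) (reeb2 S c x) (scal G x) lambda ->
  forall u v, Ric G x u v = lambda * bilin (G x) u v
    + (2 * p%:R - lambda) * (pairing (alpha1 S c x) u * pairing (alpha1 S c x) v)
    + (2 * q%:R - lambda) * (pairing (alpha2 S c x) u * pairing (alpha2 S c x) v).
Proof.
move=> cond u v; rewrite -RcE !pair1 !pair2.
by apply: (scal_quasi_einstein mE p_gt0 q_gt0 (G_sym Ux) (G_pos Ux) Rc_sym (bilin_ZZ true true)
  (bilin_ZZ false false) (bilin_ZZ true false) (RcZ true) (RcZ false) s_diff cond).
Qed.

End InChart.

Theorem theorem3p2 (R : realType) (m p q : nat) (M : manifold R m)
    (S : metric_contact_pair M p q) (S_normal : is_normal S) :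
  generalized_quasi_einstein S <->
  exists lambda : M -> R, forall (c : chart R m M) (Q : M),
    atlas c -> chart_dom c Q ->
    let x := c Q in
    let g := metric S c in
    let Z1 := reeb1 S c x in
    let Z2 := reeb2 S c x in
    let perp := orthocomp (g x) in
    [/\ forall P : 'M[R]_m, \rank P = (p + q + 1)%N ->
          (Z1 <= perp P)%MS -> (Z2 <= perp P)%MS ->
          scal g x P + p%:R + q%:R - lambda Q = scal g x (perp P),
        forall N : 'M[R]_m, \rank N = (p + q)%N ->
          (Z1 <= perp N)%MS -> (Z2 <= perp N)%MS ->
          scal g x N + p%:R + q%:R = scal g x (perp N) &
        forall K : 'M[R]_m, \rank K = (p + q + 1)%N ->
          (Z1 <= K)%MS -> (Z2 <= perp K)%MS ->
          scal g x K + q%:R - p%:R = scal g x (perp K)].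
Proof.
split=> [[lambda [beta [mu qe]]]|[lambda cond]].
  exists lambda => c Q cA cQ; have Ux : chart_cod c (c Q) by exists Q.
  exact: (Ric_scal_conditions S_normal cA Ux (qe c Q cA cQ)).
exists lambda, (fun Q => 2 * p%:R - lambda Q), (fun Q => 2 * q%:R - lambda Q).
move=> c Q cA cQ; have Ux : chart_cod c (c Q) by exists Q.
exact: (scal_conditions_Ric S_normal cA Ux (cond c Q cA cQ)).
Qed.
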